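(* (1) Two singular Brascamp-Lieb data $\mathbf{H}$ and $\mathbf{H}'$ are equivalent if and only if the associated modules $\mathbf{M}_{\mathbf{H}}$ and $\mathbf{M}_{\mathbf{H}'}$ are isomorphic. (2) For each module $\mathbf{M}$ there exists a singular Brascamp-Lieb datum $\mathbf{H}$ with $\mathbf{M}_{\mathbf{H}}\cong\mathbf{M}$. (3) For every singular Brascamp-Lieb datum $\mathbf{H}$ there exists a finite list $\mathbf{M}_1,\dots,\mathbf{M}_k$ of modules, each obtained from one of the modules $\mathbf{0},\mathbf{I},\mathbf{II},\mathbf{III},\mathbf{III}^*,\mathbf{IV},\mathbf{IV}^*,\mathbf{V},\mathbf{V}^*$ (listed in the context) by a permutation of the four subspaces, such that $$\mathbf{M}_{\mathbf{H}}\cong \mathbf{M}_1\oplus\dots\oplus\mathbf{M}_k .$$ This list is unique up to permutation (and isomorphism of its entries). (4) Conversely, for every finite list $\mathbf{M}_1,\dots,\mathbf{M}_k$ of such modules there exists a singular Brascamp-Lieb datum $\mathbf{H}$, unique up to equivalence, such that $\mathbf{M}_{\mathbf{H}}\cong \mathbf{M}_1\oplus\dots\oplus\mathbf{M}_k$.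
   Context: All vector spaces are finite dimensional over $\mathbb{R}$. A singular Brascamp-Lieb datum is a tuple $\mathbf{H}=(H;H_0,H_1,H_2,H_3;\Pi_0,\Pi_1,\Pi_2,\Pi_3)$ of finite dimensional Hilbert spaces $H,H_i$ and surjective linear maps $\Pi_i:H\to H_i$. Two data $\mathbf{H},\mathbf{H}'$ are equivalent if there are invertible linear maps $\varphi:H\to H'$, $\varphi_i:H_i\to H_i'$ with $\Pi_i'\circ\varphi=\varphi_i\circ\Pi_i$ for $i=0,1,2,3$. A module is a tuple $\mathbf{M}=(M;M_0,M_1,M_2,M_3)$ of a finite dimensional vector space $M$ and four subspaces $M_i\subseteq M$. Modules $\mathbf{M},\mathbf{M}'$ are isomorphic ($\mathbf{M}\cong\mathbf{M}'$) if there is an invertible linear $\psi:M\to M'$ with $\psi(M_i)=M_i'$ for $i=0,1,2,3$. Direct sums of modules are taken componentwise. The module associated with $\mathbf{H}$ is $\mathbf{M}_{\mathbf{H}}=(H^*;\Pi_0^*H_0^*,\Pi_1^*H_1^*,\Pi_2^*H_2^*,\Pi_3^*H_3^* )$, where ${}^*$ denotes dual spaces and adjoint maps. Matrix notation: $I_n$ is the $n\times n$ identity; $J_n(\lambda)$ is the $n\times n$ Jordan block with eigenvalue $\lambda$ (ones on the superdiagonal); an arrow superscript means that one zero row or column is added on the side the arrow points to (e.g. $I_n^{\uparrow}$ is $(n+1)\times n$ with a zero row on top of $I_n$; $I_n^{\leftarrow}$ is $n\times(n+1)$ with a zero column to the left of $I_n$). $[A;B]$ denotes the matrix with block rows $A$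 and $B$ (top to bottom), and $[A;B;C]$ similarly. $X$ denotes the $n\times n$ companion matrix of a polynomial $P(t)^s$ of degree $n$, where $s\ge1$ and $P\in\mathbb{R}[t]$ is monic irreducible with $P(t)\ne t$ and $P(t)\neq t-1$. $10\ldots0$ denotes the row vector $(1,0,\dots,0)$. Each module below has $M=\mathbb{R}^N$ and $M_0,M_1,M_2,M_3$ equal to the column spaces of the four listed matrices, in order: $\mathbf{0}$ ($n\ge1$, $N=2n$): $[I_n;0],\ [0;I_n],\ [I_n;I_n],\ [X;I_n]$. $\mathbf{I}$ ($n\ge1$, $N=2n$): $[I_n;0],\ [0;I_n],\ [I_n;I_n],\ [J_n(0);I_n]$. $\mathbf{II}$ ($n\ge0$, $N=2n+1$): $[I_{n+1};0],\ [I_{n+1};I_n^{\rightarrow}],\ [I_n^{\downarrow};I_n],\ [0;I_n]$. $\mathbf{III}$ ($n\ge0$, $N=2n+1$): $[I_{n+1};0],\ [0;I_n],\ [I_n^{\uparrow};I_n],\ [I_n^{\downarrow};I_n]$. $\mathbf{III}^*$ ($n\ge0$, $N=2n+1$): $[I_n;0],\ [0;I_{n+1}],\ [I_n^{\leftarrow};I_{n+1}],\ [I_n^{\rightarrow};I_{n+1}]$. $\mathbf{IV}$ ($n\ge0$, $N=2n+2$): $[I_{n+1};0],\ [0;I_{n+1}],\ [I_{n+1};I_{n+1}],\ [I_n^{\uparrow};I_n^{\downarrow}]$. $\mathbf{IV}^*$ ($n\ge0$, $N=2n+2$): $[I_{n+1};0],\ [0;I_{n+1}],\ [I_{n+1};I_{n+1}],\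 [I_{n+1}^{\leftarrow};I_{n+1}^{\rightarrow}]$. $\mathbf{V}$ ($n\ge0$, $N=2n+1$): $[I_n;0;0],\ [0;I_n;0],\ [J_n(0);I_n;10\ldots0],\ [I_n;J_n(0);10\ldots0]$. $\mathbf{V}^*$ ($n\ge0$, $N=2n+1$): $[I_n^{\leftarrow};0;10\ldots0],\ [I_n^{\leftarrow};I_n^{\rightarrow};10\ldots0],\ [I_n^{\rightarrow};I_n^{\leftarrow};10\ldots0],\ [0;I_n^{\leftarrow};10\ldots0]$.
   Formalization: In module II the third matrix is taken as [I_n^↑; I_n] instead of the printed [I_n^↓; I_n]; as printed, II decomposes for n ≥ 1 into II with n = 0 and permuted copies of I with n = 1, so the uniqueness in (3) fails. *)

(* Defs.v *)
From HB Require Import structures.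
From mathcomp Require Import all_boot all_order all_fingroup all_algebra.
From mathcomp Require Import reals.

Set Implicit Arguments.
Unset Strict Implicit.
Unset Printing Implicit Defensive.

Import Order.TTheory GRing.Theory Num.Theory.

Local Open Scope ring_scope.

(* Completeness is automatic in finite dimension. *)
Record hilbert (R : realType) := Hilbert {
  hilbert_vect :> vectType R;
  hilbert_dot : {dot hilbert_vect for idfun}
}.

Record bl_datum (R : realType) := BLDatum {
  bl_dom : hilbert R;
  bl_cod : 'I_4 -> hilbert R;
  bl_map : forall i, 'Hom(bl_dom, bl_cod i);
  bl_surj : forall i, limg (bl_map i) = fullv
}.

(* Only the linear structure is compared, the maps need not be isometries. *)
Definition bl_equiv (R : realType) (H H' : bl_datum R) : Prop :=
  exists (phi : 'Hom(bl_dom H, bl_dom H'))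
         (phi_ : forall i, 'Hom(bl_cod H i, bl_cod H' i)),
    [/\ bijective phi,
        forall i, bijective (phi_ i) &
        forall i, (bl_map H' i \o phi = phi_ i \o bl_map H i)%VF].

Record module4 (R : realType) := Module4 {
  m4_vect :> vectType R;
  m4_sub : 'I_4 -> {vspace m4_vect}
}.

Definition m4_iso (R : realType) (M M' : module4 R) : Prop :=
  exists psi : 'Hom(M, M'),
    bijective psi /\ forall i, (psi @: m4_sub M i)%VS = m4_sub M' i.

Definition m4_perm (R : realType) (s : 'S_4) (M : module4 R) : module4 R :=
  Module4 (fun i => m4_sub M (s i)).

Definition m4_zero (R : realType) : module4 R :=
  @Module4 R 'rV[R]_0 (fun=> 0%VS).

Definition prodv (R : realType) (V W : vectType R)
    (A : {vspace V}) (B : {vspace W}) : {vspace V * W} :=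
  (linfun (@fst V W) @^-1: A :&: linfun (@snd V W) @^-1: B)%VS.

Lemma memv_prodv (R : realType) (V W : vectType R)
    (A : {vspace V}) (B : {vspace W}) (u : V * W) :
  (u \in prodv A B) = (u.1 \in A) && (u.2 \in B).
Proof. by rewrite memv_cap -!memv_preim !lfunE. Qed.

Definition m4_add (R : realType) (M M' : module4 R) : module4 R :=
  @Module4 R (m4_vect M * m4_vect M')%type
    (fun i => prodv (m4_sub M i) (m4_sub M' i)).

Definition m4_sum (R : realType) (k : nat) (M : 'I_k -> module4 R) :
    module4 R :=
  \big[@m4_add R/m4_zero R]_(i < k) M i.

Section Adjoint.
Variables (R : realType) (V W : vectType R) (f : 'Hom(V, W)).

Definition adjoint_fun (w : 'Hom(W, R^o)) : 'Hom(V, R^o) := (w \o f)%VF.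

Fact adjoint_fun_is_linear : linear adjoint_fun.
Proof.
by move=> a u v; rewrite /adjoint_fun comp_lfunDl comp_lfunZl.
Qed.

HB.instance Definition _ :=
  GRing.isLinear.Build R 'Hom(W, R^o) 'Hom(V, R^o) _ adjoint_fun
    adjoint_fun_is_linear.

Definition adjoint : 'Hom('Hom(W, R^o), 'Hom(V, R^o)) := linfun adjoint_fun.

Lemma adjointE w : adjoint w = (w \o f)%VF.
Proof. by rewrite lfunE. Qed.
End Adjoint.

Definition bl_module (R : realType) (H : bl_datum R) : module4 R :=
  @Module4 R 'Hom(bl_dom H, R^o) (fun i => limg (adjoint (bl_map H i))).

Section Matrices.
Variable R : realType.

Definition jordan_block n (lambda : R) : 'M[R]_n :=
  \matrix_(i, j) (lambda *+ (i == j) + (i.+1 == j :> nat)%:R).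

(* The identity matrix with one zero row or column added: on top, at the
   bottom, on the left, on the right. *)
Definition id_up n : 'M[R]_(n.+1, n) :=
  \matrix_(i, j) (i == j.+1 :> nat)%:R.
Definition id_down n : 'M[R]_(n.+1, n) :=
  \matrix_(i, j) (i == j :> nat)%:R.
Definition id_left n : 'M[R]_(n, n.+1) :=
  \matrix_(i, j) (i.+1 == j :> nat)%:R.
Definition id_right n : 'M[R]_(n, n.+1) :=
  \matrix_(i, j) (i == j :> nat)%:R.

Definition row10 n : 'rV[R]_n := \row_j (j == 0 :> nat)%:R.

Definition colspace m n (A : 'M[R]_(m, n)) : {vspace 'cV[R]_m} :=
  limg (linfun (mulmx A : 'cV[R]_n -> 'cV[R]_m)).

Definition m4_of_mx N d0 d1 d2 d3 (A0 : 'M[R]_(N, d0)) (A1 : 'M[R]_(N, d1))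
    (A2 : 'M[R]_(N, d2)) (A3 : 'M[R]_(N, d3)) : module4 R :=
  Module4 (tnth [tuple colspace A0; colspace A1; colspace A2; colspace A3]).

Definition m4_0 n (X : 'M[R]_n) : module4 R :=
  m4_of_mx (col_mx 1%:M 0 : 'M_(n + n, n))
           (col_mx 0 1%:M : 'M_(n + n, n))
           (col_mx 1%:M 1%:M)
           (col_mx X 1%:M).

Definition m4_I n : module4 R :=
  m4_of_mx (col_mx 1%:M 0 : 'M_(n + n, n))
           (col_mx 0 1%:M : 'M_(n + n, n))
           (col_mx 1%:M 1%:M)
           (col_mx (jordan_block n 0) 1%:M).

(* With [id_down n] in place of [id_up n] in the third matrix (a misprint one
   can meet), the columns of the third matrix would be the first n columns of
   the second one, and for n >= 1 the module would decompose as the direct sum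
   of the one for n = 0 and of n copies of R^2 with the lines spanned by
   (1,0), (1,1), (1,1), (0,1). *)
Definition m4_II n : module4 R :=
  m4_of_mx (col_mx 1%:M 0 : 'M_(n.+1 + n, n.+1))
           (col_mx 1%:M (id_right n))
           (col_mx (id_up n) 1%:M)
           (col_mx 0 1%:M : 'M_(n.+1 + n, n)).

Definition m4_III n : module4 R :=
  m4_of_mx (col_mx 1%:M 0 : 'M_(n.+1 + n, n.+1))
           (col_mx 0 1%:M : 'M_(n.+1 + n, n))
           (col_mx (id_up n) 1%:M)
           (col_mx (id_down n) 1%:M).

Definition m4_IIIs n : module4 R :=
  m4_of_mx (col_mx 1%:M 0 : 'M_(n + n.+1, n))
           (col_mx 0 1%:M : 'M_(n + n.+1, n.+1))
           (col_mx (id_left n) 1%:M)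
           (col_mx (id_right n) 1%:M).

Definition m4_IV n : module4 R :=
  m4_of_mx (col_mx 1%:M 0 : 'M_(n.+1 + n.+1, n.+1))
           (col_mx 0 1%:M : 'M_(n.+1 + n.+1, n.+1))
           (col_mx 1%:M 1%:M)
           (col_mx (id_up n) (id_down n)).

Definition m4_IVs n : module4 R :=
  m4_of_mx (col_mx 1%:M 0 : 'M_(n.+1 + n.+1, n.+1))
           (col_mx 0 1%:M : 'M_(n.+1 + n.+1, n.+1))
           (col_mx 1%:M 1%:M)
           (col_mx (id_left n.+1) (id_right n.+1)).

Definition m4_V n : module4 R :=
  m4_of_mx (col_mx 1%:M (col_mx 0 0) : 'M_(n + (n + 1), n))
           (col_mx 0 (col_mx 1%:M 0) : 'M_(n + (n + 1), n))
           (col_mx (jordan_block n 0) (col_mx 1%:M (row10 n)))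
           (col_mx 1%:M (col_mx (jordan_block n 0) (row10 n))).

Definition m4_Vs n : module4 R :=
  m4_of_mx
    (col_mx (id_left n) (col_mx 0 (row10 n.+1)) : 'M_(n + (n + 1), n.+1))
    (col_mx (id_left n) (col_mx (id_right n) (row10 n.+1)))
    (col_mx (id_right n) (col_mx (id_left n) (row10 n.+1)))
    (col_mx 0 (col_mx (id_left n) (row10 n.+1)) : 'M_(n + (n + 1), n.+1)).

End Matrices.

(* In case 0 the size n of the companion matrix is the degree of P ^+ s. *)
Inductive m4_table (R : realType) : module4 R -> Prop :=
| Table_0 (P : {poly R}) (s : nat) of
    (1 <= s)%N & P \is monic & irreducible_poly P & P != 'X & P != 'X - 1 :
    m4_table (m4_0 (companionmx (P ^+ s)))
| Table_I n of (1 <= n)%N : m4_table (m4_I R n)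
| Table_II n : m4_table (m4_II R n)
| Table_III n : m4_table (m4_III R n)
| Table_IIIs n : m4_table (m4_IIIs R n)
| Table_IV n : m4_table (m4_IV R n)
| Table_IVs n : m4_table (m4_IVs R n)
| Table_V n : m4_table (m4_V R n)
| Table_Vs n : m4_table (m4_Vs R n).

Definition m4_listed (R : realType) (M : module4 R) : Prop :=
  exists (s : 'S_4) (M' : module4 R), m4_table M' /\ M = m4_perm s M'.

(* Main.v *)
Require Import Defs.
From HB Require Import structures.
From mathcomp Require Import all_boot all_order all_fingroup all_algebra.
From mathcomp Require Import reals boolp zify.

(* By duality a datum is the same thing as a module, so the content is the
   classification of quadruples of subspaces and its uniqueness.

   Uniqueness is the Krull-Schmidt theorem (Fitting's lemma makes endomorphism
   rings of indecomposables local), once every listed module is shown to be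
   indecomposable, by computing its endomorphisms.

   For existence, let the defect of an indecomposable M be the sum of the
   dimensions of the M_i minus 2 dim M.  The Coxeter functor, sending M to the
   kernel of M_0 + M_1 + M_2 + M_3 -> M with the subspaces where one coordinate
   vanishes, is fully faithful on the indecomposables with M the sum of any three
   of the M_i; the others are one-dimensional with at most one nonzero M_i.  It
   keeps the defect and adds it to dim M, so a negative defect forces, by
   induction, the dimensions of a member of the list and determines M from them.
   Positive defect follows by duality.

   For defect zero, take x <> 0 in M_a and M_b.  The summands of M/x have defect
   zero, as M has no nonzero map to an indecomposable of negative defect.  A
   summand in which M_c and M_d are complementary would lift to a summand of M;
   by induction none exists, whence M_a and M_b both meet M_c and M_d trivially.
   For a = 0, b = 1, this makes M_1 and M_3 the graphs of the two components of an
   odd nilpotent endomorphism of M = M_0 + M_2, and M is a single string: types I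
   and II.  If instead all the intersections are trivial, M is given by an
   operator commuting with no nontrivial idempotent, i.e. the companion matrix of
   a power of an irreducible polynomial: type 0. *)

Set Implicit Arguments.
Unset Strict Implicit.
Unset Printing Implicit Defensive.

Import Order.TTheory GRing.Theory Num.Theory.

Local Open Scope ring_scope.

(** * Morphisms, indecomposability and Fitting's lemma *)

Section LinearMaps.
Variable R : realType.
Implicit Types U V W : vectType R.

(** The Coxeter functor is the engine only when the defect is nonzero: in defect zero it keeps dim
    M, and dimensions no longer determine the module, so another descent is needed. Dividing by a
    line x inside M_a and M_b lowers dim M by one and the sum of the dim M_i by at least two. A
    summand Q of M/x with Q_c and Q_d complementary lifts to M because a lift may be prescribed on
    Q_c and Q_d separately, while on Q_a and Q_b it is ambiguous only by multiples of x, which lie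
    in both M_a and M_b. The lift would identify Q with all of M, although x dies in Q. In the case
    of trivial intersections the operator may have no real eigenvalue, so there is no Jordan form to
    rely on. Indecomposability first gives a minimal polynomial P^s, and cyclicity is then extracted
    from a Hankel matrix. In type 0, P = t and P = t - 1 would make M_3 meet M_1 and M_2
    respectively, which is why these two polynomials are left to type I. *)

Lemma lfun_of_linear U V (f : U -> V) :
  linear f -> exists g : 'Hom(U, V), g =1 f.
Proof.
move=> f_lin; pose fM := GRing.isLinear.Build R U V _ f f_lin.
pose fL : {linear U -> V} := HB.pack f fM.
by exists (linfun fL) => x; rewrite lfunE.
Qed.

(** [q \o projv A] has image [q @: A], so its inverse there, projected to [A], is a section with
    values in [A]. *)
Lemma lfun_section U V (q : 'Hom(U, V)) (A : {vspace U}) :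
  exists t : 'Hom(V, U), forall w, w \in (q @: A)%VS -> t w \in A /\ q (t w) = w.
Proof.
exists (projv A \o (q \o projv A)^-1)%VF => w Aw; split.
  by rewrite comp_lfunE memv_proj.
have wl : w \in limg (q \o projv A) by rewrite limg_comp limg_proj.
by rewrite comp_lfunE -[LHS]comp_lfunE limg_lfunVK.
Qed.

Lemma functional_sep V (A : {vspace V}) (x : V) :
  x \notin A ->
  exists h : 'Hom(V, R^o), h x = 1 /\ forall a, a \in A -> h a = 0.
Proof.
move=> Ax; set y := x - projv A x.
have y0 : y != 0 by apply: contra Ax => /eqP/subr0_eq ->; rewrite memv_proj.
have [g gE] := lfun_of_linear (linearP (coord (in_tuple [:: y]) 0 : {linear V -> R^o})).
exists (g \o (\1 - projv A))%VF; split => [|a Aa].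
  rewrite comp_lfunE !lfun_simp /= gE.
  rewrite -/y; have := @coord_free _ _ _ (in_tuple [:: y]) 0 0.
  by rewrite seq1_free => /(_ y0).
by rewrite comp_lfunE !lfun_simp /= projv_id // subrr linear0.
Qed.

(** The quotient is modelled by a complement of [A], the image of [\1 - projv A]. *)
Lemma quot_exists V (A : {vspace V}) :
  exists (W : vectType R) (q : 'Hom(V, W)), limg q = fullv /\ lker q = A.
Proof.
pose p := (\1 - projv A)%VF.
have [q qE] := lfun_of_linear (linearP (vsproj (limg p) : {linear V -> _})).
have qp x : vsval ((q \o p)%VF x) = p x.
  by rewrite comp_lfunE qE vsprojK // memv_img ?memvf.
exists (subvs_of (limg p)), (q \o p)%VF; split.
  apply/eqP; rewrite eqEsubv subvf; apply/subvP => w _.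
  have /memv_imgP[u _ wu] := subvsP w.
  apply/memv_imgP; exists u; first exact: memvf.
  by apply: val_inj; rewrite /= qp.
apply/vspaceP => x; rewrite memv_ker.
have -> : ((q \o p)%VF x == 0) = (p x == 0).
  by apply/eqP/eqP => [px0|px0]; [rewrite -qp px0|apply: val_inj; rewrite /= qp].
rewrite !lfun_simp /= subr_eq0; apply/eqP/idP => [->|/projv_id //].
exact: memv_proj.
Qed.

Fixpoint lpow V (f : 'End(V)) k : 'End(V) :=
  if k is k'.+1 then (f \o lpow f k')%VF else \1%VF.

Lemma lpowE V (f : 'End(V)) k x : lpow f k x = iter k f x.
Proof. by elim: k => [|k IH] /=; rewrite lfun_simp // /= IH. Qed.

(** The images of [A] under the powers of [f] decrease, and strictly in dimension until they become
    constant, so [\dim A] steps suffice. *)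
Lemma lpow_img_stable V (f : 'End(V)) (A : {vspace V}) n m :
  (f @: A <= A)%VS -> (\dim A <= n)%N -> (lpow f (n + m) @: A = lpow f n @: A)%VS.
Proof.
have lpowSr k : lpow f k.+1 = (lpow f k \o f)%VF.
  by apply/lfunP => x; rewrite comp_lfunE !lpowE iterSr.
elim: n A => [|n IH] A fA dA.
  by move: dA; rewrite leqn0 dimv_eq0 => /eqP->; rewrite !limg0.
have [fAA|nfA] := eqVneq (f @: A)%VS A.
  have fix_k k : (lpow f k @: A = A)%VS.
    by elim: k => [|k IHk] /=; rewrite ?lim1g // limg_comp IHk fAA.
  by rewrite !fix_k.
rewrite addSn !lpowSr !limg_comp IH //; first exact: limgS.
by rewrite -ltnS (leq_trans _ dA) // ltn_neqAle dimv_leqif_eq // nfA dimvS.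
Qed.

Lemma lfun_inj_surj V W (f : 'Hom(V, W)) :
  injective f -> limg f = fullv ->
  exists g : 'Hom(W, V), cancel f g /\ cancel g f.
Proof.
move=> /lker0P kf lf; exists f^-1%VF; split; first exact: lker0_lfunK.
by move=> w; rewrite limg_lfunVK // lf memvf.
Qed.

Lemma lfun_bij_inv V W (f : 'Hom(V, W)) :
  bijective f -> exists g : 'Hom(W, V), cancel f g /\ cancel g f.
Proof.
move=> [g fK gK]; apply: lfun_inj_surj; first exact: can_inj fK.
by apply/vspaceP => w; rewrite memvf; apply/memv_imgP; exists (g w); rewrite ?memvf ?gK.
Qed.

Lemma daddv_pi0 V (A B : {vspace V}) w :
  (A :&: B = 0)%VS -> w \in B -> daddv_pi A B w = 0.
Proof.
move=> dAB Bw; have := daddv_pi_add dAB (subvP (addvSr A B) _ Bw).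
by rewrite [daddv_pi B A w]daddv_pi_id // 1?capvC // => /(canRL (addrK _)); rewrite subrr.
Qed.

Lemma dim_prodv V W (A : {vspace V}) (B : {vspace W}) :
  \dim (prodv A B) = (\dim A + \dim B)%N.
Proof.
have [f fE] := lfun_of_linear (linearP (@fst V W : {linear (V * W)%type -> V})).
have [g gE] : exists g : 'Hom(W, (V * W)%type), g =1 (fun w => (0, w)).
  by apply: lfun_of_linear => a u v; apply: injective_projections; rewrite /= ?scaler0 ?addr0.
rewrite -(limg_ker_dim f) addnC; congr (_ + _)%N; last first.
  have -> : (prodv A B :&: lker f = g @: B)%VS.
    apply/vspaceP => -[v w]; rewrite memv_cap memv_prodv memv_ker fE /=.
    apply/andP/memv_imgP => [[/andP[_ Bw] /eqP->]|[u Bu]]; first by exists w; rewrite ?gE.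
    by rewrite gE => -[-> ->]; rewrite mem0v.
  rewrite limg_dim_eq //; apply/eqP; rewrite -subv0; apply/subvP => w.
  by rewrite memv_cap memv_ker gE => /andP[_ /eqP[->]]; rewrite mem0v.
congr (\dim _); apply/vspaceP => v; apply/memv_imgP/idP => [[[v' w]]|Av].
  by rewrite memv_prodv fE => /andP[/= Av _] ->.
by exists (v, 0); rewrite ?fE // memv_prodv /= Av mem0v.
Qed.

End LinearMaps.

Section Homs.
Variable R : realType.
Implicit Types L M N Q : module4 R.

Definition m4_hom M N (f : 'Hom(M, N)) : Prop :=
  forall i x, x \in m4_sub M i -> f x \in m4_sub N i.

(** The inverse is carried along as a morphism, so that isomorphisms can be composed and cut into
    blocks without returning to images. *)
Definition m4_inv M N (f : 'Hom(M, N)) (g : 'Hom(N, M)) : Prop :=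
  [/\ m4_hom f, m4_hom g, cancel f g & cancel g f].

Lemma m4_isoP M N :
  m4_iso M N <-> exists (f : 'Hom(M, N)) (g : 'Hom(N, M)), m4_inv f g.
Proof.
split=> [[f [/lfun_bij_inv[g [fK gK]] fM]]|[f [g [fM gM fK gK]]]].
  exists f, g; split=> // i x xi; first by rewrite -fM memv_img.
  by move: xi; rewrite -fM => /memv_imgP[y yi ->]; rewrite fK.
exists f; split; first by exists g.
move=> i; apply/vspaceP => x; apply/memv_imgP/idP => [[y yi ->]|xi]; first exact: fM.
by exists (g x); rewrite ?gK ?gM.
Qed.

Lemma m4_hom_id M : m4_hom (\1%VF : 'End(M)).
Proof. by move=> i x xi; rewrite lfunE. Qed.

Lemma m4_hom_comp L M N (f : 'Hom(M, N)) (g : 'Hom(L, M)) :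
  m4_hom f -> m4_hom g -> m4_hom (f \o g)%VF.
Proof. by move=> fM gM i x xi; rewrite comp_lfunE fM ?gM. Qed.

Lemma m4_hom_add M N (f g : 'Hom(M, N)) : m4_hom f -> m4_hom g -> m4_hom (f + g).
Proof. by move=> fM gM i x xi; rewrite add_lfunE rpredD ?fM ?gM. Qed.

Lemma m4_hom_opp M N (f : 'Hom(M, N)) : m4_hom f -> m4_hom (- f).
Proof. by move=> fM i x xi; rewrite opp_lfunE rpredN fM. Qed.

Lemma m4_inv_sym M N (f : 'Hom(M, N)) g : m4_inv f g -> m4_inv g f.
Proof. by case. Qed.

Lemma m4_inv_comp L M N (f : 'Hom(M, N)) f' (g : 'Hom(L, M)) g' :
  m4_inv f f' -> m4_inv g g' -> m4_inv (f \o g)%VF (g' \o f')%VF.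
Proof.
move=> [fM f'M fK f'K] [gM g'M gK g'K]; split; try exact: m4_hom_comp.
  by move=> x; rewrite !comp_lfunE fK gK.
by move=> x; rewrite !comp_lfunE g'K f'K.
Qed.

Lemma m4_iso_refl M : m4_iso M M.
Proof.
by apply/m4_isoP; exists \1%VF, \1%VF; split; try exact: m4_hom_id; move=> x; rewrite !lfunE.
Qed.

Lemma m4_iso_sym M N : m4_iso M N -> m4_iso N M.
Proof. by move=> /m4_isoP[f [g fg]]; apply/m4_isoP; exists g, f; apply: m4_inv_sym. Qed.

Lemma m4_iso_trans L M N : m4_iso L M -> m4_iso M N -> m4_iso L N.
Proof.
move=> /m4_isoP[f [g fg]] /m4_isoP[f' [g' fg']]; apply/m4_isoP.
by exists (f' \o f)%VF, (g \o g')%VF; apply: m4_inv_comp.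
Qed.

Definition m4_dim M := \dim {:M}.
Definition m4_subdim M i := \dim (m4_sub M i).
Definition m4_total M := (\sum_i m4_subdim M i)%N.

Lemma m4_subdim_le M i : (m4_subdim M i <= m4_dim M)%N.
Proof. exact: dimvS (subvf _). Qed.

Lemma m4_iso_dim M N : m4_iso M N ->
  m4_dim M = m4_dim N /\ m4_subdim M =1 m4_subdim N.
Proof.
move=> [f [/lfun_bij_inv[g [fK gK]] fM]].
have kf : lker f = 0%VS by apply/eqP/lker0P/(can_inj fK).
split=> [|i]; last by rewrite /m4_subdim -fM limg_dim_eq // kf capv0.
rewrite /m4_dim -(limg_dim_eq (U := {:M}) (f := f)) ?kf ?capv0 //; congr (\dim _).
by apply/vspaceP => w; rewrite memvf; apply/memv_imgP; exists (g w); rewrite ?memvf ?gK.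
Qed.

Lemma m4_iso_total M N : m4_iso M N -> m4_total M = m4_total N.
Proof. by move=> /m4_iso_dim[_ dMN]; apply: eq_bigr => i _; apply: dMN. Qed.

(* A bijective morphism maps each subspace injectively, so equality of the
   total dimensions forces it to be onto on each of them. *)
Lemma m4_iso_of_total M N (f : 'Hom(M, N)) :
  m4_hom f -> injective f -> limg f = fullv -> (m4_total N <= m4_total M)%N ->
  exists g, m4_inv f g.
Proof.
move=> fM /lker0P kf lf leNM.
have dimf i : \dim (f @: m4_sub M i) = m4_subdim M i.
  by rewrite limg_dim_eq // (eqP kf) capv0.
have sub i : (f @: m4_sub M i <= m4_sub N i)%VS.
  by apply/subvP => _ /memv_imgP[x xi ->]; apply: fM.
have le i : (m4_subdim M i <= m4_subdim N i)%N by rewrite -dimf dimvS.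
have deq i : m4_subdim M i = m4_subdim N i.
  apply/eqP; rewrite eqn_leq le /=; move: leNM.
  rewrite /m4_total (bigD1 i) //= [X in (_ <= X)%N](bigD1 i) //= => leNM.
  rewrite -(leq_add2r (\sum_(j < 4 | j != i) m4_subdim M j)).
  by apply: leq_trans leNM; rewrite leq_add2l leq_sum.
have eqi i : (f @: m4_sub M i = m4_sub N i)%VS.
  by apply/eqP; rewrite eqEdim sub dimf deq leqnn.
have fK := lker0_lfunK kf.
exists f^-1%VF; split=> // [i x|x]; last by rewrite limg_lfunVK // lf memvf.
by rewrite -eqi => /memv_imgP[y yi ->]; rewrite fK.
Qed.

Lemma lfun_inj_dim (V W : vectType R) (f : 'Hom(V, W)) :
  injective f -> (\dim {:W} <= \dim {:V})%N -> limg f = fullv.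
Proof.
move=> /lker0P/eqP kf dWV; apply/eqP; rewrite eqEdim subvf.
by rewrite limg_dim_eq ?kf ?capv0.
Qed.

(** Phrased by idempotent endomorphisms: a decomposition is the same as such an idempotent
    ([m4_split]), and for modules given by matrices this form can be computed. *)
Definition indec M : Prop :=
  (exists x : M, x != 0) /\
  forall e : 'End(M), m4_hom e -> (forall x, e (e x) = e x) ->
    (forall x, e x = 0) \/ (forall x, e x = x).

Lemma indec_dim M : indec M -> (0 < m4_dim M)%N.
Proof.
move=> [[x x0] _]; rewrite lt0n dimv_eq0; apply: contra x0 => /eqP M0.
by rewrite -memv0 -M0 memvf.
Qed.

Lemma indec_iso M N : m4_iso M N -> indec M -> indec N.
Proof.
move=> /m4_isoP[f [g [fM gM fK gK]]] [[x x0] iM]; split.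
  by exists (f x); apply: contra x0 => /eqP fx0; rewrite -[x]fK fx0 linear0.
move=> e eM ee.
have e'M : m4_hom (g \o (e \o f))%VF by do 2![apply: m4_hom_comp => //].
have [y|e0|e1] := iM _ e'M; first by rewrite !comp_lfunE gK ee.
  by left=> y; have := e0 (g y); rewrite !comp_lfunE gK -[RHS](linear0 g) => /(can_inj gK).
by right=> y; have := e1 (g y); rewrite !comp_lfunE gK => /(can_inj gK).
Qed.

(** [s \o r] is an idempotent endomorphism of [M], and it is not zero because [r] recovers [Q] from
    it. *)
Lemma retract_inv M Q (s : 'Hom(Q, M)) (r : 'Hom(M, Q)) :
  indec M -> (exists x : Q, x != 0) -> m4_hom s -> m4_hom r -> cancel s r ->
  m4_inv s r.
Proof.
move=> [_ iM] [x x0] sM rM sK; split=> // y.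
have [z|e0|e1] := iM _ (m4_hom_comp sM rM); first by rewrite !comp_lfunE sK.
  by move: x0; rewrite -[x]sK -[s x]/(s x) -{1}[x]sK -[s _]comp_lfunE e0 linear0 eqxx.
by rewrite -[RHS]e1 comp_lfunE.
Qed.

(** For [F] the power of [f] with exponent dim M, the image and the kernel of [F] are complementary.
    The projection [e] onto the image is an idempotent endomorphism, hence 0, and [f] is nilpotent,
    or 1, and [f] is injective. *)
Lemma fitting M (f : 'End(M)) : indec M -> m4_hom f ->
  (exists k, forall x, iter k f x = 0) \/ exists g, m4_inv f g.
Proof.
move=> [_ iM] fM; set n := \dim {:M}; set F := lpow f n.
have FF : (F \o F)%VF = lpow f (n + n).
  by apply/lfunP => x; rewrite comp_lfunE !lpowE iterD.
have FFU (A : {vspace M}) : (f @: A <= A -> F @: (F @: A) = F @: A)%VS.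
  by move=> fA; rewrite -limg_comp FF lpow_img_stable // dimvS ?subvf.
have FM : m4_hom F.
  by rewrite /F; elim: n {F FF FFU} => [|k IH] /=; [apply: m4_hom_id|apply: m4_hom_comp].
set A := lker F; set B := limg F.
have dBA : (B :&: A = 0)%VS.
  apply/eqP; rewrite -dimv_eq0 -(eqn_add2r (\dim (F @: B))) limg_ker_dim FFU //.
  exact: subvf.
pose e := daddv_pi B A.
have eF y : e (F y) = F y by rewrite /e daddv_pi_id // memv_img ?memvf.
(* The images of M_i are stable too, so for x in M_i there is y in M_i with F (F y) = F x; then x -
   F y lies in the kernel and e x = F y lies in M_i. *)
have eM : m4_hom e.
  move=> i x xi; have fMi : (f @: m4_sub M i <= m4_sub M i)%VS.
    by apply/subvP => _ /memv_imgP[y yi ->]; apply: fM.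
  have : F x \in (F @: (F @: m4_sub M i))%VS by rewrite FFU // memv_img.
  move=> /memv_imgP[_ /memv_imgP[y yi ->] FxE].
  suff -> : e x = F y by apply: FM.
  have -> : e x = e (x - F y) + e (F y) by rewrite -linearD subrK.
  by rewrite eF {1}/e daddv_pi0 ?add0r // memv_ker linearB /= FxE subrr.
have [x|e0|e1] := iM _ eM; first by rewrite /e daddv_pi_proj.
  by left; exists n => x; rewrite -lpowE -/F -eF e0.
right.
have kF x : F x = 0 -> x = 0.
  by move=> Fx; rewrite -[x]e1 /e daddv_pi0 // memv_ker Fx.
have fI : injective f.
  move=> x y /eqP; rewrite -subr_eq0 -linearB /= => /eqP fxy.
  apply/eqP; rewrite -subr_eq0; apply/eqP/kF; rewrite lpowE /n.
  (* [F] contains a factor [f] only for a positive exponent; exponent 0 means that M is zero, and so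
     is the line spanned by [x - y]. *)
  case: (\dim {:M}) (dimvS (subvf <[x - y]>%VS)) => [|k _]; last first.
    by rewrite iterSr fxy -lpowE linear0.
  by rewrite dim_vline leqn0 eqb0 negbK => /eqP->.
by apply: m4_iso_of_total => //; apply: lfun_inj_dim.
Qed.

(** Locality of the endomorphism ring. Fitting's lemma is applied to [h \o f]: where [g] vanishes
    this map is the identity, so if it is nilpotent then [g] is injective. *)
Lemma indec_local M (f g : 'End(M)) : indec M -> m4_hom f -> m4_hom g ->
  (exists h, m4_inv (f + g) h) ->
  (exists h, m4_inv f h) \/ (exists h, m4_inv g h).
Proof.
move=> iM fM gM [h [_ hM fgK hK]].
have [[k nil]|[u [_ uM uK uK']]] := fitting iM (m4_hom_comp hM fM); last first.
  left; exists (u \o h)%VF; split=> // [|x|x]; first exact: m4_hom_comp.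
    by rewrite comp_lfunE -[h _]comp_lfunE uK.
  by apply: (can_inj hK); rewrite comp_lfunE -[LHS]comp_lfunE uK'.
right; have gI : injective g.
  move=> x y /eqP; rewrite -subr_eq0 -linearB /= => /eqP gz.
  apply/eqP; rewrite -subr_eq0; apply/eqP; set z := x - y in gz *.
  have fz : (h \o f)%VF z = z by rewrite comp_lfunE -[RHS]fgK add_lfunE gz addr0.
  by rewrite -(nil z); elim: k {nil} => [//|k IH]; rewrite iterS -IH fz.
by apply: m4_iso_of_total => //; apply: lfun_inj_dim.
Qed.

End Homs.

(** * Direct sums and the Krull-Schmidt theorem *)

Section PairMaps.
Variable R : realType.

Section LPair.
Variables (U V W : vectType R) (f : 'Hom(U, V)) (g : 'Hom(U, W)).

Definition lpair_fun (x : U) : (V * W)%type := (f x, g x).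

Fact lpair_fun_is_linear : linear lpair_fun.
Proof. by move=> a u v; rewrite /lpair_fun !linearP. Qed.

HB.instance Definition _ :=
  GRing.isLinear.Build R U (V * W)%type _ lpair_fun lpair_fun_is_linear.

Definition lpair : 'Hom(U, (V * W)%type) := linfun lpair_fun.

Lemma lpairE x : lpair x = (f x, g x).
Proof. by rewrite lfunE. Qed.
End LPair.

Definition lfst (V W : vectType R) : 'Hom((V * W)%type, V) := linfun (@fst V W).
Definition lsnd (V W : vectType R) : 'Hom((V * W)%type, W) := linfun (@snd V W).

Lemma lfstE (V W : vectType R) x : lfst V W x = x.1. Proof. by rewrite lfunE. Qed.
Lemma lsndE (V W : vectType R) x : lsnd V W x = x.2. Proof. by rewrite lfunE. Qed.

Implicit Types A B C D L M : module4 R.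

Definition madd_fst A B : 'Hom(m4_add A B, A) := lfst A B.
Definition madd_snd A B : 'Hom(m4_add A B, B) := lsnd A B.
Definition madd_pair L A B (f : 'Hom(L, A)) (g : 'Hom(L, B)) :
  'Hom(L, m4_add A B) := lpair f g.
Definition madd_inl A B : 'Hom(A, m4_add A B) := madd_pair \1%VF 0.
Definition madd_inr A B : 'Hom(B, m4_add A B) := madd_pair 0 \1%VF.

Lemma madd_fstE A B x : madd_fst A B x = x.1. Proof. exact: lfstE. Qed.
Lemma madd_sndE A B x : madd_snd A B x = x.2. Proof. exact: lsndE. Qed.
Lemma madd_pairE L A B (f : 'Hom(L, A)) (g : 'Hom(L, B)) x :
  madd_pair f g x = (f x, g x).
Proof. exact: lpairE. Qed.
Lemma madd_inlE A B x : madd_inl A B x = (x, 0).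
Proof. by rewrite madd_pairE !lfunE. Qed.
Lemma madd_inrE A B x : madd_inr A B x = (0, x).
Proof. by rewrite madd_pairE !lfunE. Qed.
Lemma madd_addE A B (x y : m4_add A B) : x + y = (x.1 + y.1, x.2 + y.2).
Proof. by []. Qed.

Definition maddE :=
  (madd_fstE, madd_sndE, madd_inlE, madd_inrE, madd_pairE).

Lemma madd_fst_hom A B : m4_hom (madd_fst A B).
Proof. by move=> i x; rewrite memv_prodv madd_fstE => /andP[]. Qed.
Lemma madd_snd_hom A B : m4_hom (madd_snd A B).
Proof. by move=> i x; rewrite memv_prodv madd_sndE => /andP[]. Qed.
Lemma madd_pair_hom L A B (f : 'Hom(L, A)) (g : 'Hom(L, B)) :
  m4_hom f -> m4_hom g -> m4_hom (madd_pair f g).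
Proof. by move=> fM gM i x xi; rewrite memv_prodv madd_pairE /= fM ?gM. Qed.
Lemma m4_hom0 A B : m4_hom (0 : 'Hom(A, B)).
Proof. by move=> i x _; rewrite lfunE mem0v. Qed.
Lemma madd_inl_hom A B : m4_hom (madd_inl A B).
Proof. by apply: madd_pair_hom; [apply: m4_hom_id|apply: m4_hom0]. Qed.
Lemma madd_inr_hom A B : m4_hom (madd_inr A B).
Proof. by apply: madd_pair_hom; [apply: m4_hom0|apply: m4_hom_id]. Qed.

Lemma madd_mem A B i x : x \in m4_sub (m4_add A B) i ->
  x.1 \in m4_sub A i /\ x.2 \in m4_sub B i.
Proof. by rewrite memv_prodv => /andP. Qed.

Lemma m4_sub_sum A B (x : m4_add A B) :
  x = madd_inl A B x.1 + madd_inr A B x.2.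
Proof.
by rewrite !maddE madd_addE /= addr0 add0r; case: x.
Qed.

Lemma m4_add_inv A B C D (f : 'Hom(A, C)) f' (g : 'Hom(B, D)) g' :
  m4_inv f f' -> m4_inv g g' ->
  m4_inv (madd_pair (f \o madd_fst A B) (g \o madd_snd A B))
         (madd_pair (f' \o madd_fst C D) (g' \o madd_snd C D)).
Proof.
move=> [fM f'M fK f'K] [gM g'M gK g'K]; split.
- by apply: madd_pair_hom; apply: m4_hom_comp => //; [apply: madd_fst_hom|apply: madd_snd_hom].
- by apply: madd_pair_hom; apply: m4_hom_comp => //; [apply: madd_fst_hom|apply: madd_snd_hom].
- by move=> [x y]; rewrite !maddE !comp_lfunE !maddE /= fK gK.
- by move=> [x y]; rewrite !maddE !comp_lfunE !maddE /= f'K g'K.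
Qed.

Lemma m4_add_iso A B C D : m4_iso A C -> m4_iso B D -> m4_iso (m4_add A B) (m4_add C D).
Proof.
move=> /m4_isoP[f [f' ff']] /m4_isoP[g [g' gg']]; apply/m4_isoP.
by do 2!eexists; apply: m4_add_inv; eassumption.
Qed.

(** The formula for [f] is part of the conclusion because [indec_exchange] follows a component
    through this rearrangement. *)
Lemma m4_addCA_inv A B C :
  exists (f : 'Hom(m4_add A (m4_add B C), m4_add B (m4_add A C))) g,
    m4_inv f g /\ forall x, f x = (x.2.1, (x.1, x.2.2)).
Proof.
pose F A B C : 'Hom(m4_add A (m4_add B C), m4_add B (m4_add A C)) :=
  madd_pair (madd_fst B C \o madd_snd A _) (madd_pair (madd_fst A _) (madd_snd B C \o madd_snd A _)).
have FE A' B' C' x : F A' B' C' x = (x.2.1, (x.1, x.2.2)).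
  by rewrite /F !maddE !comp_lfunE !maddE.
have FM A' B' C' : m4_hom (F A' B' C').
  move=> i x; rewrite FE => /madd_mem[x1 /madd_mem[x21 x22]].
  by rewrite memv_prodv /= x21 memv_prodv /= x1.
exists (F A B C), (F B A C); split=> //; split=> // x; rewrite !FE /=.
  by case: x => ? [].
by case: x => ? [].
Qed.

Lemma m4_addA_iso A B C : m4_iso (m4_add (m4_add A B) C) (m4_add A (m4_add B C)).
Proof.
apply/m4_isoP.
exists (madd_pair (madd_fst A B \o madd_fst _ C)
         (madd_pair (madd_snd A B \o madd_fst _ C) (madd_snd _ C))).
exists (madd_pair (madd_pair (madd_fst A _) (madd_fst B C \o madd_snd A _))
         (madd_snd B C \o madd_snd A _)).
split.
- move=> i x /madd_mem[/madd_mem[x1 x2] x3].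
  by rewrite !maddE !comp_lfunE !maddE memv_prodv /= x1 memv_prodv /= x2.
- move=> i x /madd_mem[x1 /madd_mem[x2 x3]].
  by rewrite !maddE !comp_lfunE !maddE memv_prodv /= x3 memv_prodv /= x1 x2.
- by move=> [[x y] z]; rewrite !maddE !comp_lfunE !maddE.
- by move=> [x [y z]]; rewrite !maddE !comp_lfunE !maddE.
Qed.

Lemma m4_add0_iso A : m4_iso A (m4_add (m4_zero R) A).
Proof.
apply/m4_isoP; exists (madd_inr _ A), (madd_snd _ A).
split; [exact: madd_inr_hom|exact: madd_snd_hom|by move=> x; rewrite !maddE|].
by move=> [z x]; rewrite !maddE /= (thinmx0 z).
Qed.

Lemma m4_addC_iso A B : m4_iso (m4_add A B) (m4_add B A).
Proof.
apply/m4_isoP; exists (madd_pair (madd_snd A B) (madd_fst A B)).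
exists (madd_pair (madd_snd B A) (madd_fst B A)).
split; first 2 last; try by move=> [x y]; rewrite !maddE.
  by apply: madd_pair_hom; [apply: madd_snd_hom|apply: madd_fst_hom].
by apply: madd_pair_hom; [apply: madd_snd_hom|apply: madd_fst_hom].
Qed.

Lemma m4_dim_add A B : m4_dim (m4_add A B) = (m4_dim A + m4_dim B)%N.
Proof.
rewrite /m4_dim -dim_prodv; congr (\dim _); apply/vspaceP => x.
by rewrite memv_prodv !memvf.
Qed.

Lemma m4_total_add A B : m4_total (m4_add A B) = (m4_total A + m4_total B)%N.
Proof.
by rewrite /m4_total -big_split; apply: eq_bigr => i _; rewrite /m4_subdim /= dim_prodv.
Qed.

Lemma m4_dim0 : m4_dim (m4_zero R) = 0%N.
Proof.
by apply/eqP; rewrite dimv_eq0 -subv0; apply/subvP => x _; rewrite (thinmx0 x) mem0v.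
Qed.

Lemma m4_total0 : m4_total (m4_zero R) = 0%N.
Proof. by rewrite /m4_total big1 // => i _; rewrite /m4_subdim /= dimv0. Qed.

Lemma m4_dim0_iso A : m4_dim A = 0%N -> m4_iso A (m4_zero R).
Proof.
move=> /eqP; rewrite dimv_eq0 => /eqP A0.
have xA (x : A) : x = 0 by apply/eqP; rewrite -memv0 -A0 memvf.
apply/m4_isoP; exists 0, 0; split; try exact: m4_hom0.
  by move=> x; rewrite [x]xA !lfunE.
by move=> x; rewrite (thinmx0 x) !lfunE.
Qed.

Lemma m4_sum_recl k (M : 'I_k.+1 -> module4 R) :
  m4_sum M = m4_add (M ord0) (m4_sum (fun i => M (lift ord0 i))).
Proof. exact: big_ord_recl. Qed.

Lemma m4_sum0 (M : 'I_0 -> module4 R) : m4_sum M = m4_zero R.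
Proof. exact: big_ord0. Qed.

Lemma m4_sum_iso k (M M' : 'I_k -> module4 R) :
  (forall i, m4_iso (M i) (M' i)) -> m4_iso (m4_sum M) (m4_sum M').
Proof.
elim: k M M' => [|k IH] M M' MM'; first by rewrite !m4_sum0; apply: m4_iso_refl.
by rewrite !m4_sum_recl; apply: m4_add_iso => //; apply: IH.
Qed.

Definition sum_of (P : module4 R -> Prop) M :=
  exists k (Q : 'I_k -> module4 R), (forall i, P (Q i)) /\ m4_iso M (m4_sum Q).

Lemma sum_of_iso P A B : m4_iso A B -> sum_of P B -> sum_of P A.
Proof. by move=> AB [k [Q [PQ BQ]]]; exists k, Q; split=> //; apply: m4_iso_trans BQ. Qed.

Lemma sum_of_cons (P : module4 R -> Prop) A B : P A -> sum_of P B -> sum_of P (m4_add A B).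
Proof.
move=> PA [k [Q [PQ BQ]]].
exists k.+1, (fun i => if unlift ord0 i is Some j then Q j else A); split.
  by move=> i; case: unliftP.
rewrite m4_sum_recl unlift_none; apply: m4_add_iso; first exact: m4_iso_refl.
by apply: m4_iso_trans BQ _; apply: m4_sum_iso => i; rewrite liftK; apply: m4_iso_refl.
Qed.

Lemma sum_of_add P A B : sum_of P A -> sum_of P B -> sum_of P (m4_add A B).
Proof.
move=> [k [Q [PQ AQ]]] PB.
apply: (sum_of_iso (m4_add_iso AQ (m4_iso_refl B))).
elim: k Q PQ {A AQ} => [|k IH] Q PQ.
  by rewrite m4_sum0; apply: sum_of_iso PB; apply/m4_iso_sym/m4_add0_iso.
rewrite m4_sum_recl; apply: (sum_of_iso (m4_addA_iso _ _ _)).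
by apply: sum_of_cons => //; apply: IH.
Qed.

Lemma sum_of0 P A : m4_dim A = 0%N -> sum_of P A.
Proof.
move=> A0; exists 0%N, (fun=> A); split; first by case.
by rewrite m4_sum0; apply: m4_dim0_iso.
Qed.

Lemma sum_of1 (P : module4 R -> Prop) A : P A -> sum_of P A.
Proof.
move=> PA; apply: sum_of_iso (sum_of_cons PA (sum_of0 P m4_dim0)).
exact: m4_iso_trans (m4_add0_iso A) (m4_addC_iso _ _).
Qed.

(** In x = e x + (x - e x) both terms stay in M_i when x does, so the four subspaces split along
    with the space. *)
Lemma m4_split M (e : 'End(M)) : m4_hom e -> (forall x, e (e x) = e x) ->
  exists A B, [/\ m4_iso M (m4_add A B),
    m4_dim A = \dim (limg e) & m4_dim B = \dim (lker e)].
Proof.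
move=> eM ee.
have [p pE] := lfun_of_linear (linearP (vsproj (limg e) : {linear M -> _})).
have [q qE] := lfun_of_linear (linearP (vsproj (lker e) : {linear M -> _})).
pose sub (U : {vspace M}) : module4 R :=
  @Module4 R (subvs_of U) (fun i => linfun vsval @^-1: m4_sub M i)%VS.
have subE U i (x : sub U) : (x \in m4_sub (sub U) i) = (vsval x \in m4_sub M i).
  by rewrite -memv_preim lfunE.
have dim_sub U : m4_dim (sub U) = \dim U by rewrite /m4_dim dimvf.
exists (sub (limg e)), (sub (lker e)); split=> //; apply/m4_isoP.
pose f : 'Hom(M, m4_add (sub (limg e)) (sub (lker e))) :=
  @madd_pair M (sub (limg e)) (sub (lker e)) (p \o e)%VF (q \o (\1 - e))%VF.
pose g : 'Hom(m4_add (sub (limg e)) (sub (lker e)), M) :=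
  (linfun vsval \o lfst _ _)%VF + (linfun vsval \o lsnd _ _)%VF.
have gE x : g x = vsval x.1 + vsval x.2.
  by rewrite add_lfunE !comp_lfunE lfstE lsndE !lfunE.
have f1 x : vsval (f x).1 = e x.
  by rewrite maddE /= comp_lfunE pE vsprojK // memv_img ?memvf.
have f2 x : vsval (f x).2 = x - e x.
  rewrite maddE /= comp_lfunE qE !lfun_simp vsprojK //.
  by rewrite memv_ker linearB /= ee subrr.
exists f, g; split.
- move=> i x xi; rewrite memv_prodv !subE f1 f2 eM //=.
  by rewrite rpredB // eM.
- by move=> i x; rewrite memv_prodv !subE gE => /andP[? ?]; rewrite rpredD.
- by move=> x; rewrite gE f1 f2 addrC subrK.
- move=> x; have /memv_imgP[y _ x1E] := subvsP x.1.
  have x2 : e (vsval x.2) = 0 by apply/eqP; rewrite -memv_ker subvsP.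
  have egx : e (g x) = vsval x.1 by rewrite gE linearD /= x2 addr0 x1E ee.
  apply: injective_projections; apply: val_inj => /=; first by rewrite f1.
  by rewrite f2 egx gE addrC addKr.
Qed.

Lemma indec_decomp M : sum_of (@indec R) M.
Proof.
have [n] := ubnP (m4_dim M); elim: n M => // n IH M /ltnSE dM.
have [iM|niM] := pselect (indec M); first exact: sum_of1.
have [M0|M0] := posnP (m4_dim M); first exact: sum_of0.
have [x x0] : exists x : M, x != 0.
  apply: contrapT => nx; move: M0; rewrite lt0n => /negP; apply.
  rewrite dimv_eq0 -subv0; apply/subvP => x _; rewrite memv0.
  by apply/negPn/negP => x0; apply: nx; exists x.
have [e [eM ee e0 e1]] : exists e : 'End(M), [/\ m4_hom e,
    forall x, e (e x) = e x, e != 0 & lker e != 0%VS].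
  apply: contrapT => ne; apply: niM; split; first by exists x.
  move=> e eM ee; have [->|e0] := eqVneq e 0; first by left=> y; rewrite lfunE.
  right=> y; have [/lker0P eI|e1] := boolP (lker e == 0%VS); first by apply: eI.
  by case: ne; exists e.
have [A [B [iso dA dB]]] := m4_split eM ee.
have dk := limg_ker_dim e {:M}; rewrite capfv in dk.
have A0 : (0 < m4_dim A)%N.
  rewrite dA lt0n dimv_eq0 -subv0; apply: contra e0 => /subvP l0.
  apply/eqP/lfunP => y; rewrite lfunE; apply/eqP; rewrite -memv0.
  by apply: l0; rewrite memv_img ?memvf.
have B0 : (0 < m4_dim B)%N by rewrite dB lt0n dimv_eq0.
have dAB : (m4_dim A + m4_dim B)%N = m4_dim M by rewrite dA dB addnC.
apply: (sum_of_iso iso); apply: sum_of_add; apply: IH; apply: leq_trans dM; rewrite -dAB.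
  by rewrite -[ltnLHS]addn0 ltn_add2l.
by rewrite -[ltnLHS]add0n ltn_add2r.
Qed.

(** Block elimination: with [a] invertible in the block form (a b; c d) of [f], the Schur complement
    d - c a^-1 b is an isomorphism, whose inverse is the lower right block of [g]. *)
Lemma m4_cancel A B C D (f : 'Hom(m4_add A B, m4_add C D)) g :
  m4_inv f g ->
  (exists a', m4_inv (madd_fst C D \o (f \o madd_inl A B))%VF a') -> m4_iso B D.
Proof.
move=> [fM gM fK gK] [a' [_ a'M aK a'K]].
pose a := (madd_fst C D \o (f \o madd_inl A B))%VF.
pose b := (madd_fst C D \o (f \o madd_inr A B))%VF.
pose c := (madd_snd C D \o (f \o madd_inl A B))%VF.
pose d := (madd_snd C D \o (f \o madd_inr A B))%VF.
pose d' := (madd_snd A B \o (g \o madd_inr C D))%VF.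
have [aM bM cM dM] : [/\ m4_hom a, m4_hom b, m4_hom c & m4_hom d].
  by split; do 2?[apply: m4_hom_comp]; rewrite /madd_inl /madd_inr;
    do ?[exact: madd_fst_hom|exact: madd_snd_hom|exact: madd_inl_hom|exact: madd_inr_hom].
have d'M : m4_hom d'.
  by do 2?[apply: m4_hom_comp] => //; [apply: madd_snd_hom|apply: madd_inr_hom].
have fE x y : f (x, y) = (a x + b y, c x + d y).
  have -> : f (x, y) = f (madd_inl A B x) + f (madd_inr A B y).
    by rewrite -linearD !maddE madd_addE /= addr0 add0r.
  by rewrite madd_addE; congr pair; rewrite !comp_lfunE !maddE.
have d'E y : d' y = (g (0, y)).2 by rewrite !comp_lfunE !maddE.
have {}aK : cancel a a' := aK; have {}a'K : cancel a' a := a'K.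
apply/m4_isoP; exists (d - (c \o (a' \o b)))%VF, d'.
have sE y : (d - (c \o (a' \o b)))%VF y = d y - c (a' (b y)).
  by rewrite !lfun_simp.
split=> //.
- by apply: (m4_hom_add dM); apply: m4_hom_opp; do 2!apply: m4_hom_comp => //.
- move=> y; rewrite sE d'E.
  have -> : (0, d y - c (a' (b y))) = f (- a' (b y), y).
    by rewrite fE !linearN /= a'K addNr addrC.
  by rewrite fK.
- move=> y; rewrite sE.
  have := gK (0, y); rewrite d'E; case: (g (0, y)) => u v /=; rewrite fE => -[e1 e2].
  have bv : b v = - a u by apply/eqP; rewrite -addr_eq0 addrC e1.
  by rewrite bv !linearN /= aK opprK addrC.
Qed.

(** The automorphism [b \o a] is the sum of its parts through the summands, so by locality one of
    these parts, through [Q j], is invertible. Then [A] is a retract of [Q j], hence isomorphic to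
    it; [t] only moves this summand to the front. *)
Lemma indec_exchange A k (Q : 'I_k -> module4 R)
    (a : 'Hom(A, m4_sum Q)) (b : 'Hom(m4_sum Q, A)) :
  indec A -> (forall i, indec (Q i)) -> m4_hom a -> m4_hom b ->
  (exists h, m4_inv (b \o a)%VF h) ->
  exists j (t : 'Hom(m4_sum Q, m4_add (Q j) (m4_sum (fun i => Q (lift j i))))) t',
    m4_inv t t' /\ exists h, m4_inv (madd_fst _ _ \o (t \o a))%VF h.
Proof.
elim: k Q a b => [|k IH] Q a b iA iQ aM bM [h [_ hM baK _]].
  have [[x x0] _] := iA; move: x0; rewrite -[x]baK comp_lfunE.
  move: (m4_sum Q) (m4_sum0 Q) a b {aM bM baK} => S -> a b.
  by rewrite (thinmx0 (a x)) !linear0 eqxx.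
(* The types of [a] and [b] depend on the sum, so it is generalised together with them before its
   recursive form is substituted. *)
move: (m4_sum Q) (m4_sum_recl Q) a b aM bM baK => S -> a b aM bM baK.
set S' := m4_sum _ in a b aM bM baK *.
pose a0 := (madd_fst _ _ \o a)%VF; pose a1 := (madd_snd _ _ \o a)%VF.
pose b0 := (b \o madd_inl (Q ord0) S')%VF; pose b1 := (b \o madd_inr (Q ord0) S')%VF.
have a0M : m4_hom a0 by apply: m4_hom_comp => //; apply: madd_fst_hom.
have a1M : m4_hom a1 by apply: m4_hom_comp => //; apply: madd_snd_hom.
have b0M : m4_hom b0 by apply: m4_hom_comp => //; apply: madd_inl_hom.
have b1M : m4_hom b1 by apply: m4_hom_comp => //; apply: madd_inr_hom.
have E : (b \o a = (b0 \o a0) + (b1 \o a1))%VF.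
  apply/lfunP => x; rewrite add_lfunE !comp_lfunE -linearD !maddE madd_addE /=.
  by rewrite addr0 add0r; case: (a x).
have [|||[u [_ uM u0 _]]|[u u1]] :=
    indec_local (f := (b0 \o a0)%VF) (g := (b1 \o a1)%VF) iA.
- exact: m4_hom_comp.
- exact: m4_hom_comp.
- rewrite -E; exists h; split=> //; first exact: m4_hom_comp.
  by have [] := lfun_inj_surj (can_inj baK) (lfun_inj_dim (can_inj baK) (leqnn _));
    move=> h' [_ h'K] x; rewrite -[x]h'K baK.
- exists ord0, \1%VF, \1%VF; split.
    by split; try exact: m4_hom_id; move=> x; rewrite !lfunE.
  exists (u \o b0)%VF; rewrite comp_lfun1l; apply: retract_inv => //.
  + by case: iA.
  + exact: m4_hom_comp.
  + by move=> x; rewrite -[RHS]u0 !comp_lfunE.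
have [j [t [t' [tt' [v v1]]]]] := IH (fun i => Q (lift ord0 i)) a1 b1 iA (fun i => iQ _) a1M b1M (ex_intro _ u u1).
have [k0 kE] : exists k0, k = k0.+1.
  by exists k.-1; rewrite prednK // (leq_ltn_trans (leq0n j)).
subst k.
exists (lift ord0 j).
have -> : m4_sum (fun i : 'I_k0.+2.-1 => Q (lift (lift ord0 j) i)) =
    m4_add (Q ord0) (m4_sum (fun i : 'I_k0 => Q (lift ord0 (lift j i)))).
  rewrite m4_sum_recl; congr m4_add; first by congr Q; apply: ord_inj.
  by apply: eq_bigr => i _; congr Q; apply: ord_inj; rewrite /= /bump /= !add1n ltnS addnS.
have [w [w' [ww' wE]]] := m4_addCA_inv (Q ord0) (Q (lift ord0 j)) (m4_sum (fun i : 'I_k0 => Q (lift ord0 (lift j i)))).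
have id_inv : m4_inv (\1%VF : 'End(Q ord0)) \1%VF.
  by split; try exact: m4_hom_id; move=> x; rewrite !lfunE.
do 2!eexists; split; first exact: m4_inv_comp ww' (m4_add_inv id_inv tt').
exists v; congr m4_inv: v1; apply/lfunP => x.
by rewrite !comp_lfunE !maddE wE /= !comp_lfunE !maddE.
Qed.

(** The first summand is exchanged with some [Q' j] by means of the given isomorphism, [m4_cancel]
    removes both, and induction matches the rest. *)
Theorem krull_schmidt k k' (Q : 'I_k -> module4 R) (Q' : 'I_k' -> module4 R) :
  (forall i, indec (Q i)) -> (forall i, indec (Q' i)) ->
  m4_iso (m4_sum Q) (m4_sum Q') ->
  exists s : 'I_k -> 'I_k', bijective s /\ forall i, m4_iso (Q i) (Q' (s i)).
Proof.
elim: k k' Q Q' => [|k IH] k' Q Q' iQ iQ' iso.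
  case: k' => [|k'] in Q' iQ' iso *; first by exists id; split=> [|[]//]; exists id.
  have [] := m4_iso_dim iso; rewrite m4_sum0 m4_dim0 m4_sum_recl m4_dim_add => /esym/eqP.
  by rewrite addn_eq0 eqn0Ngt (indec_dim (iQ' _)).
move: iso; rewrite m4_sum_recl => /m4_isoP[f [g fg]]; have [fM gM fK gK] := fg.
have [|||j [t [t' [tt' u]]]] :=
  @indec_exchange (Q ord0) k' Q' (f \o madd_inl _ _)%VF (madd_fst _ _ \o g)%VF (iQ _) iQ'.
- by apply: m4_hom_comp => //; apply: madd_inl_hom.
- by apply: m4_hom_comp => //; apply: madd_fst_hom.
- exists \1%VF; split; try exact: m4_hom_id.
  + have := m4_hom_comp fM (@madd_inl_hom (Q ord0) (m4_sum (fun i => Q (lift ord0 i)))).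
    by apply: m4_hom_comp; apply: m4_hom_comp gM; apply: madd_fst_hom.
  + by move=> x; rewrite lfunE /= !comp_lfunE fK !maddE.
  + by move=> x; rewrite !comp_lfunE fK !maddE id_lfunE.
have iso0 : m4_iso (Q ord0) (Q' j).
  by apply/m4_isoP; case: u => h uh; do 2!eexists; exact: uh.
have iso' : m4_iso (m4_sum (fun i => Q (lift ord0 i))) (m4_sum (fun i => Q' (lift j i))).
  apply: (m4_cancel (m4_inv_comp tt' fg)).
  by case: u => h uh; exists h; rewrite -comp_lfunA.
have [s [[s' sK s'K] isos]] := IH _ _ _ (fun i => iQ _) (fun i => iQ' _) iso'.
exists (fun i => if unlift ord0 i is Some i' then lift j (s i') else j); split.
  exists (fun y => if unlift j y is Some y' then lift ord0 (s' y') else ord0).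
    by move=> i; case: (unliftP ord0 i) => [i'|] ->; rewrite ?liftK ?sK ?unlift_none.
  by move=> y; case: (unliftP j y) => [y'|] ->; rewrite ?liftK ?s'K ?unlift_none.
by move=> i; case: (unliftP ord0 i) => [i'|] ->.
Qed.
End PairMaps.

(** * The Coxeter functor and modules of nonzero defect *)

Section OneDim.
Variable R : realType.
Implicit Types M N Q : module4 R.

(** The map y |-> h(y) x is idempotent, and the hypothesis on each M_i is just what makes it an
    endomorphism. It fixes x, so it is the identity and M is the line through x. *)
Lemma indec_line M (x : M) (h : 'Hom(M, R^o)) : indec M -> h x = 1 ->
    (forall i, x \in m4_sub M i \/ forall a, a \in m4_sub M i -> h a = 0) ->
  [/\ m4_dim M = 1%N,
      forall i, x \in m4_sub M i -> m4_subdim M i = 1%N &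
      forall i, (forall a, a \in m4_sub M i -> h a = 0) -> m4_subdim M i = 0%N].
Proof.
move=> [_ iM] hx xh.
have [e eE] : exists e : 'End(M), e =1 (fun y => h y *: x).
  by apply: lfun_of_linear => a u v; rewrite linearP scalerDl scalerA.
have x0 : x != 0.
  by apply/eqP => x0; move: hx; rewrite x0 linear0 => /esym/eqP; rewrite oner_eq0.
have hyp : forall y, y = h y *: x.
  have [|y|e0|e1] := iM e.
  - move=> i y yi; rewrite eE; have [xi|->//] := xh i; first by rewrite rpredZ.
    by rewrite scale0r mem0v.
  - by rewrite !eE linearZ /= hx [_ *: 1]mulr1.
  - by move: x0; rewrite -[x]scale1r -{1}hx -eE e0 eqxx.
  - by move=> y; rewrite -eE.
have dx : \dim <[x]> = 1%N by rewrite dim_vline x0.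
split=> [|i xi|i hi].
- rewrite /m4_dim -dx; congr (\dim _); apply/eqP; rewrite eqEsubv subvf andbT.
  by apply/subvP => y _; rewrite [y]hyp memvZ ?memv_line.
- rewrite /m4_subdim -dx; congr (\dim _); apply/eqP; rewrite eqEsubv -memvE xi andbT.
  by apply/subvP => y _; rewrite [y]hyp memvZ ?memv_line.
- apply/eqP; rewrite dimv_eq0 -subv0; apply/subvP => y yi.
  by rewrite [y]hyp hi // scale0r mem0v.
Qed.

Lemma dim1_iso M N : m4_dim M = 1%N -> m4_dim N = 1%N ->
  m4_subdim M =1 m4_subdim N -> m4_iso M N.
Proof.
move=> dM dN dMN.
have [f [fI fS]] : exists f : 'Hom(M, N), injective f /\ limg f = fullv.
  have [y y0] : exists y : N, y != 0.
    exists (vpick {:N}); rewrite vpick0 -dimv_eq0 -[\dim _]/(m4_dim N) dN //.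
  have [x x0] : exists x : M, x != 0.
    exists (vpick {:M}); rewrite vpick0 -dimv_eq0 -[\dim _]/(m4_dim M) dM //.
  have [h [hx _]] : exists h : 'Hom(M, R^o), h x = 1 /\ forall a, a \in 0%VS -> h a = 0.
    by apply: functional_sep; rewrite memv0.
  have [f fE] : exists f : 'Hom(M, N), f =1 (fun z => h z *: y).
    by apply: lfun_of_linear => a u v; rewrite linearP scalerDl scalerA.
  have lf : limg f = fullv.
    apply/eqP; rewrite eqEdim subvf /= -[\dim {:N}]/(m4_dim N) dN.
    have fx0 : f x != 0 by rewrite fE hx scale1r.
    have <- : \dim <[f x]> = 1%N by rewrite dim_vline fx0.
    by rewrite dimvS // -memvE memv_img ?memvf.
  exists f; split=> //; apply/lker0P; rewrite -dimv_eq0.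
  have := limg_ker_dim f {:M}; rewrite capfv lf -[\dim {:N}]/(m4_dim N) -[\dim {:M}]/(m4_dim M).
  by rewrite dM dN => /eqP; rewrite -[X in _ == X]add0n eqn_add2r.
have [||g fg] := m4_iso_of_total (f := f) _ fI fS; last by apply/m4_isoP; exists f, g.
  move=> i z zi; have := m4_subdim_le N i; rewrite dN leq_eqVlt => /orP[/eqP Ni|].
    suff -> : m4_sub N i = fullv by rewrite memvf.
    by apply/eqP; rewrite eqEdim subvf /= -[\dim {:N}]/(m4_dim N) dN -Ni leqnn.
  rewrite ltnS leqn0 -dMN dimv_eq0 => /eqP Mi.
  by move: zi; rewrite Mi memv0 => /eqP->; rewrite linear0 mem0v.
by rewrite leq_eqVlt; apply/orP; left; apply/eqP; apply: eq_bigr => i _; rewrite -dMN.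
Qed.

End OneDim.

Section Coxeter.
Variable R : realType.
Implicit Types M N Q : module4 R.

Section FfunProj.
Variables (V : vectType R).

Definition ffun_proj i (x : {ffun 'I_4 -> V}) : V := x i.
Fact ffun_proj_is_linear i : linear (ffun_proj i).
Proof. by move=> a u v; rewrite /ffun_proj !ffunE. Qed.
HB.instance Definition _ i :=
  GRing.isLinear.Build R {ffun 'I_4 -> V} V _ (ffun_proj i) (ffun_proj_is_linear i).
Definition fproj i : 'Hom({ffun 'I_4 -> V}, V) := linfun (ffun_proj i).
Lemma fprojE i x : fproj i x = x i. Proof. by rewrite lfunE. Qed.

(** The intersection is the product of the [A i] inside V^4; it is rewritten as the direct sum of
    their images under the coordinate injections. *)
Lemma dim_ffun_prod (A : 'I_4 -> {vspace V}) :
  \dim (\bigcap_i (fproj i @^-1: A i))%VS = (\sum_i \dim (A i))%N.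
Proof.
have inj_ex i : exists f : 'Hom(V, {ffun 'I_4 -> V}),
    f =1 (fun v => [ffun j => if j == i then v else 0]).
  by apply: lfun_of_linear => a u v; apply/ffunP => j; rewrite !ffunE;
    case: ifP; rewrite ?scaler0 ?addr0.
pose inj i := sval (cid (inj_ex i)).
have injE i v j : inj i v j = if j == i then v else 0.
  by rewrite /inj; case: (cid _) => f /= ->; rewrite ffunE.
have -> : (\bigcap_i (fproj i @^-1: A i))%VS = (\sum_i inj i @: A i)%VS.
  apply/eqP; rewrite eqEsubv; apply/andP; split.
    apply/subvP => x xA; have {xA} xA i : x i \in A i.
      by rewrite -fprojE memv_preim; apply: subvP xA; apply: bigcapv_inf.
    apply/memv_sumP; exists (fun i => inj i (x i)); first by move=> i _; rewrite memv_img.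
    apply/ffunP => j; rewrite sum_ffunE (bigD1 j) //= injE eqxx big1 ?addr0 // => i ij.
    by rewrite injE eq_sym (negbTE ij).
  apply/subv_sumP => i _; apply/subv_bigcapP => j _; apply/subvP => _ /memv_imgP[v vi ->].
  by rewrite -memv_preim fprojE injE; case: eqP => [->|]; rewrite ?mem0v.
have /directvP -> /= : directv (\sum_i inj i @: A i)%VS.
  apply/directv_sum_independent => us usA us0 i _.
  have /memv_imgP[v _ uv] := usA i isT.
  suff v0 : v = 0 by rewrite uv v0 linear0.
  have := congr1 (fun x : {ffun 'I_4 -> V} => x i) us0; rewrite sum_ffunE ffunE (bigD1 i) //=.
  rewrite big1 ?addr0 => [|j ji]; first by rewrite uv injE eqxx.
  by have /memv_imgP[w _ ->] := usA j isT; rewrite injE eq_sym (negbTE ji).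
apply: eq_bigr => i _; rewrite limg_dim_eq //; apply/eqP; rewrite -subv0.
apply/subvP => v; rewrite memv_cap memv_ker => /andP[_ /eqP/ffunP/(_ i)].
by rewrite injE eqxx ffunE => ->; rewrite mem0v.
Qed.
End FfunProj.

Definition cox_space M : {vspace {ffun 'I_4 -> M}} :=
  ((\bigcap_i (fproj M i @^-1: m4_sub M i)) :&: lker (\sum_i fproj M i)%R)%VS.

(* The Coxeter functor of Gelfand and Ponomarev. *)
Definition cox M : module4 R :=
  @Module4 R (subvs_of (cox_space M))
    (fun i => lker (fproj M i \o linfun vsval)%VF).

Definition cox_p M i : 'Hom(cox M, M) := (fproj M i \o linfun vsval)%VF.

Lemma cox_pE M i (k : cox M) : cox_p M i k = vsval k i.
Proof. by rewrite comp_lfunE fprojE lfunE. Qed.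

Lemma cox_subE M i k : (k \in m4_sub (cox M) i) = (cox_p M i k == 0).
Proof. exact: memv_ker. Qed.

Lemma cox_space_mem M x : (x \in cox_space M) <->
  (forall i, x i \in m4_sub M i) /\ \sum_i x i = 0.
Proof.
rewrite memv_cap memv_ker sum_lfunE.
have -> : \sum_i fproj M i x = \sum_i x i by apply: eq_bigr => i _; rewrite fprojE.
split=> [/andP[xi /eqP->]|[xi ->]]; last first.
  rewrite eqxx andbT memvE; apply/subv_bigcapP => i _.
  by rewrite -memvE -memv_preim fprojE.
split=> // i; rewrite -fprojE memv_preim.
by apply: subvP xi; apply: bigcapv_inf.
Qed.

Lemma cox_p_mem M i k : cox_p M i k \in m4_sub M i.
Proof. by rewrite cox_pE; have /cox_space_mem[] := subvsP k. Qed.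

Lemma cox_p_sum M k : \sum_i cox_p M i k = 0.
Proof.
by under eq_bigr do rewrite cox_pE; have /cox_space_mem[] := subvsP k.
Qed.

Lemma cox_ex M (v : 'I_4 -> M) :
  (forall i, v i \in m4_sub M i) -> \sum_i v i = 0 ->
  exists k, forall i, cox_p M i k = v i.
Proof.
move=> vi v0.
have vK : [ffun i => v i] \in cox_space M.
  apply/cox_space_mem; split=> [i|]; first by rewrite ffunE.
  by under eq_bigr do rewrite ffunE.
by exists (Subvs vK) => i; rewrite cox_pE /= ffunE.
Qed.

Lemma cox_p_inj M k k' : (forall i, cox_p M i k = cox_p M i k') -> k = k'.
Proof.
move=> kk'; apply: val_inj; apply/ffunP => i.
by have := kk' i; rewrite !cox_pE.
Qed.

(** The condition under which [M] can be recovered from [cox M]: every [cox_p M i] is then onto M_i,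
    so that M_i is the quotient of [cox M] by its i-th subspace. *)
Definition good M := forall i, (\sum_(j < 4 | j != i) m4_sub M j = fullv)%VS.

Lemma good_full M : good M -> (\sum_i m4_sub M i = fullv)%VS.
Proof.
move=> gM; apply/eqP; rewrite eqEsubv subvf -(gM ord0).
by apply/subv_sumP => i _; apply: sumv_sup (subvv _).
Qed.

Lemma cox_p_surj M i v : good M -> v \in m4_sub M i -> exists k, cox_p M i k = v.
Proof.
move=> gM vi.
have /memv_sumP[w wi wE] : - v \in (\sum_(j < 4 | j != i) m4_sub M j)%VS.
  by rewrite gM memvf.
have [j||k kE] := @cox_ex M (fun j => if j == i then v else w j).
- by case: eqP => [->//|/eqP ji]; apply: wi.
- rewrite (bigD1 i) //= eqxx (eq_bigr w) ?[X in _ + X]esym ?wE //; last first.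
    by move=> j /negbTE ->.
  by rewrite -wE subrr.
by exists k; rewrite kE eqxx.
Qed.

Lemma cox_p_img M i : good M -> limg (cox_p M i) = m4_sub M i.
Proof.
move=> gM; apply/vspaceP => v; apply/memv_imgP/idP => [[k _ ->]|vi]; first exact: cox_p_mem.
by have [k kE] := cox_p_surj gM vi; exists k; rewrite ?memvf.
Qed.

Lemma cox_subdim M i : good M ->
  (m4_subdim (cox M) i + m4_subdim M i)%N = m4_dim (cox M).
Proof.
move=> gM; rewrite /m4_dim -(limg_ker_dim (cox_p M i)) cox_p_img //.
by congr (_ + _)%N; congr (\dim _); rewrite capfv.
Qed.

Lemma cox_dim M : good M -> (m4_dim (cox M) + m4_dim M)%N = m4_total M.
Proof.
move=> gM; rewrite /m4_total.
have -> : (\sum_i m4_subdim M i)%N = \dim (\bigcap_i (fproj M i @^-1: m4_sub M i))%VS.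
  by rewrite dim_ffun_prod.
have -> : m4_dim (cox M) = \dim (cox_space M) by rewrite /m4_dim dimvf.
rewrite /cox_space; set P := (\bigcap_i _)%VS; set s := \sum_i _.
rewrite -[RHS](limg_ker_dim s); congr (_ + _)%N; congr (\dim _).
apply/vspaceP => v; rewrite memvf.
have /memv_sumP[w wi ->] : v \in (\sum_i m4_sub M i)%VS by rewrite good_full ?memvf.
apply/esym/memv_imgP; exists [ffun i => w i].
  rewrite memvE; apply/subv_bigcapP => i _.
  by rewrite -memvE -memv_preim fprojE ffunE wi.
by rewrite sum_lfunE; apply: eq_bigr => i _; rewrite fprojE ffunE.
Qed.

Lemma cox_total M : good M -> (m4_total (cox M) + m4_total M)%N = (4 * m4_dim (cox M))%N.
Proof.
move=> gM; rewrite /m4_total -big_split /=.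
under eq_bigr do rewrite cox_subdim //.
by rewrite sum_nat_const card_ord.
Qed.

(** Each v in M is a sum of terms [cox_p M i (k i)], and [f] has to send it to the sum of the
    [cox_p N i (psi (k i))]. The content is that this does not depend on the choice of the [k i]. *)
Lemma cox_full M N (psi : 'Hom(cox M, cox N)) : good M -> m4_hom psi ->
  exists f : 'Hom(M, N), m4_hom f /\ forall i k, f (cox_p M i k) = cox_p N i (psi k).
Proof.
move=> gM psiM.
(* Terms adding up to zero are the coordinates of a single element k' of [cox M]. Each [k i] differs
   from k' by an element of the i-th subspace, which [psi] preserves and [cox_p N i] kills. *)
have wd (k : 'I_4 -> cox M) : \sum_i cox_p M i (k i) = 0 ->
    \sum_i cox_p N i (psi (k i)) = 0.
  move=> k0; have [i|k' k'E] := @cox_ex M (fun i => cox_p M i (k i)) _ k0.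
    exact: cox_p_mem.
  apply: etrans (cox_p_sum (psi k')).
  apply: eq_bigr => i _; apply/eqP.
  by rewrite -subr_eq0 -!linearB /= -cox_subE psiM // cox_subE linearB /= k'E subrr.
pose t i := sval (cid (lfun_section (cox_p M i) {:cox M})).
have tE i v : v \in m4_sub M i -> cox_p M i (t i v) = v.
  by rewrite /t; case: (cid _) => f /= fE; rewrite -cox_p_img // => /fE[].
pose c i : 'Hom(M, cox M) := (t i \o sumv_pi_for (erefl (\sum_i m4_sub M i)%VS) i)%VF.
have cE v : \sum_i cox_p M i (c i v) = v.
  rewrite -[RHS](sumv_pi_sum (erefl (\sum_i m4_sub M i)%VS)) ?good_full ?memvf //.
  by apply: eq_bigr => i _; rewrite [c i v]comp_lfunE tE // memv_sum_pi.
pose f := \sum_i (cox_p N i \o (psi \o c i))%VF.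
have fE i k : f (cox_p M i k) = cox_p N i (psi k).
  (* The difference between the chosen decomposition of [cox_p M i k] and the one concentrated at
     the index i. *)
  pose k' j := c j (cox_p M i k) - (if j == i then k else 0).
  have /wd : \sum_j cox_p M j (k' j) = 0.
    under eq_bigr do rewrite linearB /=.
    rewrite sumrB cE (bigD1 i) //= eqxx big1 ?addr0 ?subrr // => j /negbTE->.
    by rewrite linear0.
  under eq_bigr do rewrite !linearB /=.
  rewrite sumrB; have -> : \sum_j cox_p N j (psi (if j == i then k else 0)) = cox_p N i (psi k).
    rewrite (bigD1 i) //= eqxx big1 ?addr0 // => j /negbTE ->.
    by rewrite !linear0.
  move=> /subr0_eq <-; rewrite sum_lfunE; apply: eq_bigr => j _.
  by rewrite comp_lfunE [(psi \o _)%VF _]comp_lfunE.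
exists f; split=> // i v vi.
by have [k <-] := cox_p_surj gM vi; rewrite fE cox_p_mem.
Qed.

Lemma cox_p_ext M N (f g : 'Hom(M, N)) : good M ->
  (forall i k, f (cox_p M i k) = g (cox_p M i k)) -> f = g.
Proof.
move=> gM fg; apply/lfunP => v.
have /memv_sumP[w wi ->] : v \in (\sum_i m4_sub M i)%VS by rewrite good_full ?memvf.
rewrite !linear_sum /=; apply: eq_bigr => i _.
by have [k <-] := cox_p_surj gM (wi i isT); rewrite fg.
Qed.

Lemma cox_map M N (f : 'Hom(M, N)) : m4_hom f ->
  exists psi : 'Hom(cox M, cox N),
    m4_hom psi /\ forall i k, cox_p N i (psi k) = f (cox_p M i k).
Proof.
move=> fM.
have ex k : exists k', forall i, cox_p N i k' = f (cox_p M i k).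
  apply: cox_ex => [i|]; first by rewrite fM ?cox_p_mem.
  by rewrite -linear_sum cox_p_sum linear0.
pose p k := sval (cid (ex k)).
have pE k i : cox_p N i (p k) = f (cox_p M i k) by rewrite /p; case: (cid _).
have [psi psiE] : exists psi : 'Hom(cox M, cox N), psi =1 p.
  apply: lfun_of_linear => a u v; apply: cox_p_inj => i.
  by rewrite pE !linearP /= !pE.
exists psi; split=> [i k|i k]; last by rewrite psiE pE.
by rewrite !cox_subE psiE pE => /eqP->; rewrite linear0.
Qed.

Lemma cox_indec M : good M -> indec M -> indec (cox M).
Proof.
move=> gM iM; have [_ iM'] := iM; split.
  apply: contrapT => nx; have k0 (k : cox M) : k = 0.
    by apply/eqP/negPn/negP => k0; apply: nx; exists k.
  have [[x x0] _] := iM; case/negP: x0; apply/eqP.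
  have /memv_sumP[w wi ->] : x \in (\sum_i m4_sub M i)%VS by rewrite good_full ?memvf.
  by apply: big1 => i _; have [k <-] := cox_p_surj gM (wi i isT); rewrite [k]k0 linear0.
move=> psi psiM pp; have [f [fM fE]] := cox_full gM psiM.
have ff x : f (f x) = f x.
  rewrite -comp_lfunE; congr (fun_of_lfun _ x); apply: cox_p_ext => // i k.
  by rewrite comp_lfunE !fE pp.
have [f0|f1] := iM' f fM ff; [left|right] => k; apply: cox_p_inj => i.
  by rewrite -fE f0 linear0.
by rewrite -fE f1.
Qed.

Lemma cox_iso M N : good M -> good N -> m4_iso (cox M) (cox N) -> m4_iso M N.
Proof.
move=> gM gN /m4_isoP[p [q [pM qM pK qK]]].
have [f [fM fE]] := cox_full gM pM; have [g [g_M gE]] := cox_full gN qM.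
apply/m4_isoP; exists f, g; split=> // x; rewrite -comp_lfunE -[RHS]id_lfunE;
  congr (fun_of_lfun _ x); apply: cox_p_ext => // i k.
  by rewrite comp_lfunE fE gE pK id_lfunE.
by rewrite comp_lfunE gE fE qK id_lfunE.
Qed.

(* A functional killing the three subspaces M_j, j <> i, splits off a
   one-dimensional summand. *)
Lemma indec_kill M i (h : 'Hom(M, R^o)) : indec M ->
  (forall j, j != i -> forall a, a \in m4_sub M j -> h a = 0) ->
  h = 0 \/ m4_dim M = 1%N /\ forall j, j != i -> m4_subdim M j = 0%N.
Proof.
move=> iM hj; have [->|h0] := eqVneq h 0; [by left|right].
have [x hx xi] : exists2 x, h x = 1 & x \in m4_sub M i \/ forall a, a \in m4_sub M i -> h a = 0.
  have scale x : h x != 0 -> h ((h x)^-1 *: x) = 1.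
    by move=> hx0; rewrite linearZ /= [_ *: _]mulVf.
  have [[x [xi hx]]|nx] := pselect (exists x, x \in m4_sub M i /\ h x != 0).
    by exists ((h x)^-1 *: x); [apply: scale|left; rewrite rpredZ].
  have /lfunPn[x] := h0; rewrite lfunE /= => hx.
  exists ((h x)^-1 *: x); [exact: scale|right=> a ai].
  by apply/eqP/negPn/negP => ha; apply: nx; exists a.
have [j|d1 _ d0] := indec_line iM hx.
  by have [->|ji] := eqVneq j i; [|right; apply: hj].
by split=> // j ji; apply: d0; apply: hj.
Qed.

Lemma indec_good M : indec M ->
  good M \/ exists i, m4_dim M = 1%N /\ forall j, j != i -> m4_subdim M j = 0%N.
Proof.
move=> iM; have [gM|ngM] := pselect (good M); [by left|right].
have [i ni] : exists i, (\sum_(j < 4 | j != i) m4_sub M j != fullv)%VS.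
  apply: contrapT => nn; apply: ngM => i; apply/eqP/negPn/negP => ni.
  by apply: nn; exists i.
have [x xs] : exists x, x \notin (\sum_(j < 4 | j != i) m4_sub M j)%VS.
  by move: ni; rewrite eqEsubv subvf /= => /subvPn[x _ ?]; exists x.
have [h [hx hs]] := functional_sep xs.
exists i; have [j ji a aj|h0|//] := indec_kill (i := i) (h := h) iM.
  by apply: hs; apply: subvP aj; apply: sumv_sup (subvv _).
by move: hx; rewrite h0 lfunE /= => /esym/eqP; rewrite oner_eq0.
Qed.

Lemma total_le1 M i : m4_dim M = 1%N -> (forall j, j != i -> m4_subdim M j = 0%N) ->
  (m4_total M <= 1)%N.
Proof.
move=> d1 d0; rewrite /m4_total (bigD1 i) //= big1 // addn0 -d1.
exact: m4_subdim_le.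
Qed.

Lemma defect0_good M : indec M -> m4_total M = (2 * m4_dim M)%N -> good M.
Proof.
move=> /indec_good[//|[i [d1 d0]]] dM.
by have := total_le1 d1 d0; rewrite dM d1.
Qed.

(** The functor preserves both defects and strictly lowers dim Q, so the induction ends at a
    one-dimensional [Q] with at most one nonzero subspace. *)
Lemma hom_defect_neg M Q (f : 'Hom(M, Q)) : indec M -> indec Q ->
  m4_total M = (2 * m4_dim M)%N -> (m4_total Q < 2 * m4_dim Q)%N -> m4_hom f -> f = 0.
Proof.
have [n] := ubnP (m4_dim Q); elim: n M Q f => // n IH M Q f /ltnSE dn iM iQ dM dQ fM.
have gM := defect0_good iM dM.
have [gQ|[i [d1 d0]]] := indec_good iQ; last first.
  apply/eqP/negPn/negP => /lfunPn[x]; rewrite lfunE /= => fx0.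
  have [h [hx _]] : exists h : 'Hom(Q, R^o), h (f x) = 1 /\ forall a, a \in 0%VS -> h a = 0.
    by apply: functional_sep; rewrite memv0.
  (* Composed with a functional on the line Q, [f] kills three of the subspaces of M; if this
     composite is nonzero, M is a line with total dimension at most 1, against defect zero. *)
  have [j ji a aj|h0|[e1 e0]] := indec_kill (i := i) (h := (h \o f)%VF) iM.
  - rewrite comp_lfunE; have := fM _ _ aj; have /eqP := d0 _ ji.
    by rewrite dimv_eq0 => /eqP->; rewrite memv0 => /eqP->; rewrite linear0.
  - by move: hx; rewrite -comp_lfunE h0 lfunE /= => /esym/eqP; rewrite oner_eq0.
  - by have := total_le1 e1 e0; rewrite dM e1.
have [psi [psiM psiE]] := cox_map fM.
have cd := cox_dim gM; have cs := cox_total gM.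
have cdQ := cox_dim gQ; have csQ := cox_total gQ.
have psi0 : psi = 0.
  apply: IH (cox_indec gM iM) (cox_indec gQ iQ) _ _ psiM; lia.
apply: cox_p_ext => // i k; rewrite -psiE psi0 zero_lfunE [RHS]zero_lfunE.
by rewrite linear0.
Qed.

(** The dimensions of [cox M] are computed from those of [M], so the hypotheses pass to [cox M] and
    [cox N], which are smaller; [cox_iso] brings the isomorphism back. *)
Lemma defect_neg_unique M N : indec M -> indec N ->
  (m4_total M < 2 * m4_dim M)%N ->
  m4_dim M = m4_dim N -> m4_subdim M =1 m4_subdim N -> m4_iso M N.
Proof.
have [n] := ubnP (m4_dim M); elim: n M N => // n IH M N /ltnSE dn iM iN dM dMN sMN.
have tMN : m4_total M = m4_total N by apply: eq_bigr => i _; apply: sMN.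
have [gM|[i [d1 _]]] := indec_good iM; last by apply: dim1_iso => //; rewrite -dMN.
have [gN|[i [d1 _]]] := indec_good iN; last by apply: dim1_iso => //; rewrite dMN.
have cM := cox_dim gM; have tM := cox_total gM.
have cN := cox_dim gN; have tN := cox_total gN.
apply: cox_iso => //; apply: IH; try exact: cox_indec; try lia.
move=> i; have := cox_subdim i gM; have := cox_subdim i gN; have := sMN i; lia.
Qed.

(** The dimension vectors of V, of III with i the place of the larger subspace, and of IV with i the
    place of the smaller one; the last is written additively to avoid a truncated subtraction. *)
Definition prep_dims (N : nat) (d : 'I_4 -> nat) : Prop :=
  [\/ exists n, N = (2 * n + 1)%N /\ forall i, d i = n,
      exists n i, N = (2 * n + 1)%N /\ forall j, d j = (n + (j == i))%N |
      exists n i, N = (2 * n + 2)%N /\ forall j, (d j + (j == i))%N = (n + 1)%N].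

Lemma sum_delta4 (i : 'I_4) : (\sum_j (j == i))%N = 1%N.
Proof. by rewrite (bigD1 i) //= eqxx big1 // => j /negbTE->. Qed.

(** On dimension vectors the functor takes V at n+1 to V at n, IV at n to III at n, and III at n+1
    to IV at n, always with the same i. It stops at a line, which is V or III at n = 0. *)
Lemma defect_neg_dims M : indec M -> (m4_total M < 2 * m4_dim M)%N ->
  prep_dims (m4_dim M) (m4_subdim M).
Proof.
have [n] := ubnP (m4_dim M); elim: n M => // n IH M /ltnSE dn iM dM.
have [gM|[i [d1 d0]]] := indec_good iM; last first.
  have [di|di] := posnP (m4_subdim M i).
    by constructor 1; exists 0%N; split=> // j; have [->|/d0] := eqVneq j i.
  constructor 2; exists 0%N, i; split=> // j; have [->|/d0//] := eqVneq j i.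
  by have := m4_subdim_le M i; rewrite d1; lia.
have cM := cox_dim gM; have tM := cox_total gM; have sM j := cox_subdim j gM.
have : prep_dims (m4_dim (cox M)) (m4_subdim (cox M)).
  by apply: IH; [|exact: cox_indec|]; lia.
case=> [[m [N' d']]|[m [i [N' d']]]|[m [i [N' d']]]].
- constructor 1; exists m.+1.
  have S' : m4_total (cox M) = (4 * m)%N.
    by rewrite /m4_total; under eq_bigr do rewrite d'; rewrite sum_nat_const card_ord.
  by split=> [|j]; [|have := sM j; rewrite d']; lia.
- constructor 3; exists m, i.
  have S' : m4_total (cox M) = (4 * m + 1)%N.
    rewrite /m4_total; under eq_bigr do rewrite d'.
    by rewrite big_split /= sum_delta4 sum_nat_const card_ord.
  by split=> [|j]; [|have := sM j; rewrite d']; lia.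
- constructor 2; exists m.+1, i.
  have S' : (m4_total (cox M) + 1 = 4 * (m + 1))%N.
    have : (\sum_j (m4_subdim (cox M) j + (j == i)))%N = (4 * (m + 1))%N.
      by under eq_bigr do rewrite d'; rewrite sum_nat_const card_ord.
    by rewrite big_split /= sum_delta4.
  by split=> [|j]; [|have := sM j; have := d' j]; lia.
Qed.

End Coxeter.

(** * Duality and Brascamp-Lieb data *)

Section Duality.
Variable R : realType.

Lemma dim_dual (V : vectType R) : \dim {:'Hom(V, R^o)} = \dim {:V}.
Proof. by rewrite !dimvf; apply: muln1. Qed.

Section Annihilators.
Variable V : vectType R.
Local Notation dual_space := 'Hom(V, R^o).

(** The kernel of restriction to [A], so that its dimension comes from the rank of the restriction
    map. *)
Definition ann (A : {vspace V}) : {vspace dual_space} :=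
  lker (adjoint (linfun vsval : 'Hom(subvs_of A, V))).

Lemma annP (A : {vspace V}) (phi : dual_space) :
  reflect (forall a, a \in A -> phi a = 0) (phi \in ann A).
Proof.
rewrite memv_ker adjointE; apply: (iffP eqP) => [p0 a Aa|p0].
  have /lfunP/(_ (Subvs Aa)) := p0.
  by rewrite zero_lfunE comp_lfunE lfunE.
by apply/lfunP => a; rewrite zero_lfunE comp_lfunE lfunE p0 // subvsP.
Qed.

Lemma dim_ann (A : {vspace V}) : (\dim (ann A) + \dim A)%N = \dim {:V}.
Proof.
set r := adjoint (linfun vsval : 'Hom(subvs_of A, V)).
rewrite -dim_dual -(limg_ker_dim r fullv) capfv; congr (_ + _)%N.
suff -> : limg r = fullv by rewrite dim_dual dimvf.
apply/eqP; rewrite eqEsubv subvf; apply/subvP => psi _; apply/memv_imgP.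
exists (psi \o linfun (vsproj A))%VF; first exact: memvf.
by rewrite adjointE; apply/lfunP => a; rewrite !comp_lfunE !lfunE /= vsvalK.
Qed.

Definition eval_fun (v : V) (phi : dual_space) : R^o := phi v.
Fact eval_fun_is_linear v : linear (eval_fun v).
Proof. by move=> a p q; rewrite /eval_fun add_lfunE scale_lfunE. Qed.
HB.instance Definition _ v :=
  GRing.isLinear.Build R dual_space R^o _ (eval_fun v) (eval_fun_is_linear v).
Definition eval_at v : 'Hom(dual_space, R^o) := linfun (eval_fun v).
Lemma eval_atE v phi : eval_at v phi = phi v. Proof. by rewrite lfunE. Qed.

Lemma dual_separates (v w : V) : (forall phi : dual_space, phi v = phi w) -> v = w.
Proof.
move=> vw; apply/eqP; rewrite -subr_eq0; apply/negPn/negP => v0.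
have [h [hv _]] : exists h : dual_space, h (v - w) = 1 /\ forall a, a \in 0%VS -> h a = 0.
  by apply: functional_sep; rewrite memv0.
by move: hv; rewrite linearB /= vw subrr => /esym/eqP; rewrite oner_eq0.
Qed.

Lemma bidual_ex : exists ev : 'Hom(V, 'Hom(dual_space, R^o)),
  [/\ ev =1 eval_at, injective ev & limg ev = fullv].
Proof.
have [ev evE] : exists ev : 'Hom(V, 'Hom(dual_space, R^o)), ev =1 eval_at.
  apply: lfun_of_linear => a u v; apply/lfunP => phi.
  by rewrite add_lfunE scale_lfunE !eval_atE linearP.
have evI : injective ev.
  by move=> v w vw; apply: dual_separates => phi; rewrite -!eval_atE -!evE vw.
exists ev; split=> //; apply: lfun_inj_dim => //.
by rewrite !dim_dual.
Qed.
End Annihilators.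

(** [f] is the adjoint of [psi], read through the evaluation isomorphism of V with its bidual. *)
Lemma dual_full (V W : vectType R) (psi : 'Hom('Hom(V, R^o), 'Hom(W, R^o))) :
  exists f : 'Hom(W, V), forall phi, psi phi = (phi \o f)%VF.
Proof.
have [ev [evE evI evS]] := bidual_ex V.
have [g [evK gK]] := lfun_inj_surj evI evS.
have [p pE] : exists p : 'Hom(W, 'Hom('Hom(V, R^o), R^o)),
    p =1 (fun w => eval_at w \o psi)%VF.
  apply: lfun_of_linear => a u v; apply/lfunP => phi.
  by rewrite add_lfunE scale_lfunE !comp_lfunE !eval_atE linearP.
exists (g \o p)%VF => phi; apply/lfunP => w.
by rewrite !comp_lfunE -[RHS]eval_atE -evE gK pE comp_lfunE eval_atE.
Qed.

Implicit Types M N : module4 R.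

Definition m4_dual M : module4 R :=
  @Module4 R 'Hom(M, R^o) (fun i => ann (m4_sub M i)).

Lemma m4_dual_dim M : m4_dim (m4_dual M) = m4_dim M.
Proof. exact: dim_dual. Qed.

Lemma m4_dual_subdim M i :
  (m4_subdim (m4_dual M) i + m4_subdim M i)%N = m4_dim M.
Proof. exact: dim_ann. Qed.

Lemma m4_dual_total M : (m4_total (m4_dual M) + m4_total M)%N = (4 * m4_dim M)%N.
Proof.
rewrite /m4_total -big_split /=.
by under eq_bigr do rewrite m4_dual_subdim; rewrite sum_nat_const card_ord.
Qed.

Lemma m4_dual_hom M N (f : 'Hom(M, N)) :
  m4_hom f -> m4_hom (adjoint f : 'Hom(m4_dual N, m4_dual M)).
Proof.
move=> fM i phi /annP p0; apply/annP => x xi.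
by rewrite adjointE comp_lfunE p0 // fM.
Qed.

Lemma m4_dual_iso M N : m4_iso M N -> m4_iso (m4_dual M) (m4_dual N).
Proof.
move=> /m4_isoP[f [g [fM gM fK gK]]]; apply/m4_isoP.
exists (adjoint g), (adjoint f); split; try exact: m4_dual_hom.
  by move=> phi; rewrite !adjointE; apply/lfunP => x; rewrite !comp_lfunE fK.
by move=> phi; rewrite !adjointE; apply/lfunP => x; rewrite !comp_lfunE gK.
Qed.

Lemma m4_dual_full M N (psi : 'Hom(m4_dual M, m4_dual N)) : m4_hom psi ->
  exists f : 'Hom(N, M), m4_hom f /\ forall phi, psi phi = (phi \o f)%VF.
Proof.
move=> psiM; have [f fE] := dual_full psi; exists f; split=> // i x xi.
apply/negPn/negP => /functional_sep[h [hx hM]].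
have /annP/(_ x xi) : psi h \in ann (m4_sub N i) by apply: psiM; apply/annP.
by rewrite fE comp_lfunE hx => /eqP; rewrite oner_eq0.
Qed.

Lemma m4_bidual M : m4_iso M (m4_dual (m4_dual M)).
Proof.
have [ev [evE evI evS]] := bidual_ex M.
have [||g fg] := @m4_iso_of_total _ M (m4_dual (m4_dual M)) ev _ evI evS.
- move=> i x xi; rewrite evE; apply/annP => phi /annP p0.
  by rewrite eval_atE p0.
- have := m4_dual_total M; have := m4_dual_total (m4_dual M).
  by rewrite m4_dual_dim; lia.
by apply/m4_isoP; exists ev, g.
Qed.

Lemma m4_dual_iso_inv M N : m4_iso (m4_dual M) (m4_dual N) -> m4_iso M N.
Proof.
move=> /m4_dual_iso iso; apply: m4_iso_trans (m4_bidual M) _.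
exact: m4_iso_trans iso (m4_iso_sym (m4_bidual N)).
Qed.

Lemma m4_dual_indec M : indec M -> indec (m4_dual M).
Proof.
move=> iM; have [_ iM'] := iM; split.
  exists (vpick {:m4_dual M}); rewrite vpick0 -dimv_eq0 -lt0n.
  by rewrite -[\dim _]/(m4_dim (m4_dual M)) m4_dual_dim indec_dim.
move=> psi psiM pp; have [f [fM fE]] := m4_dual_full psiM.
have ff x : f (f x) = f x.
  apply: dual_separates => phi; have /lfunP/(_ x) := pp phi.
  by rewrite !fE !comp_lfunE.
have [f0|f1] := iM' f fM ff; [left|right] => phi; apply/lfunP => x; rewrite fE comp_lfunE.
  by rewrite f0 linear0 zero_lfunE.
by rewrite f1.
Qed.

Lemma defect_pos_unique M N : indec M -> indec N ->
  (2 * m4_dim M < m4_total M)%N ->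
  m4_dim M = m4_dim N -> m4_subdim M =1 m4_subdim N -> m4_iso M N.
Proof.
move=> iM iN tM dMN sMN; apply: m4_dual_iso_inv.
apply: defect_neg_unique; try exact: m4_dual_indec.
- by have := m4_dual_total M; rewrite m4_dual_dim; lia.
- by rewrite !m4_dual_dim.
- by move=> i; have := m4_dual_subdim M i; have := m4_dual_subdim N i; rewrite -dMN -sMN; lia.
Qed.

End Duality.

(** * Dot products on arbitrary spaces *)

Section StandardDot.
Variables (R : realType) (V : vectType R).

(** The dot product for which [vbasis] is orthonormal; it supplies the Hilbert structure when a
    datum is built from a module. *)
Definition std_dot (u v : V) : R := \sum_i coord (vbasis {:V}) i u * coord (vbasis {:V}) i v.

Fact std_dot_bilinear : bilinear_for *%R (idfun \; *%R) std_dot.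
Proof.
split=> w a u v /=; rewrite /std_dot mulr_sumr -big_split;
  apply: eq_bigr => i _; rewrite /= linearP /= ?mulrDl ?mulrDr ?mulrA //.
by rewrite [a * _]mulrC.
Qed.

HB.instance Definition _ :=
  bilinear_isBilinear.Build R V V R *%R (idfun \; *%R) std_dot std_dot_bilinear.

Fact std_dot_hermitian u v : std_dot u v = (-1) ^+ false * idfun (std_dot v u).
Proof. by rewrite mul1r; apply: eq_bigr => i _; rewrite mulrC. Qed.

HB.instance Definition _ :=
  isHermitianSesquilinear.Build R V false idfun std_dot std_dot_hermitian.

Fact std_dot_gt0 u : u != 0 -> 0 < std_dot u u.
Proof.
move=> u0; rewrite lt_def; apply/andP; split; last first.
  by apply: sumr_ge0 => i _; rewrite -expr2 sqr_ge0.
apply: contra u0; rewrite psumr_eq0 => [/allP u0|i _]; last by rewrite -expr2 sqr_ge0.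
rewrite (coord_vbasis (memvf u)) big1 // => i _.
by have := u0 i (mem_index_enum _); rewrite -expr2 sqrf_eq0 => /eqP->; rewrite scale0r.
Qed.

HB.instance Definition _ := isDotProduct.Build R V std_dot std_dot_gt0.

Definition std_hilbert : hilbert R := @Hilbert R V std_dot.
End StandardDot.

(** * Data as quadruples of kernels *)

Section Data.
Variable R : realType.
Implicit Types H : bl_datum R.

(** A functional killing the kernel of [f] does not see which preimage [f^-1] selects, so it factors
    as [phi \o f^-1] after [f]. *)
Lemma limg_adjoint (V W : vectType R) (f : 'Hom(V, W)) :
  limg (adjoint f) = ann (lker f).
Proof.
apply/vspaceP => phi; apply/memv_imgP/annP => [[psi _ -> a]|p0].
  by rewrite memv_ker adjointE comp_lfunE => /eqP->; rewrite linear0.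
exists (phi \o f^-1)%VF; first exact: memvf.
rewrite adjointE; apply/lfunP => x; rewrite !comp_lfunE; apply/eqP.
rewrite -subr_eq0 -linearB; apply/eqP/p0.
by rewrite memv_ker linearB /= limg_lfunVK ?memv_img ?memvf // subrr.
Qed.

Lemma m4_iso_ext (V : vectType R) (A B : 'I_4 -> {vspace V}) :
  A =1 B -> m4_iso (Module4 A) (Module4 B).
Proof.
move=> AB; apply/m4_isoP; exists \1%VF, \1%VF.
by split=> [i x|i x|x|x]; rewrite ?id_lfunE //= AB.
Qed.

Definition ker_module H : module4 R :=
  @Module4 R (bl_dom H) (fun i => lker (bl_map H i)).

Lemma bl_module_dual H : m4_iso (bl_module H) (m4_dual (ker_module H)).
Proof. by apply: m4_iso_ext => i; rewrite limg_adjoint. Qed.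

(** By surjectivity each [bl_cod H i] is the quotient of the domain by a kernel, so an isomorphism
    matching the kernels induces the maps [phi_ i]. *)
Lemma bl_equiv_ker H H' : bl_equiv H H' <-> m4_iso (ker_module H) (ker_module H').
Proof.
split=> [[phi [phi_ [phiB phi_B phiE]]]|/m4_isoP[f [g [fM gM fK gK]]]].
  exists phi; split=> // i.
  have [g phiK gK] := phiB.
  have E x : bl_map H' i (phi x) = phi_ i (bl_map H i x).
    by rewrite -!comp_lfunE phiE.
  have ker x : (bl_map H' i (phi x) == 0) = (bl_map H i x == 0).
    by rewrite E -(inj_eq (bij_inj (phi_B i))) linear0.
  apply/vspaceP => x; apply/memv_imgP/idP => [[y]|]; rewrite !memv_ker.
    by move=> y0 ->; rewrite ker.
  by move=> x0; exists (g x); rewrite ?gK // memv_ker -ker gK.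
have inv_ker (G : bl_datum R) i x : x - (bl_map G i)^-1%VF (bl_map G i x) \in lker (bl_map G i).
  by rewrite memv_ker linearB /= limg_lfunVK ?memv_img ?memvf // subrr.
pose f_ i : 'Hom(bl_cod H i, bl_cod H' i) := (bl_map H' i \o (f \o (bl_map H i)^-1))%VF.
pose g_ i : 'Hom(bl_cod H' i, bl_cod H i) := (bl_map H i \o (g \o (bl_map H' i)^-1))%VF.
have f_E i x : f_ i (bl_map H i x) = bl_map H' i (f x).
  have := fM i _ (inv_ker H i x); rewrite memv_ker !linearB /= subr_eq0 => /eqP->.
  by rewrite !comp_lfunE.
have g_E i x : g_ i (bl_map H' i x) = bl_map H i (g x).
  have := gM i _ (inv_ker H' i x); rewrite memv_ker !linearB /= subr_eq0 => /eqP->.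
  by rewrite !comp_lfunE.
have surj (G : bl_datum R) i y : exists x, y = bl_map G i x.
  by have := memvf y; rewrite -(bl_surj G i) => /memv_imgP[x _ ->]; exists x.
exists f, f_; split=> [|i|i]; first by exists g.
  exists (g_ i) => y; have [x ->] := surj _ i y.
    by rewrite f_E g_E fK.
  by rewrite g_E f_E gK.
by apply/lfunP => x; rewrite [LHS]comp_lfunE [RHS]comp_lfunE f_E.
Qed.

Lemma bl_equiv_module H H' : bl_equiv H H' <-> m4_iso (bl_module H) (bl_module H').
Proof.
rewrite bl_equiv_ker; split=> iso.
  apply: m4_iso_trans (bl_module_dual H) _.
  apply: m4_iso_trans (m4_iso_sym (bl_module_dual H')).
  exact: m4_dual_iso.
apply: m4_dual_iso_inv; apply: m4_iso_trans (m4_iso_sym (bl_module_dual H)) _.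
exact: m4_iso_trans iso (bl_module_dual H').
Qed.

Lemma ker_module_surj (V : vectType R) (A : 'I_4 -> {vspace V}) :
  exists H, m4_iso (ker_module H) (Module4 A).
Proof.
pose W i := projT1 (cid (quot_exists (A i))).
pose q i : 'Hom(V, W i) := sval (cid (projT2 (cid (quot_exists (A i))))).
have qP i : limg (q i) = fullv /\ lker (q i) = A i.
  exact: svalP (cid (projT2 (cid (quot_exists (A i))))).
exists (@BLDatum R (std_hilbert V) (fun i => std_hilbert (W i)) q (fun i => (qP i).1)).
by apply: m4_iso_ext => i; rewrite (qP i).2.
Qed.

Lemma bl_module_surj (M : module4 R) : exists H, m4_iso (bl_module H) M.
Proof.
have [H iso] := ker_module_surj (m4_sub (m4_dual M)).
exists H; apply: m4_iso_trans (bl_module_dual H) _.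
apply: m4_iso_trans (m4_iso_sym (m4_bidual M)).
exact: m4_dual_iso.
Qed.

End Data.

(** * Indecomposables of defect zero: trivial intersections *)

Section DefectZero.
Variable R : realType.
Implicit Types M N Q : module4 R.

Lemma perm_index4 (a b c d : 'I_4) : uniq [:: a; b; c; d] ->
  perm_eq (index_enum 'I_4) [:: a; b; c; d].
Proof.
move=> u; rewrite perm_sym; apply: uniq_perm => //; first exact: index_enum_uniq.
have [||_ E i] := @uniq_min_size _ [:: a; b; c; d] (enum 'I_4) u.
- by move=> i _; rewrite mem_enum.
- by rewrite size_enum_ord.
- by rewrite E mem_enum mem_index_enum.
Qed.

Lemma index4P (a b c d i : 'I_4) : uniq [:: a; b; c; d] ->
  [\/ i = a, i = b, i = c | i = d].
Proof.
move=> /perm_index4/perm_mem/(_ i); rewrite mem_index_enum !inE => /esym.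
by case/or4P => /eqP; [constructor 1|constructor 2|constructor 3|constructor 4].
Qed.

Lemma total4 M (a b c d : 'I_4) : uniq [:: a; b; c; d] ->
  m4_total M = (m4_subdim M a + m4_subdim M b + m4_subdim M c + m4_subdim M d)%N.
Proof.
move=> /perm_index4 pm; rewrite /m4_total (perm_big _ pm) /= !big_cons big_nil.
by rewrite addn0 !addnA.
Qed.

(** If x is nonzero, a functional h with h x = 1, killing M_d unless x lies in it, makes
    [indec_line] applicable. M is then a line with at least three full subspaces, too many for
    defect zero. *)
Lemma triple_meet0 M (a b c d : 'I_4) (x : M) : uniq [:: a; b; c; d] ->
  indec M -> m4_total M = (2 * m4_dim M)%N ->
  x \in m4_sub M a -> x \in m4_sub M b -> x \in m4_sub M c -> x = 0.
Proof.
move=> u iM tM xa xb xc; apply/eqP/negPn/negP => x0.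
have [h [hx hd]] : exists h : 'Hom(M, R^o), h x = 1 /\
    (x \notin m4_sub M d -> forall y, y \in m4_sub M d -> h y = 0).
  have [xd|/functional_sep[h [hx hd]]] := boolP (x \in m4_sub M d); last by exists h.
  have /functional_sep[h [hx _]] : x \notin 0%VS by rewrite memv0.
  by exists h.
have [i|d1 e1 _] := indec_line iM hx.
  have [->|->|->|->] := index4P i u; try by left.
  by have [xd|/hd] := boolP (x \in m4_sub M d); [left|right].
by move: tM; rewrite (total4 M u) (e1 a) // (e1 b) // (e1 c) // d1.
Qed.

Definition triv M i j : Prop := (m4_sub M i :&: m4_sub M j = 0)%VS.

Lemma trivP M i j :
  triv M i j <-> forall x, x \in m4_sub M i -> x \in m4_sub M j -> x = 0.
Proof.
split=> [t x xi xj|t]; first by apply/eqP; rewrite -memv0 -t memv_cap xi xj.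
apply/eqP; rewrite -subv0; apply/subvP => x; rewrite memv_cap => /andP[xi xj].
by rewrite (t x xi xj) mem0v.
Qed.

Lemma triv_sym M i j : triv M i j -> triv M j i.
Proof. by rewrite /triv capvC. Qed.

Lemma triv_iso M N i j : m4_iso M N -> triv N i j -> triv M i j.
Proof.
move=> /m4_isoP[f [g [fM gM fK gK]]] /trivP t; apply/trivP => x xi xj.
by rewrite -[x]fK (t (f x)) ?fM // linear0.
Qed.

Lemma triv_sum k (Q : 'I_k -> module4 R) i j :
  (forall l, triv (Q l) i j) -> triv (m4_sum Q) i j.
Proof.
elim: k Q => [|k IH] Q t; apply/trivP.
  by rewrite m4_sum0 => x _ _; rewrite (thinmx0 x).
rewrite m4_sum_recl => x /madd_mem[x1i x2i] /madd_mem[x1j x2j].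
have /trivP t2 := IH (fun l => Q (lift ord0 l)) (fun l => t _).
have /trivP t1 := t ord0.
by rewrite [x]m4_sub_sum (t1 _ x1i x1j) (t2 _ x2i x2j) !linear0 addr0.
Qed.

Lemma triv_dim M i j : triv M i j ->
  (m4_subdim M i + m4_subdim M j)%N = \dim (m4_sub M i + m4_sub M j)%VS.
Proof. by move=> /dimv_disjoint_sum ->. Qed.

(** M_a and M_b being disjoint, their dimensions add up to at most dim M; defect zero leaves at
    least dim M for M_c and M_d, which are disjoint as well. *)
Lemma triv_full M (a b c d : 'I_4) : uniq [:: a; b; c; d] ->
  m4_total M = (2 * m4_dim M)%N -> triv M a b -> triv M c d ->
  (m4_sub M c + m4_sub M d)%VS = fullv.
Proof.
move=> u; rewrite (total4 M u) => tM /triv_dim ab /triv_dim cd.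
apply/eqP; rewrite eqEdim subvf -cd -[\dim {:M}]/(m4_dim M).
have := dimvS (subvf (m4_sub M a + m4_sub M b)%VS).
by rewrite -ab -[\dim {:M}]/(m4_dim M); lia.
Qed.

Lemma sum_retract k (Q : 'I_k -> module4 R) j :
  exists (s : 'Hom(Q j, m4_sum Q)) (r : 'Hom(m4_sum Q, Q j)),
    [/\ m4_hom s, m4_hom r & cancel s r].
Proof.
elim: k Q j => [|k IH] Q j; first by case: j.
rewrite m4_sum_recl; have [l ->|->] := unliftP ord0 j; last first.
  exists (madd_inl _ _), (madd_fst _ _); split.
  - exact: madd_inl_hom.
  - exact: madd_fst_hom.
  - by move=> x; rewrite !maddE.
have [s [r [sM rM sK]]] := IH (fun l => Q (lift ord0 l)) l.
exists (madd_inr _ _ \o s)%VF, (r \o madd_snd _ _)%VF; split.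
- by apply: m4_hom_comp sM; apply: madd_inr_hom.
- by apply: m4_hom_comp rM _; apply: madd_snd_hom.
- by move=> x; rewrite !comp_lfunE !maddE /= sK.
Qed.

Lemma m4_dim_sum k (Q : 'I_k -> module4 R) : m4_dim (m4_sum Q) = (\sum_j m4_dim (Q j))%N.
Proof.
elim: k Q => [|k IH] Q; first by rewrite m4_sum0 m4_dim0 big_ord0.
by rewrite m4_sum_recl m4_dim_add IH big_ord_recl.
Qed.

Lemma m4_total_sum k (Q : 'I_k -> module4 R) :
  m4_total (m4_sum Q) = (\sum_j m4_total (Q j))%N.
Proof.
elim: k Q => [|k IH] Q; first by rewrite m4_sum0 m4_total0 big_ord0.
by rewrite m4_sum_recl m4_total_add IH big_ord_recl.
Qed.

(** The lift is defined on Q_c and Q_d by sections with values in M_c and M_d. On Q_a and Q_b any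
    lift is correct up to a multiple of x, which belongs to M_a and M_b. *)
Lemma lift_along_quotient M (W : vectType R) (q : 'Hom(M, W)) (x : M)
    (a b c d : 'I_4) Q (f : 'Hom(Q, Module4 (fun i => q @: m4_sub M i)%VS)) :
  uniq [:: a; b; c; d] -> lker q = <[x]>%VS ->
  x \in m4_sub M a -> x \in m4_sub M b -> m4_hom f ->
  triv Q c d -> (m4_sub Q c + m4_sub Q d)%VS = fullv ->
  exists s : 'Hom(Q, M), m4_hom s /\ forall z, q (s z) = f z.
Proof.
move=> u kq xa xb fM tcd fcd.
have [tc tcE] := lfun_section q (m4_sub M c).
have [td tdE] := lfun_section q (m4_sub M d).
have tcd' : (m4_sub Q d :&: m4_sub Q c = 0)%VS by rewrite capvC.
pose pc := daddv_pi (m4_sub Q c) (m4_sub Q d).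
pose pd := daddv_pi (m4_sub Q d) (m4_sub Q c).
have pcdE z : pc z + pd z = z by rewrite /pc /pd daddv_pi_add // fcd memvf.
have pcM z : f (pc z) \in (q @: m4_sub M c)%VS by apply: (fM c); apply: memv_pi.
have pdM z : f (pd z) \in (q @: m4_sub M d)%VS by apply: (fM d); apply: memv_pi.
pose s : 'Hom(Q, M) := (tc \o (f \o pc))%VF + (td \o (f \o pd))%VF.
have sE z : s z = tc (f (pc z)) + td (f (pd z)) by rewrite add_lfunE !comp_lfunE.
have qs z : q (s z) = f z.
  by rewrite sE linearD /= (tcE _ (pcM z)).2 (tdE _ (pdM z)).2 -linearD pcdE.
exists s; split=> // i z zi.
have sat e : e = a \/ e = b -> z \in m4_sub Q e -> s z \in m4_sub M e.
  move=> ee ze; have /memv_imgP[y ye qy] : f z \in (q @: m4_sub M e)%VS by apply: (fM e).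
  have : s z - y \in lker q by rewrite memv_ker linearB /= qs qy subrr.
  rewrite kq => /vlineP[l /eqP]; rewrite subr_eq => /eqP->.
  by rewrite rpredD // rpredZ //; case: ee => ->.
case: (index4P i u) zi => -> zi.
- by apply: sat zi; left.
- by apply: sat zi; right.
- have pz : pd z = 0 by rewrite /pd daddv_pi0.
  by rewrite sE pz !linear0 addr0 (tcE _ (pcM z)).1.
- have pz : pc z = 0 by rewrite /pc daddv_pi0.
  by rewrite sE pz !linear0 add0r (tdE _ (pdM z)).1.
Qed.

(** A dichotomy for each splitting of the indices into two pairs. For a summand of a quotient M/x
    the first alternative allows a lift and is thereby refuted, which leaves the second one to be
    carried up to M. *)
Definition cross_triv M := forall a b c d : 'I_4, uniq [:: a; b; c; d] ->
  triv M a b /\ triv M c d \/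
  [/\ triv M a c, triv M b d, triv M a d & triv M b c].

Lemma cross_triv_step M (a b c d : 'I_4) (x : M) :
  uniq [:: a; b; c; d] -> indec M -> m4_total M = (2 * m4_dim M)%N ->
  (forall Q, indec Q -> m4_total Q = (2 * m4_dim Q)%N ->
     (m4_dim Q < m4_dim M)%N -> cross_triv Q) ->
  x != 0 -> x \in m4_sub M a -> x \in m4_sub M b ->
  [/\ triv M a c, triv M b d, triv M a d & triv M b c].
Proof.
move=> u iM tM IH x0 xa xb.
have xc : x \notin m4_sub M c.
  by apply: contra x0 => xc; apply/eqP; apply: triple_meet0 u iM tM xa xb xc.
have xd : x \notin m4_sub M d.
  have u' : uniq [:: a; b; d; c].
    by rewrite -(perm_uniq (s1 := [:: a; b; c; d])) // !perm_cons (perm_catC [:: c] [:: d]).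
  by apply: contra x0 => xd; apply/eqP; apply: triple_meet0 u' iM tM xa xb xd.
have [W [q [qS kq]]] := quot_exists <[x]>%VS.
pose Mq := Module4 (fun i => q @: m4_sub M i)%VS.
have qM : m4_hom (q : 'Hom(M, Mq)) by move=> i y yi; apply: memv_img.
have dx : \dim <[x]> = 1%N by rewrite dim_vline x0.
have dMq : (m4_dim Mq).+1 = m4_dim M.
  rewrite /m4_dim -[\dim {:M}](limg_ker_dim q) capfv kq dx qS add1n //.
have sub_ab e : x \in m4_sub M e -> (m4_subdim Mq e).+1 = m4_subdim M e.
  move=> xe; rewrite /m4_subdim -[\dim (m4_sub M e)](limg_ker_dim q) kq.
  by have /capv_idPr -> : (<[x]> <= m4_sub M e)%VS; rewrite -?memvE ?dx.
have sub_cd e : (m4_subdim Mq e <= m4_subdim M e)%N.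
  by rewrite /m4_subdim -[\dim (m4_sub M e)](limg_ker_dim q) leq_addl.
(* M_a and M_b each lose one dimension and the other two subspaces cannot grow, so the quotient has
   defect at most zero. *)
have tMq : (m4_total Mq <= 2 * m4_dim Mq)%N.
  move: tM; rewrite !(total4 _ u); have := sub_ab _ xa; have := sub_ab _ xb.
  by have := sub_cd c; have := sub_cd d; lia.
have [k [Q [iQ /[dup] iso /m4_isoP[f [g [fM gM fK gK]]]]]] := indec_decomp Mq.
have surj j (r : 'Hom(m4_sum Q, Q j)) (s : 'Hom(Q j, m4_sum Q)) z : cancel s r ->
    exists y, (r \o (f \o q))%VF y = z.
  move=> sK; have : g (s z) \in limg q by rewrite qS memvf.
  by move=> /memv_imgP[y _ yE]; exists y; rewrite !comp_lfunE -yE gK sK.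
(* M maps onto every summand of the quotient, and [hom_defect_neg] forbids this for negative defect.
   Together with [tMq], all summands have defect exactly zero. *)
have defge j : (2 * m4_dim (Q j) <= m4_total (Q j))%N.
  rewrite leqNgt; apply/negP => lt.
  have [s [r [sM rM sK]]] := sum_retract Q j.
  have [[z z0] _] := iQ j; have [y yE] := surj j r s z sK.
  have h0 := hom_defect_neg iM (iQ j) tM lt (m4_hom_comp rM (m4_hom_comp fM qM)).
  by move: z0; rewrite -yE h0 zero_lfunE eqxx.
have defeq j : m4_total (Q j) = (2 * m4_dim (Q j))%N.
  apply/eqP; rewrite eqn_leq defge andbT.
  move: tMq; rewrite (m4_iso_total iso) (m4_iso_dim iso).1 m4_total_sum m4_dim_sum big_distrr /=.
  rewrite (bigD1 j) //= [X in (_ <= X)%N](bigD1 j) //=.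
  have : (\sum_(l < k | l != j) 2 * m4_dim (Q l) <= \sum_(l < k | l != j) m4_total (Q l))%N.
    by apply: leq_sum => l _; apply: defge.
  set A := (\sum_(l < k | _) _)%N; set B := (\sum_(l < k | _) _)%N; lia.
have dimQ j : (m4_dim (Q j) < m4_dim M)%N.
  by rewrite -dMq ltnS (m4_iso_dim iso).1 m4_dim_sum (bigD1 j) //= leq_addr.
(* In the first alternative [triv_full] makes Q_c and Q_d complementary, so [Q j] lifts to a retract
   of M, hence to M itself; but the retraction factors through [q] and kills x. *)
have crossQ j : [/\ triv (Q j) a c, triv (Q j) b d, triv (Q j) a d & triv (Q j) b c].
  have [[tab tcd]|//] := IH (Q j) (iQ j) (defeq j) (dimQ j) a b c d u.
  have fcd := triv_full u (defeq j) tab tcd.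
  have [s [r [sM rM sK]]] := sum_retract Q j.
  have [t [tM' tE]] := lift_along_quotient u kq xa xb (m4_hom_comp gM sM) tcd fcd.
  have tK : cancel t (r \o (f \o q))%VF.
    by move=> z; rewrite !comp_lfunE tE comp_lfunE gK sK.
  have [_ _ _ rK] := retract_inv iM (iQ j).1 tM' (m4_hom_comp rM (m4_hom_comp fM qM)) tK.
  have qx : q x = 0 by apply/eqP; rewrite -memv_ker kq memv_line.
  by move: x0; rewrite -[x]rK !comp_lfunE qx !linear0 eqxx.
(* A vector of M_e' and M_e dies in the quotient, so it is a multiple of x; since x is not in M_e,
   the multiple is zero. *)
have down e e' : x \notin m4_sub M e -> (forall j, triv (Q j) e' e) -> triv M e' e.
  move=> xe tQ; have /trivP t : triv Mq e' e by apply: triv_iso iso (triv_sum tQ).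
  apply/trivP => y ye' ye.
  have : y \in lker q by rewrite memv_ker (t (q y)) ?memv_img.
  rewrite kq => /vlineP[l yl]; have [l0|l0] := eqVneq l 0; first by rewrite yl l0 scale0r.
  by move: ye; rewrite yl rpredZeq (negbTE l0) (negbTE xe).
split; apply: down => // j; have [] := crossQ j => //.
Qed.

Theorem cross_triv_indec M : indec M -> m4_total M = (2 * m4_dim M)%N -> cross_triv M.
Proof.
have [n] := ubnP (m4_dim M); elim: n M => // n IH M /ltnSE dM iM tM a b c d u.
have {}IH Q : indec Q -> m4_total Q = (2 * m4_dim Q)%N ->
    (m4_dim Q < m4_dim M)%N -> cross_triv Q.
  by move=> iQ tQ dQ; apply: IH => //; apply: leq_trans dM.
have [tab|/eqP ntab] := eqVneq (m4_sub M a :&: m4_sub M b)%VS 0%VS; last first.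
  right; have : exists2 x, x != 0 & x \in (m4_sub M a :&: m4_sub M b)%VS.
    by exists (vpick (m4_sub M a :&: m4_sub M b)); rewrite ?memv_pick // vpick0; apply/eqP.
  move=> [x x0]; rewrite memv_cap => /andP[xa xb].
  exact: cross_triv_step u iM tM IH x0 xa xb.
have [tcd|/eqP ntcd] := eqVneq (m4_sub M c :&: m4_sub M d)%VS 0%VS; first by left.
right; have : exists2 x, x != 0 & x \in (m4_sub M c :&: m4_sub M d)%VS.
  by exists (vpick (m4_sub M c :&: m4_sub M d)); rewrite ?memv_pick // vpick0; apply/eqP.
move=> [x x0]; rewrite memv_cap => /andP[xc xd].
have u' : uniq [:: c; d; a; b].
  by rewrite -(perm_uniq (s1 := [:: a; b; c; d])) // (perm_catC [:: a; b] [:: c; d]).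
have [ca db cb da] := cross_triv_step u' iM tM IH x0 xc xd.
by split; apply: triv_sym.
Qed.
End DefectZero.

(** * Operators without commuting idempotents *)

Section Cyclic.
Variable F : fieldType.
Implicit Types P q g h : {poly F}.

Lemma monic_irreducible_dvd q : (1 < size q)%N ->
  exists P, [/\ P \is monic, irreducible_poly P & P %| q].
Proof.
have [n] := ubnP (size q); elim: n q => // n IH q /ltnSE sq q1.
have q0 : q != 0 by rewrite -size_poly_gt0 ltnW.
have [irr|nirr] := pselect (irreducible_poly q).
  have lc0 : (lead_coef q)^-1 != 0 by rewrite invr_eq0 lead_coef_eq0.
  have eqq : (lead_coef q)^-1 *: q %= q by rewrite eqp_scale.
  exists ((lead_coef q)^-1 *: q); split; last by rewrite (eqp_dvdl _ eqq).
    by rewrite monicE lead_coefZ mulVf // lead_coef_eq0.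
  split=> [|d d1 dq]; first by rewrite size_scale.
  have := irr.2 d d1; rewrite -(eqp_dvdr d eqq) => /(_ dq) dqq.
  by apply: eqp_trans dqq _; rewrite eqp_sym.
have [d [d1 dq ndq]] : exists d : {poly F}, [/\ size d != 1%N, d %| q & ~~ (d %= q)].
  apply: contrapT => nd; apply: nirr; split=> // d d1 dq.
  by apply/negPn/negP => ndq; apply: nd; exists d.
have d0 : d != 0 by apply: contraNneq q0 => d0; rewrite -dvd0p -d0.
have [||P [Pm Pi Pd]] := IH d.
- apply: leq_trans sq; rewrite ltn_neqAle (dvdp_leq q0 dq) andbT.
  by rewrite (dvdp_size_eqp dq).
- by move: d0; rewrite -size_poly_gt0; case: (size d) d1 => [|[|]].
by exists P; split=> //; apply: dvdp_trans dq.
Qed.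

Lemma irreducible_multiplicity P q : irreducible_poly P -> q != 0 ->
  exists s r, q = P ^+ s * r /\ ~~ (P %| r).
Proof.
move=> irr; have [n] := ubnP (size q); elim: n q => // n IH q /ltnSE sq q0.
have [/dvdpP[r qr]|ndvd] := boolP (P %| q); last by exists 0%N, q; rewrite mul1r.
have r0 : r != 0 by apply: contraNneq q0 => r0; rewrite qr r0 mul0r.
have [|s [t [rt nt]]] := IH r _ r0.
  apply: leq_trans sq; rewrite qr size_mul ?(irredp_neq0 irr) //.
  by have := irr.1; case: (size P) => [|[|k]] // _; rewrite !addnS ltnS leq_addr.
by exists s.+1, t; split=> //; rewrite qr rt exprSr mulrAC.
Qed.

Lemma irreducible_coprime P r : irreducible_poly P -> ~~ (P %| r) -> coprimep P r.
Proof.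
by move=> irr nd; rewrite irreducible_poly_coprime.
Qed.

Lemma irreducible_pow_dvd P s g h : irreducible_poly P -> coprimep g h ->
  P ^+ s %| g * h -> (P ^+ s %| g) || (P ^+ s %| h).
Proof.
move=> irr co dv; have [Ph|nPh] := boolP (P %| h); last first.
  by rewrite -(Gauss_dvdpl g (coprimep_expl s (irreducible_coprime irr nPh))) dv.
have nPg : ~~ (P %| g).
  apply/negP => Pg; have Pgcd : P %| gcdp g h by rewrite dvdp_gcd Pg.
  move: co; rewrite /coprimep => /eqP sg.
  have g0 : gcdp g h != 0 by rewrite -size_poly_eq0 sg.
  by have := dvdp_leq g0 Pgcd; rewrite sg leqNgt irr.1.
by rewrite orbC -(Gauss_dvdpr h (coprimep_expl s (irreducible_coprime irr nPg))) dv.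
Qed.

(** Indecomposability, up to the zero case, of F^n as a module over F[t] with t acting by [X]. *)
Definition no_idempotent n (X : 'M[F]_n) :=
  forall p : 'M_n, p *m X = X *m p -> p *m p = p -> p = 0 \/ p = 1%:M.

(** The entries of a companion matrix without its size being tied to [size q], so that Jordan blocks
    fit as well. *)
Definition companion_shape n (X : 'M[F]_n) q :=
  X = \matrix_(i, j) (if i == n.-1 :> nat then - q`_j else (i.+1 == j :> nat)%:R).

Lemma horner_mx_wide n (X : 'M[F]_n.+1) g d : (size g <= d)%N ->
  horner_mx X g = \sum_(i < d) g`_i *: X ^+ i.
Proof.
move=> sg; have {1}-> : g = \poly_(i < d) g`_i.
  apply/polyP => i; rewrite coef_poly; case: ltnP => // di.
  by rewrite nth_default // (leq_trans sg).
rewrite poly_def linear_sum; apply: eq_bigr => i _.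
by rewrite linearZ /= rmorphXn /= horner_mx_X.
Qed.

Lemma mul_horner_mxE m n (A : 'M[F]_(m, n.+1)) (X : 'M[F]_n.+1) g d i j :
  (size g <= d)%N ->
  (A *m horner_mx X g) i j = \sum_(k < d) g`_k * (A *m X ^+ k) i j.
Proof.
move=> sg; rewrite (horner_mx_wide _ sg) linear_sum summxE.
by apply: eq_bigr => k _; rewrite linearZ /= mxE.
Qed.

Lemma horner_mx_mulE m n (A : 'M[F]_(n.+1, m)) (X : 'M[F]_n.+1) g d i j :
  (size g <= d)%N ->
  (horner_mx X g *m A) i j = \sum_(k < d) g`_k * (X ^+ k *m A) i j.
Proof.
move=> sg; rewrite (horner_mx_wide _ sg) -[_ *m A]/(mulmxr A _) linear_sum summxE.
by apply: eq_bigr => k _; rewrite linearZ /= mxE.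
Qed.

Lemma companion_row_pow n (X : 'M[F]_n.+1) q i : companion_shape X q ->
  (i < n.+1)%N -> delta_mx 0 0 *m X ^+ i = delta_mx 0 (inord i) :> 'rV_n.+1.
Proof.
move=> XE; elim: i => [|i IH] lti.
  have -> : inord 0 = 0 :> 'I_n.+1 by apply: ord_inj; rewrite inordK.
  by rewrite expr0 mulmx1.
rewrite exprSr -[X ^+ i * X]/(X ^+ i *m X) mulmxA IH ?(ltnW lti) //.
rewrite -rowE; apply/rowP => j; rewrite !mxE /= XE mxE inordK ?(ltnW lti) //.
by rewrite ltn_eqF //= -val_eqE /= inordK // eq_sym.
Qed.

(** It suffices to evaluate on the first basis row, which is cyclic, because q(X) commutes with the
    powers of [X]. *)
Lemma companion_annihilates n (X : 'M[F]_n.+1) q : companion_shape X q ->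
  q \is monic -> size q = n.+2 -> horner_mx X q = 0.
Proof.
move=> XE qm sq.
have key : delta_mx 0 0 *m horner_mx X q = 0 :> 'rV_n.+1.
  apply/rowP => j; rewrite (@mul_horner_mxE _ _ _ _ _ n.+2) ?sq // big_ord_recr /=.
  have -> : q`_n.+1 = 1 by have := monicP qm; rewrite /lead_coef sq.
  rewrite mul1r exprSr -[X ^+ n * X]/(X ^+ n *m X) mulmxA (companion_row_pow XE) //.
  have -> : (delta_mx 0 (inord n) *m X : 'rV_n.+1) 0 j = - q`_j.
    by rewrite -rowE mxE XE mxE inordK // eqxx.
  rewrite (bigD1 j) //= big1 => [|i ij]; rewrite (companion_row_pow XE) // !mxE inord_val.
    by rewrite !eqxx mulr1 addr0 subrr.
  by rewrite eqxx eq_sym (negbTE ij) mulr0.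
apply/row_matrixP => i; rewrite row0 rowE -[i]inord_val -(companion_row_pow XE) //.
rewrite -mulmxA -[X ^+ i *m _]/(X ^+ i * horner_mx X q).
have -> : X ^+ i * horner_mx X q = horner_mx X q * X ^+ i.
  by rewrite -[X in X ^+ i](horner_mx_X X) -rmorphXn -!rmorphM mulrC.
by rewrite -[_ * _]/(horner_mx X q *m X ^+ i) mulmxA key mul0mx.
Qed.

(** The first basis row is cyclic, so whatever commutes with [X] is g(X), with g read off from the
    image of that row. For an idempotent, P^s divides g (g - 1); the factors are coprime, so it
    divides one of them. *)
Lemma companion_no_idempotent n (X : 'M[F]_n) P s : companion_shape X (P ^+ s) ->
  P \is monic -> irreducible_poly P -> size (P ^+ s) = n.+1 -> no_idempotent X.
Proof.
case: n X => [|n] X XE Pm irr sq p pX pp; first by left; rewrite [p]thinmx0.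
set q := P ^+ s in XE sq; have qm : q \is monic by rewrite monic_exp.
have q0 := companion_annihilates XE qm sq.
pose g := rVpoly (delta_mx 0 0 *m p : 'rV_n.+1).
have gX : delta_mx 0 0 *m p = delta_mx 0 0 *m horner_mx X g :> 'rV_n.+1.
  apply/rowP => j; rewrite (@mul_horner_mxE _ _ _ _ _ n.+1) ?size_poly //.
  rewrite (bigD1 j) //= big1 => [|i ij]; rewrite (companion_row_pow XE) // !mxE inord_val.
    by rewrite !eqxx mulr1 addr0 coef_rVpoly_ord mxE.
  by rewrite eqxx eq_sym (negbTE ij) mulr0.
have pXi i : p *m X ^+ i = X ^+ i *m p.
  elim: i => [|i IH]; first by rewrite expr0 mulmx1 mul1mx.
  by rewrite exprS -[X * _]/(X *m X ^+ i) mulmxA pX -mulmxA IH mulmxA.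
have pE : p = horner_mx X g.
  apply/row_matrixP => i; rewrite !rowE -[i]inord_val -(companion_row_pow XE) //.
  rewrite -!mulmxA -pXi mulmxA gX -!mulmxA; congr (_ *m _).
  by rewrite -[X in X ^+ i](horner_mx_X X) -rmorphXn;
    apply: (comm_horner_mx2 X g ('X^i)).
have small h : (size h <= n.+1)%N -> horner_mx X h = 0 -> h = 0.
  move=> sh h0; apply/polyP => i; rewrite coef0.
  have [lti|lei] := ltnP i n.+1; last by rewrite nth_default // (leq_trans sh).
  have := congr1 (fun A => (delta_mx 0 0 *m A : 'rV_n.+1) 0 (inord i)) h0.
  rewrite /= mulmx0 [RHS]mxE (mul_horner_mxE _ _ _ _ sh).
  rewrite (bigD1 (inord i)) //= big1 => [|k ki]; rewrite (companion_row_pow XE) // !mxE inord_val.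
    by rewrite !eqxx mulr1 addr0 inordK.
  by rewrite eqxx eq_sym (negbTE ki) mulr0.
have ann h : horner_mx X h = 0 -> q %| h.
  move=> h0; apply/modp_eq0P/small.
    by rewrite -ltnS -sq ltn_modp monic_neq0.
  by move: h0; rewrite {1}(divp_eq h q) rmorphD rmorphM /= q0 mulr0 add0r.
have co : coprimep g (g - 1).
  by apply/Bezout_eq1_coprimepP; exists (1, -1); rewrite /= mul1r mulN1r opprB addrC subrK.
have /irreducible_pow_dvd-/(_ irr co)/orP[] : q %| g * (g - 1).
  by apply: ann; rewrite mulrBr mulr1 rmorphB rmorphM /= -pE -[p * p]/(p *m p) pp subrr.
  move=> /dvdpP[u gu]; left.
  by rewrite pE gu rmorphM /= q0 mulr0.
move=> /dvdpP[u gu]; right; rewrite pE.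
by rewrite -[g](subrK 1) gu rmorphD rmorphM /= q0 mulr0 add0r rmorph1.
Qed.

(** Write the minimal polynomial as P^s r with r prime to P, and 1 = u P^s + v r. Then u P^s gives
    an idempotent at [X]; if it is 0, r is constant, and it cannot be 1, as P^s would then be
    constant. *)
Lemma no_idempotent_minpoly n (X : 'M[F]_n.+1) : no_idempotent X ->
  exists P s, [/\ (0 < s)%N, P \is monic, irreducible_poly P & mxminpoly X = P ^+ s].
Proof.
move=> hX; set q := mxminpoly X.
have qm : q \is monic := mxminpoly_monic X.
have [|P [Pm irr Pq]] := @monic_irreducible_dvd q.
  by rewrite size_mxminpoly ltnS mxminpoly_nonconstant.
have [s [r [qE nPr]]] := irreducible_multiplicity irr (monic_neq0 qm).
have s0 : (0 < s)%N.
  by case: s qE => // qE; move: nPr; rewrite qE mul1r in Pq *; rewrite Pq.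
exists P, s; split=> //.
have /Bezout_eq1_coprimepP[[u v] /= uv] : coprimep (P ^+ s) r.
  exact/coprimep_expl/irreducible_coprime.
have fq : horner_mx X q = 0 := mx_root_minpoly X.
pose e := horner_mx X (u * P ^+ s).
have e1 : 1 - e = horner_mx X (v * r).
  by rewrite /e -(rmorph1 (horner_mx X)) -rmorphB -uv addrC addKr.
have [||e0|e1'] := hX e.
- by apply: comm_horner_mx; apply: comm_mx_refl.
- apply/esym/eqP; rewrite -subr_eq0 -{1}[e]mulmx1 -mulmxBr -[_ *m _]/(e * (1 - e)) e1 -rmorphM.
  have -> : u * P ^+ s * (v * r) = u * v * q by rewrite qE mulrACA.
  by rewrite rmorphM /= fq mulr0.
- have : q %| u * P ^+ s by apply: mxminpoly_min.
  rewrite qE => /(dvdp_trans (dvdp_mull (P ^+ s) (dvdpp r))) d1.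
  have : r %| 1 by rewrite -uv dvdp_add // dvdp_mull.
  rewrite dvdp1 => /size_poly1P[c c0 rc].
  have Psm : P ^+ s \is monic by rewrite monic_exp.
  have := monicP qm; rewrite qE rc lead_coefM (monicP Psm) mul1r lead_coefC => ->.
  by rewrite mulr1.
have : q %| v * r by apply: mxminpoly_min; rewrite -e1 e1' subrr.
rewrite qE => /(dvdp_trans (dvdp_mulr r (dvdpp (P ^+ s)))) d1.
have : P ^+ s %| 1 by rewrite -uv dvdp_add // dvdp_mull.
move=> /(dvdp_trans (dvdp_exp2l P s0)); rewrite expr1 dvdp1 => /eqP sP.
by have := irr.1; rewrite sP.
Qed.

(* With [A] the rows [phi X^i] and [B] the columns [X^j y], i, j < deg q, the
   Hankel matrix [A B] is invertible as soon as [phi P(X)^(s-1) y <> 0], and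
   [B (A B)^-1 A] is then a nonzero idempotent commuting with [X]. *)
Lemma no_idempotent_companion n (X : 'M[F]_n.+1) P s : no_idempotent X ->
  (0 < s)%N -> P \is monic -> irreducible_poly P -> mxminpoly X = P ^+ s ->
  exists (A : 'M_((size (P ^+ s)).-1, n.+1)) (B : 'M_(n.+1, (size (P ^+ s)).-1)),
    [/\ A *m B = 1%:M, B *m A = 1%:M & companionmx (P ^+ s) *m A = A *m X].
Proof.
move=> hX s0 Pm irr minX; set q := P ^+ s; set d := (size q).-1.
have fq : horner_mx X q = 0 by rewrite /q -minX mx_root_minpoly.
have qm : q \is monic by rewrite monic_exp.
have sq : size q = d.+1 by rewrite /d prednK // size_poly_gt0 monic_neq0.
have [phi [y nz]] : exists (phi : 'rV[F]_n.+1) (y : 'cV[F]_n.+1),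
    (phi *m horner_mx X (P ^+ s.-1) *m y) 0 0 != 0.
  have : horner_mx X (P ^+ s.-1) != 0.
    apply/eqP => /mxminpoly_min; rewrite minX => dv.
    have := dvdp_leq (monic_neq0 (monic_exp s.-1 Pm)) dv; rewrite leqNgt.
    case: s s0 {q d minX fq qm sq dv} => // s _; rewrite /= exprS.
    rewrite size_proper_mul; last by rewrite (monicP Pm) mul1r lead_coef_eq0 monic_neq0 ?monic_exp.
    have := irr.1; have : (0 < size (P ^+ s))%N by rewrite size_poly_gt0 monic_neq0 ?monic_exp.
    by case: (size (P ^+ s)) => // k _; case: (size P) => [|[|l]] // _;
      rewrite !addSn addnS /= ltnS ltnS leq_addl.
  move=> /eqP/matrixP nz; have [i [j ij]] : exists i j, horner_mx X (P ^+ s.-1) i j != 0.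
    apply: contrapT => nn; apply: nz => i j; rewrite mxE; apply/eqP/negPn/negP => ij.
    by apply: nn; exists i, j.
  exists (delta_mx 0 i), (delta_mx j 0).
  by rewrite -rowE -colE !mxE.
have mulf g h : horner_mx X (g * h) = horner_mx X g *m horner_mx X h by rewrite rmorphM.
(* If g = P^a g' with a < s and g' prime to P, some multiple of g is P^(s-1) modulo q, on which the
   pairing with [phi] and [y] is nonzero. *)
have nondeg g : (forall h, (phi *m horner_mx X g *m horner_mx X h *m y) 0 0 = 0) -> q %| g.
  move=> gh; have [->|g0] := eqVneq g 0; first exact: dvdp0.
  have [a [g' [gE nPg]]] := irreducible_multiplicity irr g0.
  have [sa|las] := leqP s a; first by rewrite gE dvdp_mulr // dvdp_exp2l.
  have /Bezout_eq1_coprimepP[[u v] /= uv] := irreducible_coprime irr nPg.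
  case/eqP: nz; rewrite -(gh (v * P ^+ (s.-1 - a))) -[in RHS](mulmxA phi) -mulf.
  have -> : g * (v * P ^+ (s.-1 - a)) = P ^+ s.-1 - u * q.
    rewrite gE [v * _]mulrC mulrACA -exprD subnKC; last by rewrite -ltnS prednK.
    have -> : g' * v = 1 - u * P by rewrite -uv addrC addKr mulrC.
    rewrite mulrBr mulr1; congr (_ - _); rewrite mulrCA; congr (u * _).
    by rewrite -exprSr prednK.
  by rewrite rmorphB rmorphM /= fq mulr0 subr0.
pose A : 'M[F]_(d, n.+1) := \matrix_(i, j) (phi *m X ^+ i) 0 j.
pose B : 'M[F]_(n.+1, d) := \matrix_(i, j) (X ^+ j *m y) i 0.
have rowA i : row i A = phi *m X ^+ i by apply/rowP => j; rewrite !mxE.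
have colB j : col j B = X ^+ j *m y by apply/colP => i; rewrite !mxE.
have mulA (u : 'rV_d) : u *m A = phi *m horner_mx X (rVpoly u).
  apply/rowP => j; rewrite (@mul_horner_mxE _ _ _ _ _ d) ?size_poly // mxE.
  by apply: eq_bigr => k _; rewrite coef_rVpoly_ord [A k j]mxE.
have mulB (u : 'rV_d) : B *m u^T = horner_mx X (rVpoly u) *m y.
  apply/colP => i; rewrite (@horner_mx_mulE _ _ _ _ _ d) ?size_poly // mxE.
  by apply: eq_bigr => k _; rewrite coef_rVpoly_ord [B i k]mxE !mxE mulrC.
have modf h : horner_mx X h = horner_mx X (h %% q).
  by rewrite {1}(divp_eq h q) rmorphD rmorphM /= fq mulr0 add0r.
have polyd h : rVpoly (poly_rV (h %% q) : 'rV_d) = h %% q.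
  by apply: poly_rV_K; rewrite -ltnS -sq ltn_modp monic_neq0.
have smalld g : (size g <= d)%N -> q %| g -> g = 0.
  by move=> sg; have [//|g0] := eqVneq g 0; move=> /(dvdp_leq g0); rewrite sq ltnNge sg.
have Gu : A *m B \in unitmx.
  rewrite -row_free_unit; apply: inj_row_free => u; rewrite mulmxA mulA => u0.
  apply/(can_inj rVpolyK); rewrite linear0; apply: smalld; first exact: size_poly.
  apply: nondeg => h; rewrite (modf h) -polyd -mulmxA -mulB mulmxA u0 mul0mx mxE //.
pose C := companionmx q.
have powd : X ^+ d = - \sum_(j < d) q`_j *: X ^+ j.
  apply/eqP; rewrite -addr_eq0 addrC; apply/eqP.
  rewrite -[RHS]fq (@horner_mx_wide _ _ _ d.+1) ?sq // big_ord_recr /=.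
  have -> : q`_d = 1 by have := monicP qm; rewrite /lead_coef sq.
  by rewrite scale1r.
have CA : C *m A = A *m X.
  apply/row_matrixP => i; rewrite !row_mul rowA; apply/rowP => j.
  have [id|id] := eqVneq (i : nat) d.-1.
    have dE : d = i.+1 by rewrite id prednK // (leq_ltn_trans (leq0n i)).
    have -> : phi *m X ^+ i *m X = phi *m X ^+ d.
      by rewrite -mulmxA dE exprSr.
    rewrite powd mulmxN linear_sum /= !mxE summxE -sumrN; apply: eq_bigr => k _.
    by rewrite linearZ /= !mxE -[_.-1]/d id eqxx mulNr.
  have di : (i.+1 < d)%N.
    have := ltn_ord i; rewrite -[X in (_ < X)%N]/d => id'; lia.
  have -> : row i C = delta_mx 0 (Ordinal di).
    by rewrite rowE mulmx_delta_companion.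
  by rewrite -rowE rowA /= exprSr -[X ^+ i * X]/(X ^+ i *m X) mulmxA.
pose K := B *m invmx (A *m B); pose e := K *m A.
have AK : A *m K = 1%:M by rewrite mulmxA mulmxV.
have eB : e *m B = B by rewrite -!mulmxA mulVmx // mulmx1.
have Ae : A *m e = A by rewrite mulmxA AK mul1mx.
have colXB (j : 'I_d) : e *m (X *m B) *m delta_mx j 0 = X *m B *m delta_mx j 0 :> 'cV_n.+1.
  have xB : X *m B *m delta_mx j 0 = horner_mx X 'X^(j.+1) *m y.
    rewrite -mulmxA -colE colB mulmxA rmorphXn /= horner_mx_X.
    by rewrite -[X *m X ^+ j]/(X * X ^+ j) -exprS.
  by rewrite -mulmxA xB modf -polyd -mulB mulmxA eB.
have eXB : e *m (X *m B) = X *m B.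
  apply/matrixP => i j; have := congr1 (fun c : 'cV_n.+1 => c i 0) (colXB j).
  by rewrite /= -!colE mxE [RHS]mxE.
(* Both sides equal e X e: on the left because the rows of [A] span an X-stable space ([CA]), on the
   right because the columns of [B] do ([eXB]). *)
have eX : e *m X = X *m e.
  transitivity (e *m X *m e).
    by rewrite -[e *m X]mulmxA -CA -!mulmxA Ae.
  have Xe : X *m e = (X *m B) *m (invmx (A *m B) *m A) by rewrite /e /K !mulmxA.
  by rewrite -mulmxA Xe mulmxA eXB.
have ee : e *m e = e by rewrite {1}/e -mulmxA Ae.
have [e0|e1] := hX e eX ee.
  case/eqP: nz.
  by rewrite modf -polyd -mulA -Ae e0 !mulmx0 mul0mx mxE.
by exists A, K.
Qed.

End Cyclic.

(** * Modules given by matrices *)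

Section MatrixModules.
Variable R : realType.

Lemma colspaceP m n (A : 'M[R]_(m, n)) x :
  reflect (exists y, x = A *m y) (x \in colspace A).
Proof.
apply: (iffP memv_imgP) => [[y _ ->]|[y ->]]; first by exists y; rewrite lfunE.
by exists y; rewrite ?memvf ?lfunE.
Qed.

Lemma dim_colspace m n (A : 'M[R]_(m, n)) (B : 'M[R]_(n, m)) :
  B *m A = 1%:M -> \dim (colspace A) = n.
Proof.
move=> BA; rewrite limg_dim_eq; first by rewrite dimvf; apply: muln1.
apply/eqP; rewrite -subv0; apply/subvP => y; rewrite memv_cap memv_ker lfunE /=.
by move=> /andP[_ /eqP Ay]; rewrite -[y]mul1mx -BA -mulmxA Ay mulmx0 mem0v.
Qed.

Lemma colspace_sub m n k (A : 'M[R]_(m, n)) (B : 'M[R]_(m, k)) :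
  (forall y, A *m y \in colspace B) -> exists Q, A = B *m Q.
Proof.
move=> AB; have ex j : exists y : 'cV_k, A *m (delta_mx j 0 : 'cV_n) = B *m y by apply/colspaceP.
pose y j := sval (cid (ex j)).
have yE j : A *m (delta_mx j 0 : 'cV_n) = B *m y j by rewrite /y; case: (cid _).
exists (\matrix_(i, j) y j i 0); apply/matrixP => i j.
have := yE j; rewrite -colE => /colP/(_ i); rewrite !mxE => ->.
by apply: eq_bigr => l _; rewrite [in RHS]mxE.
Qed.

Lemma lfun_col_mx m n (f : 'Hom('cV[R]_n, 'cV[R]_m)) :
  exists U : 'M[R]_(m, n), forall x, f x = U *m x.
Proof.
exists (\matrix_(i, j) f (delta_mx j 0) i 0) => x; apply/colP => i.
have {1}-> : x = \sum_j x j 0 *: delta_mx j 0.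
  by rewrite {1}[x]matrix_sum_delta; apply: eq_bigr => j _; rewrite big_ord1.
rewrite linear_sum summxE !mxE; apply: eq_bigr => j _.
by rewrite linearZ !mxE mulrC.
Qed.

Lemma forall_I4 (P : 'I_4 -> Prop) :
  P (@Ordinal 4 0 isT) -> P (@Ordinal 4 1 isT) -> P (@Ordinal 4 2 isT) ->
  P (@Ordinal 4 3 isT) -> forall i, P i.
Proof.
move=> P0 P1 P2 P3 [[|[|[|[|//]]]] lti];
by rewrite (eq_irrelevance lti isT).
Qed.

Variables (N d0 d1 d2 d3 : nat).
Variables (A0 : 'M[R]_(N, d0)) (A1 : 'M[R]_(N, d1)).
Variables (A2 : 'M[R]_(N, d2)) (A3 : 'M[R]_(N, d3)).
Local Notation L := (m4_of_mx A0 A1 A2 A3).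

Lemma m4_of_mx_dim : m4_dim L = N.
Proof. by rewrite /m4_dim dimvf; apply: muln1. Qed.

Lemma m4_of_mx_subdim (B0 : 'M[R]_(d0, N)) (B1 : 'M[R]_(d1, N))
    (B2 : 'M[R]_(d2, N)) (B3 : 'M[R]_(d3, N)) :
  B0 *m A0 = 1%:M -> B1 *m A1 = 1%:M -> B2 *m A2 = 1%:M -> B3 *m A3 = 1%:M ->
  forall i, m4_subdim L i = tnth [tuple d0; d1; d2; d3] i.
Proof.
move=> e0 e1 e2 e3; apply: forall_I4; rewrite /m4_subdim /= !(tnth_nth 0%VS) (tnth_nth 0%N) /=.
- exact: dim_colspace e0.
- exact: dim_colspace e1.
- exact: dim_colspace e2.
- exact: dim_colspace e3.
Qed.

Lemma m4_of_mx_hom (M : module4 R) (f : 'Hom(L, M)) :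
  (forall y, f (A0 *m y) \in m4_sub M (@Ordinal 4 0 isT)) ->
  (forall y, f (A1 *m y) \in m4_sub M (@Ordinal 4 1 isT)) ->
  (forall y, f (A2 *m y) \in m4_sub M (@Ordinal 4 2 isT)) ->
  (forall y, f (A3 *m y) \in m4_sub M (@Ordinal 4 3 isT)) -> m4_hom f.
Proof.
move=> f0 f1 f2 f3; apply: forall_I4 => x /=; rewrite (tnth_nth 0%VS) /= => /colspaceP[y ->];
  by [apply: f0|apply: f1|apply: f2|apply: f3].
Qed.

(** An endomorphism is a matrix [U]; that it preserves a column space is expressed by the matrix [Q]
    of the induced map on the coefficients of the columns. *)
Lemma m4_of_mx_indec : (0 < N)%N ->
  (forall U : 'M[R]_N, U *m U = U ->
     (exists Q, U *m A0 = A0 *m Q) -> (exists Q, U *m A1 = A1 *m Q) ->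
     (exists Q, U *m A2 = A2 *m Q) -> (exists Q, U *m A3 = A3 *m Q) ->
     U = 0 \/ U = 1%:M) ->
  indec L.
Proof.
move=> N0 hU; split.
  exists (vpick {:L}); rewrite vpick0 -dimv_eq0 -lt0n.
  by rewrite -[\dim _]/(m4_dim L) m4_of_mx_dim.
move=> e eM ee; have [U eU] := lfun_col_mx e.
have UA i k (A : 'M[R]_(N, k)) : m4_sub L i = colspace A -> exists Q, U *m A = A *m Q.
  move=> iA; apply: colspace_sub => y; rewrite -mulmxA -eU -iA; apply: eM.
  by rewrite iA; apply/colspaceP; exists y.
have sub k (lt : (k < 4)%N) : m4_sub L (Ordinal lt) =
    nth 0%VS [:: colspace A0; colspace A1; colspace A2; colspace A3] k.
  by rewrite /= (tnth_nth 0%VS).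
have UU : U *m U = U.
  apply/matrixP => i j; have := ee (delta_mx j 0); rewrite !eU mulmxA => /colP/(_ i).
  by rewrite -!colE mxE [RHS]mxE.
have [||||U0|U1] := hU U UU.
- by apply: (UA (@Ordinal 4 0 isT)); rewrite sub.
- by apply: (UA (@Ordinal 4 1 isT)); rewrite sub.
- by apply: (UA (@Ordinal 4 2 isT)); rewrite sub.
- by apply: (UA (@Ordinal 4 3 isT)); rewrite sub.
- by left=> x; rewrite eU U0 mul0mx.
- by right=> x; rewrite eU U1 mul1mx.
Qed.

End MatrixModules.

Section ShiftLemmas.
Variable R : realType.

Lemma scalar_idem N (c : R) (U : 'M[R]_N) :
  U = c%:M -> U *m U = U -> U = 0 \/ U = 1%:M.
Proof.
case: N U => [|N] U Uc UU; first by left; rewrite [U]thinmx0.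
have : c * c = c.
  have /matrixP/(_ 0 0) : c%:M *m c%:M = c%:M :> 'M[R]_N.+1 by rewrite -Uc.
  by rewrite -scalar_mxM !mxE !eqxx.
move=> /eqP; rewrite -subr_eq0 -{3}[c]mulr1 -mulrBr mulf_eq0 subr_eq0 Uc.
by case/orP => /eqP->; [left; rewrite raddf0|right].
Qed.
End ShiftLemmas.

(** * Endomorphisms of shift pencils *)

Section Pencils.
Variable R : realType.

(* A pair of endomorphisms of the shift pencil: both commutation relations
   make [a] a Toeplitz matrix, whose off-diagonal bands meet the border where
   they vanish. *)
Lemma shift_pencil_scalar n (a : 'M[R]_n.+1) (d : 'M[R]_n) :
  a *m id_up R n = id_up R n *m d -> a *m id_down R n = id_down R n *m d ->
  exists c, a = c%:M /\ d = c%:M.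
Proof.
move=> /matrixP up /matrixP dn.
pose A i j := a (inord i) (inord j); pose D i j : R := if insub i is Some i' then
  if insub j is Some j' then d i' j' else 0 else 0.
have AE (i j : 'I_n.+1) : a i j = A i j by rewrite /A !inord_val.
have DE (i j : 'I_n) : d i j = D i j by rewrite /D !valK.
have upR i j : (i < n.+1)%N -> (j < n)%N -> A i j.+1 = if i is i'.+1 then D i' j else 0.
  move=> li lj; have := up (Ordinal li) (Ordinal lj); rewrite !mxE.
  rewrite (bigD1 (inord j.+1)) //= big1 => [|k kj]; last first.
    rewrite mxE; case: eqP => [E|]; last by rewrite mulr0.
    by case/eqP: kj; apply: ord_inj; rewrite inordK.
  rewrite mxE inordK // eqxx mulr1 addr0 AE /= inordK // => ->.
  case: i li => [|i] li; first by rewrite big1 // => k _; rewrite mxE /= mul0r.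
  rewrite (bigD1 (Ordinal (li : (i < n)%N))) //= big1 => [|k ki]; last first.
    rewrite mxE /= eqSS; case: eqP => [E|]; last by rewrite mul0r.
    by case/eqP: ki; apply: ord_inj.
  by rewrite mxE /= eqxx mul1r addr0 DE.
have dnR i j : (i < n.+1)%N -> (j < n)%N -> A i j = if (i < n)%N then D i j else 0.
  move=> li lj; have := dn (Ordinal li) (Ordinal lj); rewrite !mxE.
  have lj' : (j < n.+1)%N by apply: leqW.
  rewrite (bigD1 (Ordinal lj')) //= big1 => [|k kj]; last first.
    rewrite mxE; case: eqP => [E|]; last by rewrite mulr0.
    by case/eqP: kj; apply: ord_inj.
  rewrite mxE /= eqxx mulr1 addr0 AE /= => ->.
  case: ltnP => ni; last first.
    rewrite big1 // => k _; rewrite mxE /=; case: eqP => [E|]; last by rewrite mul0r.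
    by move: (ltn_ord k); rewrite -E ltnNge ni.
  rewrite (bigD1 (Ordinal ni)) //= big1 => [|k ki]; last first.
    rewrite mxE /=; case: eqP => [E|]; last by rewrite mul0r.
    by case/eqP: ki; apply: ord_inj.
  by rewrite mxE /= eqxx mul1r addr0 DE.
have toep i j : (i < n)%N -> (j < n)%N -> A i.+1 j.+1 = A i j.
  by move=> li lj; rewrite upR // dnR ?leqW // li.
have upper i j : (i < j)%N -> (j < n.+1)%N -> A i j = 0.
  elim: i j => [|i IH] [|j] //; first by move=> _ lj; rewrite upR.
  by rewrite ltnS => ij lj; rewrite toep ?IH //; lia.
have lower k i j : (i + k = n)%N -> (j < i)%N -> A i j = 0.
  elim: k i j => [|k IH] i j; first by rewrite addn0 => -> lj; rewrite dnR // ltnn.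
  by move=> ik ji; rewrite -toep ?IH //; lia.
have diag i : (i < n.+1)%N -> A i i = A 0%N 0%N.
  by elim: i => // i IH li; rewrite toep ?IH //; lia.
exists (A 0%N 0%N); split; apply/matrixP => i j.
  rewrite AE mxE -val_eqE /=; case: ltngtP => [ij|ij|<-].
  - exact: upper.
  - by apply: (@lower (n - i)%N) => //; have := ltn_ord i; lia.
  - exact: diag.
have li := ltn_ord i; have lj := ltn_ord j.
have -> : d i j = A i j by rewrite DE dnR ?leqW // li.
rewrite mxE -val_eqE /=; case: ltngtP => [ij|ij|<-].
- by apply: upper => //; lia.
- by apply: (@lower (n - i)%N) => //; lia.
- by apply: diag; lia.
Qed.

(** The first two hypotheses exchange [p] and [q] along each diagonal. Their bands above the
    diagonal start in the first row, fixed by the last two hypotheses, and those below end in the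
    last row, where the shift gives zero. Column 0 then yields a = b = 0 from the bottom upwards,
    and the diagonal is c. *)
Lemma twisted_pencil_core n (c sg : R) (p q : nat -> nat -> R) (a b : nat -> R) :
  (forall i j, (i < n)%N -> (j < n)%N ->
     (if (i.+1 < n)%N then q i.+1 j + sg * b i.+1 *+ (j == 0%N) else 0) =
     (if j is j'.+1 then p i j' else a i)) ->
  (forall i j, (i < n)%N -> (j < n)%N ->
     (if (i.+1 < n)%N then p i.+1 j + sg * a i.+1 *+ (j == 0%N) else 0) =
     (if j is j'.+1 then q i j' else b i)) ->
  (forall j, (j < n)%N -> q 0%N j + sg * b 0%N *+ (j == 0%N) = c *+ (j == 0%N)) ->
  (forall j, (j < n)%N -> p 0%N j + sg * a 0%N *+ (j == 0%N) = c *+ (j == 0%N)) ->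
  (forall i, (i < n)%N -> a i = 0 /\ b i = 0) /\
  (forall i j, (i < n)%N -> (j < n)%N -> p i j = c *+ (i == j) /\ q i j = c *+ (i == j)).
Proof.
move=> E1 E2 E3 E4.
have upper i j : (i < j)%N -> (j < n)%N -> p i j = 0 /\ q i j = 0.
  elim: i j => [|i IH] [|j] // ij lj.
    by have := E3 j.+1 lj; have := E4 j.+1 lj; rewrite !mulrb /= !addr0.
  have [pij qij] := IH j ij (ltnW lj).
  have li : (i.+1 < n)%N by lia.
  have := E1 i j.+1 (ltnW li) lj; have := E2 i j.+1 (ltnW li) lj.
  by rewrite li !mulrb /= !addr0 pij qij.
have lower k i j : (i + k = n.-1)%N -> (j < i)%N -> (i < n)%N -> p i j = 0 /\ q i j = 0.
  elim: k i j => [|k IH] i j ik ji li.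
    have lj : (j.+1 < n)%N by lia.
    have := E1 i j.+1 li lj; have := E2 i j.+1 li lj.
    by have -> : (i.+1 < n)%N = false by lia.
  have lj : (j.+1 < n)%N by lia.
  have li' : (i.+1 < n)%N by lia.
  have := E1 i j.+1 li lj; have := E2 i j.+1 li lj.
  rewrite li' !mulrb /= !addr0 => <- <-.
  by have [] := IH i.+1 j.+1; [lia|lia|lia|].
have ab k i : (i + k = n.-1)%N -> (i < n)%N -> a i = 0 /\ b i = 0.
  elim: k i => [|k IH] i ik li.
    have n0 : (0 < n)%N by lia.
    have := E1 i 0%N li n0; have := E2 i 0%N li n0.
    by have -> : (i.+1 < n)%N = false by lia.
  have li' : (i.+1 < n)%N by lia.
  have n0 : (0 < n)%N by lia.
  have := E1 i 0%N li n0; have := E2 i 0%N li n0.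
  have [ai bi] : a i.+1 = 0 /\ b i.+1 = 0 by apply: IH => //; lia.
  have [pi qi] : p i.+1 0%N = 0 /\ q i.+1 0%N = 0 by apply: (@lower k) => //; lia.
  by rewrite li' ai bi pi qi /= !mulr0 !addr0 => <- <-.
have ab0 i : (i < n)%N -> a i = 0 /\ b i = 0.
  by move=> li; apply: (ab (n.-1 - i)%N) => //; lia.
have diag i : (i < n)%N -> p i i = c /\ q i i = c.
  elim: i => [|i IH] li.
    have [a0 b0] := ab0 0%N li.
    by have := E3 0%N li; have := E4 0%N li; rewrite a0 b0 !mulr0 !mulrb /= !addr0.
  have [pi qi] := IH (ltnW li).
  have := E1 i i.+1 (ltnW li) li; have := E2 i i.+1 (ltnW li) li.
  by rewrite li !mulrb /= !addr0 pi qi.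
split=> // i j li lj; case: ltngtP => [ij|ij|<-]; rewrite ?mulr0n ?mulr1n.
- exact: upper.
- by apply: (@lower (n.-1 - i)%N) => //; lia.
- exact: diag.
Qed.

(** The equations of an endomorphism of V, with sg = 1, and, after transposition, of one of V*, with
    sg = -1. *)
Lemma twisted_pencil_scalar n (sg : R) (p q : 'M[R]_n) (a b : 'cV[R]_n) (c : 'M[R]_1) :
  jordan_block n 0 *m (q + sg *: (b *m row10 R n)) = p *m jordan_block n 0 + a *m row10 R n ->
  jordan_block n 0 *m (p + sg *: (a *m row10 R n)) = q *m jordan_block n 0 + b *m row10 R n ->
  row10 R n *m (q + sg *: (b *m row10 R n)) = c *m row10 R n ->
  row10 R n *m (p + sg *: (a *m row10 R n)) = c *m row10 R n ->
  [/\ p = (c 0 0)%:M, q = (c 0 0)%:M, a = 0 & b = 0].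
Proof.
case: n p q a b => [|n] p q a b.
  by move=> _ _ _ _; rewrite [p]thinmx0 [q]thinmx0 [a]flatmx0 [b]flatmx0;
    split=> //; rewrite ?[RHS]thinmx0.
pose J : 'M[R]_n.+1 := jordan_block n.+1 0; pose r := row10 R n.+1.
rewrite -/J -/r.
have rE (u : 'cV[R]_n.+1) i j : (u *m r) i j = u i 0 *+ (j == 0%N :> nat).
  by rewrite mxE big_ord1 mxE mulr_natr.
have addE (M : 'M[R]_n.+1) (u : 'cV[R]_n.+1) i j :
    (M + sg *: (u *m r)) i j = M i j + sg * u i 0 *+ (j == 0%N :> nat).
  by rewrite mxE [X in _ + X]mxE rE mulrnAr.
have addE' (M : 'M[R]_n.+1) (u : 'cV[R]_n.+1) i j :
    (M *m J + u *m r) i j = (M *m J) i j + u i 0 *+ (j == 0%N :> nat).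
  by rewrite mxE rE.
have i0 : inord 0 = 0 :> 'I_n.+1 by apply: ord_inj; rewrite inordK.
have JM m (M : 'M[R]_(n.+1, m)) i j : (J *m M) i j =
    if (i.+1 < n.+1)%N then M (inord i.+1) j else 0.
  rewrite mxE; case: ifP => li; last first.
    rewrite big1 // => k _; rewrite mxE mul0rn add0r; case: eqP => [E|]; last by rewrite mul0r.
    by move: (ltn_ord k); rewrite -E li.
  rewrite (bigD1 (inord i.+1)) //= big1 => [|k ki]; rewrite mxE mul0rn add0r.
    by rewrite inordK // eqxx mul1r addr0.
  case: eqP => [E|]; last by rewrite mul0r.
  by case/eqP: ki; apply: ord_inj; rewrite inordK.
have MJ (M : 'M[R]_n.+1) i j : (M *m J) i j =
    if (j : nat) is j'.+1 then M i (inord j') else 0.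
  rewrite mxE; have lj := ltn_ord j; case jE : (j : nat) => [|j'] in lj *.
    by rewrite big1 // => k _; rewrite mxE mul0rn add0r jE mulr0.
  rewrite (bigD1 (inord j')) //= big1 => [|k ki]; rewrite mxE mul0rn add0r jE eqSS.
    by rewrite inordK ?(ltnW lj) // eqxx mulr1 addr0.
  case: eqP => [E|]; last by rewrite mulr0.
  by case/eqP: ki; apply: ord_inj; rewrite inordK ?(ltnW lj).
have rM (M : 'M[R]_n.+1) i j : (r *m M) i j = M 0 j.
  rewrite mxE (bigD1 0) //= big1 => [|k k0]; first by rewrite mxE mul1r addr0.
  by rewrite mxE -[_ == _ :> nat]/(k == 0) (negbTE k0) mul0r.
move=> /matrixP E1 /matrixP E2 /matrixP E3 /matrixP E4.
have [|||| ab pq] := @twisted_pencil_core n.+1 (c 0 0) sg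
  (fun i j => p (inord i) (inord j)) (fun i j => q (inord i) (inord j))
  (fun i => a (inord i) 0) (fun i => b (inord i) 0).
- move=> i j li lj; have := E1 (inord i) (inord j).
  rewrite JM addE addE' MJ !inordK // => ->.
  by case: j lj => [|j] lj; rewrite ?mulr1n ?mulr0n ?add0r ?addr0.
- move=> i j li lj; have := E2 (inord i) (inord j).
  rewrite JM addE addE' MJ !inordK // => ->.
  by case: j lj => [|j] lj; rewrite ?mulr1n ?mulr0n ?add0r ?addr0.
- move=> j lj; have := E3 0 (inord j).
  by rewrite rM addE i0 mxE big_ord1 mxE inordK // mulr_natr.
- move=> j lj; have := E4 0 (inord j).
  by rewrite rM addE i0 mxE big_ord1 mxE inordK // mulr_natr.
split.
- by apply/matrixP => i j; have [pij _] := pq i j (ltn_ord i) (ltn_ord j);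
    rewrite !inord_val in pij; rewrite pij mxE.
- by apply/matrixP => i j; have [_ qij] := pq i j (ltn_ord i) (ltn_ord j);
    rewrite !inord_val in qij; rewrite qij mxE.
- by apply/colP => i; have [ai _] := ab i (ltn_ord i); rewrite inord_val in ai; rewrite ai mxE.
- by apply/colP => i; have [_ bi] := ab i (ltn_ord i); rewrite inord_val in bi; rewrite bi mxE.
Qed.
End Pencils.

Section Shifts.
Variable R : realType.

Lemma id_left_mul n m (M : 'M[R]_(n.+1, m)) i j :
  (id_left R n *m M) i j = M (lift ord0 i) j.
Proof.
rewrite mxE (bigD1 (lift ord0 i)) //= big1 => [|k ki]; rewrite mxE.
  by rewrite eqxx mul1r addr0.
case: eqP => [E|]; last by rewrite mul0r.
by case/eqP: ki; apply: ord_inj.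
Qed.

Lemma id_right_mul n m (M : 'M[R]_(n.+1, m)) i j :
  (id_right R n *m M) i j = M (lift ord_max i) j.
Proof.
rewrite mxE (bigD1 (lift ord_max i)) //= big1 => [|k ki]; rewrite mxE.
  by rewrite lift_max eqxx mul1r addr0.
case: eqP => [E|]; last by rewrite mul0r.
by case/eqP: ki; apply: ord_inj; rewrite lift_max.
Qed.

Lemma tr_id_left n : (id_left R n)^T = id_up R n.
Proof. by apply/matrixP => i j; rewrite !mxE eq_sym. Qed.

Lemma tr_id_right n : (id_right R n)^T = id_down R n.
Proof. by apply/matrixP => i j; rewrite !mxE eq_sym. Qed.

Lemma row10_mul n m (M : 'M[R]_(n.+1, m)) i j : (row10 R n.+1 *m M) i j = M ord0 j.
Proof.
rewrite mxE (bigD1 ord0) //= big1 => [|k k0]; first by rewrite mxE mul1r addr0.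
by rewrite mxE -[_ == _ :> nat]/(k == ord0) (negbTE k0) mul0r.
Qed.

Lemma left_up n : id_left R n *m id_up R n = 1%:M.
Proof. by apply/matrixP => i j; rewrite id_left_mul !mxE /= /bump !add1n eqSS. Qed.

Lemma right_down n : id_right R n *m id_down R n = 1%:M.
Proof. by apply/matrixP => i j; rewrite id_right_mul !mxE lift_max. Qed.

Lemma right_up n : id_right R n *m id_up R n = (jordan_block n 0)^T.
Proof.
by apply/matrixP => i j; rewrite id_right_mul !mxE lift_max mul0rn add0r eq_sym.
Qed.

Lemma up_left n : id_up R n *m id_left R n + (row10 R n.+1)^T *m row10 R n.+1 = 1%:M.
Proof.
apply/matrixP => i j; rewrite mxE [X in _ + X]mxE big_ord1 !mxE.
have [k ->|->] := unliftP ord0 i.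
  rewrite mul0r addr0 (bigD1 k) //= big1 => [|l lk].
    by rewrite !mxE /= /bump !add1n !eqxx mul1r addr0 -val_eqE.
  rewrite !mxE /= /bump !add1n eqSS eq_sym -[_ == _ :> nat]/(l == k) (negbTE lk).
  by rewrite mul0r.
rewrite big1 => [|l _]; last by rewrite !mxE mul0r.
by rewrite add0r mul1r eq_sym -val_eqE.
Qed.

Lemma row10_up n : row10 R n.+1 *m id_up R n = 0.
Proof. by apply/matrixP => i j; rewrite row10_mul !mxE. Qed.

Lemma left_row10T n : id_left R n *m (row10 R n.+1)^T = 0.
Proof. by apply/matrixP => i j; rewrite id_left_mul !mxE. Qed.

Lemma row10_row10T n : row10 R n.+1 *m (row10 R n.+1)^T = 1%:M.
Proof. by apply/matrixP => i j; rewrite row10_mul !mxE !ord1. Qed.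

Lemma right_row10T n : id_right R n *m (row10 R n.+1)^T = (row10 R n)^T.
Proof. by apply/matrixP => i j; rewrite id_right_mul !mxE lift_max. Qed.

Lemma block_ex m1 m2 n1 n2 (U : 'M[R]_(m1 + m2, n1 + n2)) :
  exists a b c d, U = block_mx a b c d.
Proof. by exists (ulsubmx U), (ursubmx U), (dlsubmx U), (drsubmx U); rewrite submxK. Qed.

Definition blockE := (mul_block_col, mul_row_col, mul_col_mx, mulmx1, mul1mx, mulmx0,
  mul0mx, addr0, add0r).
End Shifts.

(** * Dimensions and indecomposability of the listed modules *)

Section Listed.
Variable R : realType.

Lemma m4_0_subdim n (X : 'M[R]_n) i : m4_subdim (m4_0 X) i = tnth [tuple n; n; n; n] i.
Proof.
apply: (@m4_of_mx_subdim _ _ _ _ _ _ _ _ _ _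
  (row_mx 1%:M 0) (row_mx 0 1%:M) (row_mx 0 1%:M) (row_mx 0 1%:M));
by rewrite !blockE.
Qed.

(** The first three subspaces force an endomorphism to be diag(a, a), and the fourth makes a commute
    with [X]. *)
Lemma m4_0_indec n (X : 'M[R]_n) : (0 < n)%N -> no_idempotent X -> indec (m4_0 X).
Proof.
move=> n0 hX; apply: m4_of_mx_indec => [|U]; first by rewrite addn_gt0 n0.
have [a [b [c [d ->]]]] := block_ex U => UU [Q0 E0] [Q1 E1] [Q2 E2] [Q3 E3].
move: E0 E1 E2 E3; rewrite !blockE => /eq_col_mx[_ c0] /eq_col_mx[b0 _].
rewrite b0 c0 !blockE => /eq_col_mx[aQ dQ] /eq_col_mx[aX dQ3].
have da : d = a by rewrite aQ dQ.
have [||a0|a1] := hX a.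
- by rewrite aX -dQ3 da.
- by move: UU; rewrite b0 c0 mulmx_block => /eq_block_mx[]; rewrite !blockE.
- by left; rewrite da a0 block_mx0.
- by right; rewrite da a1 -scalar_mx_block.
Qed.

Lemma m4_0_hom n d (X : 'M[R]_n) (C : 'M[R]_d) (A : 'M[R]_(d, n)) :
  C *m A = A *m X ->
  exists f : 'Hom(m4_0 X, m4_0 C), m4_hom f /\ f =1 mulmx (block_mx A 0 0 A).
Proof.
move=> CA; have [f fE] : exists f : 'Hom(m4_0 X, m4_0 C), f =1 mulmx (block_mx A 0 0 A).
  by apply: lfun_of_linear; apply: linearP.
exists f; split=> //; apply: m4_of_mx_hom => y; rewrite fE /= (tnth_nth 0%VS) /=;
  apply/colspaceP; exists (A *m y); rewrite mulmxA [RHS]mulmxA; congr (_ *m y);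
  by rewrite !blockE ?CA.
Qed.

Lemma m4_0_no_idempotent n (X : 'M[R]_n) : indec (m4_0 X) -> no_idempotent X.
Proof.
move=> [_ iL] p pX pp; have [e [eM eE]] := m4_0_hom (esym pX).
have ee x : e (e x) = e x by rewrite !eE mulmxA mulmx_block !blockE pp.
have colU (y : 'cV[R]_n) : e (col_mx y 0) = col_mx (p *m y) 0 by rewrite eE !blockE.
have pcol (q : 'M[R]_n) : (forall y : 'cV[R]_n, p *m y = q *m y) -> p = q.
  move=> pq; apply/matrixP => i j; have /colP/(_ i) := pq (delta_mx j 0).
  by rewrite -!colE mxE [RHS]mxE.
have [e0|e1] := iL e eM ee; [left|right]; apply: pcol => y.
  have := e0 (col_mx y 0); rewrite colU -[0 in RHS]col_mx0 => /eq_col_mx[-> _].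
  by rewrite mul0mx.
by have := e1 (col_mx y 0); rewrite colU => /eq_col_mx[-> _]; rewrite mul1mx.
Qed.

Lemma m4_II_subdim n i : m4_subdim (m4_II R n) i = tnth [tuple n.+1; n.+1; n; n] i.
Proof.
apply: (@m4_of_mx_subdim _ _ _ _ _ _ _ _ _ _
  (row_mx 1%:M 0) (row_mx 1%:M 0) (row_mx 0 1%:M) (row_mx 0 1%:M));
by rewrite !blockE.
Qed.

Lemma m4_III_subdim n i : m4_subdim (m4_III R n) i = tnth [tuple n.+1; n; n; n] i.
Proof.
apply: (@m4_of_mx_subdim _ _ _ _ _ _ _ _ _ _
  (row_mx 1%:M 0) (row_mx 0 1%:M) (row_mx 0 1%:M) (row_mx 0 1%:M));
by rewrite !blockE.
Qed.

Lemma m4_IIIs_subdim n i : m4_subdim (m4_IIIs R n) i = tnth [tuple n; n.+1; n.+1; n.+1] i.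
Proof.
apply: (@m4_of_mx_subdim _ _ _ _ _ _ _ _ _ _
  (row_mx 1%:M 0) (row_mx 0 1%:M) (row_mx 0 1%:M) (row_mx 0 1%:M));
by rewrite !blockE.
Qed.

Lemma m4_IV_subdim n i : m4_subdim (m4_IV R n) i = tnth [tuple n.+1; n.+1; n.+1; n] i.
Proof.
apply: (@m4_of_mx_subdim _ _ _ _ _ _ _ _ _ _
  (row_mx 1%:M 0) (row_mx 0 1%:M) (row_mx 0 1%:M) (row_mx (id_left R n) 0));
by rewrite !blockE // left_up.
Qed.

Lemma m4_IVs_subdim n i : m4_subdim (m4_IVs R n) i = tnth [tuple n.+1; n.+1; n.+1; n.+2] i.
Proof.
apply: (@m4_of_mx_subdim _ _ _ _ _ _ _ _ _ _
  (row_mx 1%:M 0) (row_mx 0 1%:M) (row_mx 0 1%:M)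
  (row_mx (id_up R n.+1) ((row10 R n.+2)^T *m row10 R n.+1))); rewrite !blockE //.
rewrite -mulmxA -[RHS](up_left R n.+1); congr (_ + _ *m _).
by apply/matrixP => i' j; rewrite row10_mul !mxE eq_sym.
Qed.

Lemma m4_V_subdim n i : m4_subdim (m4_V R n) i = tnth [tuple n; n; n; n] i.
Proof.
apply: (@m4_of_mx_subdim _ _ _ _ _ _ _ _ _ _
  (row_mx 1%:M 0) (row_mx 0 (row_mx 1%:M 0)) (row_mx 0 (row_mx 1%:M 0)) (row_mx 1%:M 0));
by rewrite !blockE.
Qed.

Lemma m4_Vs_subdim n i : m4_subdim (m4_Vs R n) i = tnth [tuple n.+1; n.+1; n.+1; n.+1] i.
Proof.
apply: (@m4_of_mx_subdim _ _ _ _ _ _ _ _ _ _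
  (row_mx (id_up R n) (row_mx 0 (row10 R n.+1)^T)) (row_mx (id_up R n) (row_mx 0 (row10 R n.+1)^T))
  (row_mx 0 (row_mx (id_up R n) (row10 R n.+1)^T)) (row_mx 0 (row_mx (id_up R n) (row10 R n.+1)^T)));
by rewrite !blockE ?up_left.
Qed.

(** This treats type I as type 0 with P = t: the companion matrix of a power of an irreducible
    polynomial. *)
Lemma jordan_companion n : companion_shape (jordan_block n (0 : R)) 'X^n.
Proof.
apply/matrixP => i j; rewrite !mxE mul0rn add0r coefXn.
have lj := ltn_ord j; rewrite (ltn_eqF lj) oppr0.
have [E|//] := eqVneq (i : nat) n.-1; have li := ltn_ord i.
by have -> : (i.+1 == j :> nat) = false by apply/eqP; lia.
Qed.

Lemma jordan_no_idempotent n : no_idempotent (jordan_block n (0 : R)).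
Proof.
apply: (companion_no_idempotent (@jordan_companion n) (monicX R)).
  by rewrite -['X]subr0; apply: irredp_XsubC.
by rewrite size_polyXn.
Qed.

Lemma up_right n : id_up R n *m id_right R n = (jordan_block n.+1 0)^T.
Proof.
apply/matrixP => i j; rewrite !mxE mul0rn add0r.
have [E|E] := eqVneq (j.+1 : nat) i.
  have lj : (j < n)%N by rewrite -ltnS E.
  rewrite (bigD1 (Ordinal lj)) //= big1 => [|k kj]; rewrite !mxE /=.
    by rewrite E !eqxx mulr1 addr0.
  case: eqP => [E'|]; last by rewrite mul0r.
  by case/eqP: kj; apply: ord_inj; apply: succn_inj; rewrite -E' -E.
rewrite big1 // => k _; rewrite !mxE; case: eqP => [E'|]; last by rewrite mul0r.
case: eqP => [E''|]; last by rewrite mulr0.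
by case/eqP: E; rewrite -E'' E'.
Qed.

(** An endomorphism is diag(a, d), where d is intertwined with a by both shifts. Hence a commutes
    with the product of the shifts, a transposed Jordan block, and a determines d. *)
Lemma m4_II_indec n : indec (m4_II R n).
Proof.
apply: m4_of_mx_indec => [//|U].
have [a [b [c [d ->]]]] := block_ex U => UU [Q0 E0] [Q1 E1] [Q2 E2] [Q3 E3].
move: E0 E1 E2 E3; rewrite !blockE => /eq_col_mx[_ c0] E1 E2 /eq_col_mx[b0 _].
move: E1 E2; rewrite b0 c0 !blockE => /eq_col_mx[aQ dR] /eq_col_mx[aup dQ].
move: UU; rewrite b0 c0 mulmx_block !blockE => /eq_block_mx[aa _ _ dd].
have aJ : a *m (id_up R n *m id_right R n) = id_up R n *m id_right R n *m a.
  by rewrite mulmxA aup -dQ -mulmxA dR -aQ mulmxA.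
have [||aT0|aT1] := @jordan_no_idempotent n.+1 a^T.
- by apply: trmx_inj; rewrite !trmx_mul trmxK -up_right.
- by rewrite -trmx_mul aa.
- left; have a0 : a = 0 by rewrite -[a]trmxK aT0 trmx0.
  have -> : d = 0 by rewrite -[d]mulmx1 -(right_down R n) mulmxA dR -aQ a0 mulmx0 mul0mx.
  by rewrite a0 block_mx0.
right; have a1 : a = 1%:M by rewrite -[a]trmxK aT1 trmx1.
have -> : d = 1%:M by rewrite -[d]mulmx1 -(right_down R n) mulmxA dR -aQ a1 mulmx1.
by rewrite a1 -scalar_mx_block.
Qed.

Lemma m4_III_indec n : indec (m4_III R n).
Proof.
apply: m4_of_mx_indec => [|U]; first by rewrite addSn.
have [a [b [c [d ->]]]] := block_ex U => UU [Q0 E0] [Q1 E1] [Q2 E2] [Q3 E3].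
move: E0 E1 E2 E3; rewrite !blockE => /eq_col_mx[_ c0] /eq_col_mx[b0 _] E2 E3.
move: E2 E3; rewrite b0 c0 !blockE => /eq_col_mx[aup dQ2] /eq_col_mx[adn dQ3].
move: UU; rewrite b0 c0.
have [l [-> ->]] : exists l, a = l%:M /\ d = l%:M.
  by apply: shift_pencil_scalar; rewrite ?aup ?adn -?dQ2 -?dQ3.
by rewrite -scalar_mx_block; apply: scalar_idem.
Qed.

(** Transposition exchanges added columns with added rows and reduces to the pencil of III. *)
Lemma m4_IIIs_indec n : indec (m4_IIIs R n).
Proof.
apply: m4_of_mx_indec => [|U]; first by rewrite addnS.
have [a [b [c [d ->]]]] := block_ex U => UU [Q0 E0] [Q1 E1] [Q2 E2] [Q3 E3].
move: E0 E1 E2 E3; rewrite !blockE => /eq_col_mx[_ c0] /eq_col_mx[b0 _] E2 E3.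
move: E2 E3; rewrite b0 c0 !blockE => /eq_col_mx[aup dQ2] /eq_col_mx[adn dQ3].
move: UU; rewrite b0 c0.
have [l [dT aT]] : exists l, d^T = l%:M /\ a^T = l%:M.
  apply: shift_pencil_scalar; apply: trmx_inj; rewrite !trmx_mul ?trmxK.
    by rewrite -tr_id_left trmxK aup -dQ2.
  by rewrite -tr_id_right trmxK adn -dQ3.
rewrite -[a]trmxK -[d]trmxK dT aT !tr_scalar_mx -scalar_mx_block.
exact: scalar_idem.
Qed.

Lemma m4_IV_indec n : indec (m4_IV R n).
Proof.
apply: m4_of_mx_indec => [|U]; first by rewrite addSn.
have [a [b [c [d ->]]]] := block_ex U => UU [Q0 E0] [Q1 E1] [Q2 E2] [Q3 E3].
move: E0 E1 E2 E3; rewrite !blockE => /eq_col_mx[_ c0] /eq_col_mx[b0 _] E2 E3.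
move: E2 E3; rewrite b0 c0 !blockE => /eq_col_mx[aQ dQ2] /eq_col_mx[aup adn].
move: UU; rewrite b0 c0.
have da : d = a by rewrite aQ dQ2.
have [l [al _]] : exists l, a = l%:M /\ Q3 = l%:M.
  by apply: shift_pencil_scalar; rewrite // -adn da.
by rewrite da al -scalar_mx_block; apply: scalar_idem.
Qed.

Lemma m4_IVs_indec n : indec (m4_IVs R n).
Proof.
apply: m4_of_mx_indec => [|U]; first by rewrite addSn.
have [a [b [c [d ->]]]] := block_ex U => UU [Q0 E0] [Q1 E1] [Q2 E2] [Q3 E3].
move: E0 E1 E2 E3; rewrite !blockE => /eq_col_mx[_ c0] /eq_col_mx[b0 _] E2 E3.
move: E2 E3; rewrite b0 c0 !blockE => /eq_col_mx[aQ dQ2] /eq_col_mx[aup adn].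
move: UU; rewrite b0 c0.
have da : d = a by rewrite aQ dQ2.
have [l [_ aT]] : exists l, Q3^T = l%:M /\ a^T = l%:M.
  apply: shift_pencil_scalar; apply: trmx_inj; rewrite !trmx_mul ?trmxK.
    by rewrite -tr_id_left trmxK aup.
  by rewrite -tr_id_right trmxK -adn da.
rewrite da -[a]trmxK aT !tr_scalar_mx -scalar_mx_block.
exact: scalar_idem.
Qed.

Lemma m4_V_indec n : indec (m4_V R n).
Proof.
apply: m4_of_mx_indec => [|U]; first by rewrite addn1 addnS.
have [p [b [c [d ->]]]] := block_ex U.
have [b1 [b2 ->]] : exists b1 b2, b = row_mx b1 b2.
  by exists (lsubmx b), (rsubmx b); rewrite hsubmxK.
have [c1 [c2 ->]] : exists c1 c2, c = col_mx c1 c2.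
  by exists (usubmx c), (dsubmx c); rewrite vsubmxK.
have [q [b' [d21 [l ->]]]] := block_ex d.
move=> UU [Q0 E0] [Q1 E1] [Q2 E2] [Q3 E3].
move: E0; rewrite !blockE add_col_mx !addr0 => /eq_col_mx[_ /eq_col_mx[c10 c20]].
move: E1; rewrite !blockE => /eq_col_mx[b10 /eq_col_mx[_ d0]].
move: E2; rewrite c10 c20 b10 d0 !blockE !add_col_mx !add0r => /eq_col_mx[E1 /eq_col_mx[E2 E3']].
move: E3; rewrite c10 c20 b10 d0 !blockE !add_col_mx !add0r => /eq_col_mx[E4 /eq_col_mx[E5 E6]].
move: UU; rewrite c10 c20 b10 d0.
have [||||-> -> -> ->] := @twisted_pencil_scalar R n 1 p q b2 b' l;
  rewrite ?scale1r ?E2 ?E4 -?E1 -?E5 -?E3' -?E6 //.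
have -> : l = (l 0 0)%:M by rewrite [LHS]mx11_scalar.
rewrite mxE eqxx mulr1n row_mx0 col_mx0 -!scalar_mx_block.
exact: scalar_idem.
Qed.

Lemma m4_Vs_indec n : indec (m4_Vs R n).
Proof.
apply: m4_of_mx_indec => [|U]; first by rewrite addn1 addnS.
have [p [b [c [d ->]]]] := block_ex U.
have [b1 [b2 ->]] : exists b1 b2, b = row_mx b1 b2.
  by exists (lsubmx b), (rsubmx b); rewrite hsubmxK.
have [c1 [c2 ->]] : exists c1 c2, c = col_mx c1 c2.
  by exists (usubmx c), (dsubmx c); rewrite vsubmxK.
have [q [d12 [d21 [l ->]]]] := block_ex d.
move=> UU [Q0 E0] [Q1 E1] [Q2 E2] [Q3 E3].
(* The rows of [id_left] and [row10] together are those of the identity in another order, hence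
   independent. *)
have kill m (u : 'M[R]_(m, n)) (v : 'M[R]_(m, 1)) :
    u *m id_left R n + v *m row10 R n.+1 = 0 -> u = 0 /\ v = 0.
  move=> uv; split.
    have := congr1 (fun M => M *m id_up R n) uv.
    by rewrite mulmxDl -!mulmxA left_up row10_up mulmx1 mulmx0 addr0 mul0mx.
  have := congr1 (fun M => M *m (row10 R n.+1)^T) uv.
  by rewrite mulmxDl -!mulmxA left_row10T row10_row10T mulmx1 mulmx0 add0r mul0mx.
move: E0; rewrite !blockE !add_col_mx => /eq_col_mx[_ /eq_col_mx[/kill[c10 d120] _]].
move: E3; rewrite !blockE => /eq_col_mx[/kill[b10 b20] _].
move: E1; rewrite c10 d120 b10 b20 !blockE !add_col_mx !add0r => /eq_col_mx[E1 /eq_col_mx[E3 E4]].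
move: E2; rewrite c10 d120 b10 b20 !blockE !add_col_mx !add0r => /eq_col_mx[E5 /eq_col_mx[E6 E7]].
(* [Q] is eliminated by means of [up_left], and the remaining equation is split by columns,
   multiplying by [id_up] and by the transpose of [row10]. Moving the term in [v] to the other side
   is the origin of the sign -1. *)
have half (p' q' : 'M[R]_n) (u v : 'rV[R]_n) (Q : 'M[R]_n.+1) :
    p' *m id_left R n = id_left R n *m Q -> q' *m id_right R n = id_right R n *m Q ->
    u *m id_left R n + (v *m id_right R n + l *m row10 R n.+1) = row10 R n.+1 *m Q ->
    jordan_block n 0 *m (q'^T + -1 *: (v^T *m row10 R n)) =
      p'^T *m jordan_block n 0 + u^T *m row10 R n /\
    row10 R n *m (q'^T + -1 *: (v^T *m row10 R n)) = l *m row10 R n.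
  move=> pL qR rQ.
  have QE : Q = id_up R n *m (p' *m id_left R n) + (row10 R n.+1)^T *m (row10 R n.+1 *m Q).
    by rewrite pL !mulmxA -mulmxDl up_left mul1mx.
  have qE : q' *m id_right R n = (jordan_block n 0)^T *m p' *m id_left R n +
      (row10 R n)^T *m (u *m id_left R n + (v *m id_right R n + l *m row10 R n.+1)).
    by rewrite qR {1}QE mulmxDr -(right_up R n) -(right_row10T R n) rQ !mulmxA.
  split; apply: trmx_inj; rewrite scaleN1r.
    have := congr1 (fun M => M *m id_up R n) qE.
    rewrite mulmxDl -!mulmxA !mulmxDl -!mulmxA left_up row10_up right_up !mulmx1 !mulmx0 addr0.
    rewrite mulmxDr addrA => /eqP; rewrite -subr_eq => /eqP E.
    by rewrite trmx_mul linearD linearN /= !trmx_mul !trmxK linearD /= !trmx_mul !trmxK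
      mulmxBl -!mulmxA E.
  have := congr1 (fun M => M *m (row10 R n.+1)^T) qE.
  rewrite mulmxDl -!mulmxA !mulmxDl -!mulmxA left_row10T row10_row10T right_row10T.
  rewrite !mulmx1 !mulmx0 !add0r mulmxDr addrC => /eqP; rewrite -subr_eq => /eqP E.
  rewrite !trmx_mul linearD linearN /= !trmx_mul !trmxK mulmxBl -!mulmxA E.
  by congr (_ *m _); apply/matrixP => i j; rewrite mxE !ord1.
have [A1 A3] := half p q c2 d21 Q1 E1 E3 E4.
rewrite addrCA in E7; have [A2 A4] := half q p d21 c2 Q2 E6 E5 E7.
have [pT qT c2T d21T] := twisted_pencil_scalar A1 A2 A3 A4.
move: UU; rewrite c10 d120 b10 b20.
have -> : l = (l 0 0)%:M by rewrite [LHS]mx11_scalar.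
have -> : c2 = 0 by rewrite -[c2]trmxK c2T trmx0.
have -> : d21 = 0 by rewrite -[d21]trmxK d21T trmx0.
rewrite -[p]trmxK -[q]trmxK pT qT !tr_scalar_mx row_mx0 col_mx0.
by rewrite -!scalar_mx_block; apply: scalar_idem.
Qed.
End Listed.

(** * Classification of the indecomposables *)

Section Listing.
Variable R : realType.
Implicit Types M N L : module4 R.

Lemma m4_perm_iso (s : 'S_4) M N : m4_iso M N -> m4_iso (m4_perm s M) (m4_perm s N).
Proof. by move=> [f [fB fM]]; exists f; split=> // i; apply: fM. Qed.

Lemma m4_perm_comp (s t : 'S_4) M :
  m4_iso (m4_perm s (m4_perm t M)) (m4_perm (s * t)%g M).
Proof. by apply: m4_iso_ext => i; rewrite permM. Qed.

Lemma m4_perm1 M : m4_iso M (m4_perm 1%g M).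
Proof. by case: M => V A; apply: m4_iso_ext => i; rewrite /= perm1. Qed.

Lemma m4_perm_dim (s : 'S_4) M : m4_dim (m4_perm s M) = m4_dim M.
Proof. by []. Qed.

Lemma m4_perm_total (s : 'S_4) M : m4_total (m4_perm s M) = m4_total M.
Proof. by rewrite /m4_total [RHS](reindex_perm s). Qed.

Lemma m4_perm_indec (s : 'S_4) M : indec M -> indec (m4_perm s M).
Proof.
move=> [M0 iM]; split=> // e eM ee; apply: iM => // i x xi.
by have := eM ((s^-1)%g i) x; rewrite /= permKV; apply.
Qed.

Definition iso_listed M := exists L, m4_listed L /\ m4_iso M L.

Lemma iso_listed_table M L : m4_table L -> m4_iso M L -> iso_listed M.
Proof.
move=> tL ML; exists (m4_perm 1%g L); split; first by exists 1%g, L.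
exact: m4_iso_trans ML (m4_perm1 L).
Qed.

Lemma iso_listed_perm (s : 'S_4) M : iso_listed (m4_perm s M) -> iso_listed M.
Proof.
move=> [_ [[t [L [tL ->]]] iso]]; exists (m4_perm (s^-1 * t)%g L); split.
  by exists (s^-1 * t)%g, L.
apply: m4_iso_trans (m4_perm_comp _ _ _); apply: m4_iso_trans (m4_perm_iso _ iso).
apply: m4_iso_trans (m4_iso_sym (m4_perm_comp _ _ _)); rewrite mulVg.
exact: m4_perm1.
Qed.

Lemma table_indec L : m4_table L -> indec L.
Proof.
case=> [P s s0 Pm irr _ _|n n0|n|n|n|n|n|n|n].
- have sP : (1 < size (P ^+ s))%N.
    rewrite -(prednK s0) exprS size_proper_mul; last first.
      by rewrite (monicP Pm) mul1r lead_coef_eq0 monic_neq0 ?monic_exp.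
    have : (0 < size (P ^+ s.-1))%N by rewrite size_poly_gt0 monic_neq0 ?monic_exp.
    case: (size (P ^+ s.-1)) => // l _; case: (size P) irr.1 => [|[|k]] // _.
    by rewrite !addSn addnS.
  apply: m4_0_indec; first by rewrite -ltnS prednK // ltnW.
  by apply: (@companion_no_idempotent _ _ _ P s) => //; rewrite prednK // ltnW.
- exact: m4_0_indec n0 (@jordan_no_idempotent R n).
- exact: m4_II_indec.
- exact: m4_III_indec.
- exact: m4_IIIs_indec.
- exact: m4_IV_indec.
- exact: m4_IVs_indec.
- exact: m4_V_indec.
- exact: m4_Vs_indec.
Qed.

Lemma listed_indec L : m4_listed L -> indec L.
Proof. by move=> [s [L' [tL ->]]]; apply/m4_perm_indec/table_indec. Qed.

Local Notation o0 := (@Ordinal 4 0 isT).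
Local Notation o3 := (@Ordinal 4 3 isT).

Lemma defect_neg_listed M : indec M -> (m4_total M < 2 * m4_dim M)%N -> iso_listed M.
Proof.
move=> iM tM; have [[n [dM sM]]|[n [i [dM sM]]]|[n [i [dM sM]]]] := defect_neg_dims iM tM.
- apply: iso_listed_table (Table_V R n) _.
  apply: defect_neg_unique => //; first exact: m4_V_indec.
    by rewrite dM m4_of_mx_dim; lia.
  by move=> j; rewrite sM m4_V_subdim; move: j; apply: forall_I4.
- exists (m4_perm (tperm o0 i) (m4_III R n)); split.
    by exists (tperm o0 i), (m4_III R n); split=> //; constructor.
  apply: defect_neg_unique => //; first exact/m4_perm_indec/m4_III_indec.
    by rewrite dM m4_perm_dim m4_of_mx_dim; lia.
  move=> j; rewrite sM -[RHS]/(m4_subdim (m4_III R n) (tperm o0 i j)) m4_III_subdim.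
  rewrite -(inj_eq (@perm_inj _ (tperm o0 i))) tpermR.
  by move: (tperm o0 i j); apply: forall_I4; rewrite /= ?addn0 ?addn1.
- exists (m4_perm (tperm o3 i) (m4_IV R n)); split.
    by exists (tperm o3 i), (m4_IV R n); split=> //; constructor.
  apply: defect_neg_unique => //; first exact/m4_perm_indec/m4_IV_indec.
    by rewrite dM m4_perm_dim m4_of_mx_dim; lia.
  move=> j; rewrite -[RHS]/(m4_subdim (m4_IV R n) (tperm o3 i j)) m4_IV_subdim.
  have := sM j; rewrite -(inj_eq (@perm_inj _ (tperm o3 i))) tpermR.
  by move: (tperm o3 i j); apply: forall_I4; rewrite /= ?addn0 ?addn1 => // -[].
Qed.

Lemma defect_pos_listed M : indec M -> (2 * m4_dim M < m4_total M)%N -> iso_listed M.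
Proof.
move=> iM tM; have tD := m4_dual_total M.
have sD j := m4_dual_subdim M j.
have : prep_dims (m4_dim (m4_dual M)) (m4_subdim (m4_dual M)).
  by apply: defect_neg_dims (m4_dual_indec iM) _; rewrite m4_dual_dim; lia.
rewrite m4_dual_dim => -[[n [dM sM]]|[n [i [dM sM]]]|[n [i [dM sM]]]].
- apply: iso_listed_table (Table_Vs R n) _.
  apply: defect_pos_unique => //; first exact: m4_Vs_indec.
    by rewrite dM m4_of_mx_dim; lia.
  move=> j; rewrite m4_Vs_subdim; have := sD j; rewrite sM dM.
  by move: j; apply: forall_I4 => /=; rewrite (tnth_nth 0%N) /=; lia.
- exists (m4_perm (tperm o0 i) (m4_IIIs R n)); split.
    by exists (tperm o0 i), (m4_IIIs R n); split=> //; constructor.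
  apply: defect_pos_unique => //; first exact/m4_perm_indec/m4_IIIs_indec.
    by rewrite dM m4_perm_dim m4_of_mx_dim; lia.
  move=> j; rewrite -[RHS]/(m4_subdim (m4_IIIs R n) (tperm o0 i j)) m4_IIIs_subdim.
  have := sD j; rewrite sM dM -(inj_eq (@perm_inj _ (tperm o0 i))) tpermR.
  by move: (tperm o0 i j); apply: forall_I4; rewrite (tnth_nth 0%N) /=; lia.
- exists (m4_perm (tperm o3 i) (m4_IVs R n)); split.
    by exists (tperm o3 i), (m4_IVs R n); split=> //; constructor.
  apply: defect_pos_unique => //; first exact/m4_perm_indec/m4_IVs_indec.
    by rewrite dM m4_perm_dim m4_of_mx_dim; lia.
  move=> j; rewrite -[RHS]/(m4_subdim (m4_IVs R n) (tperm o3 i j)) m4_IVs_subdim.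
  have := sD j; have := sM j; rewrite dM -(inj_eq (@perm_inj _ (tperm o3 i))) tpermR.
  by move: (tperm o3 i j); apply: forall_I4; rewrite (tnth_nth 0%N) /=; lia.
Qed.

End Listing.

(** * Maps out of column spaces by linear combinations *)

Section LinComb.
Variables (R : realType) (V : vectType R).

Definition lincomb n (w : 'I_n -> V) (y : 'cV[R]_n) : V := \sum_i y i 0 *: w i.

Lemma lincombP n (w : 'I_n -> V) : linear (lincomb w).
Proof.
move=> a u v; rewrite /lincomb scaler_sumr -big_split; apply: eq_bigr => i _.
by rewrite !mxE scalerDl scalerA.
Qed.

Lemma lincomb_mem n (w : 'I_n -> V) (A : {vspace V}) y :
  (forall i, w i \in A) -> lincomb w y \in A.
Proof. by move=> wA; apply: rpred_sum => i _; apply: rpredZ. Qed.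

Lemma lfun_lincomb (f : 'End(V)) n (w : 'I_n -> V) y :
  f (lincomb w y) = lincomb (fun i => f (w i)) y.
Proof. by rewrite linear_sum; apply: eq_bigr => i _; rewrite linearZ. Qed.

Lemma lincomb_mulmx m n (A : 'M[R]_(m, n)) (w : 'I_m -> V) y :
  lincomb w (A *m y) = lincomb (fun j => \sum_i A i j *: w i) y.
Proof.
rewrite /lincomb; under [RHS]eq_bigr do rewrite scaler_sumr.
rewrite exchange_big; apply: eq_bigr => i _; rewrite mxE scaler_suml.
by apply: eq_bigr => j _; rewrite scalerA mulrC.
Qed.

Lemma eq_lincomb n (w w' : 'I_n -> V) y : w =1 w' -> lincomb w y = lincomb w' y.
Proof. by move=> ww; apply: eq_bigr => i _; rewrite ww. Qed.

Lemma lincomb0 n (w : 'I_n -> V) : lincomb w 0 = 0.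
Proof. by apply: big1 => i _; rewrite mxE scale0r. Qed.

Lemma block_lincomb n m (w : 'I_n -> V) (z : 'I_m -> V) :
  exists Psi : 'Hom('cV[R]_(n + m), V),
    forall x y, Psi (col_mx x y) = lincomb w x + lincomb z y.
Proof.
have [Psi PsiE] : exists Psi : 'Hom('cV[R]_(n + m), V),
    Psi =1 (fun x => lincomb w (usubmx x) + lincomb z (dsubmx x)).
  apply: lfun_of_linear => a u v; rewrite !linearD !linearZ /=.
  by rewrite !lincombP addrACA.
by exists Psi => x y; rewrite PsiE col_mxKu col_mxKd.
Qed.
End LinComb.

(** * Defect zero: odd endomorphisms and strings *)

Section ZeroDefect.
Variable R : realType.
Implicit Types M L : module4 R.

Local Notation o0 := (@Ordinal 4 0 isT).
Local Notation o1 := (@Ordinal 4 1 isT).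
Local Notation o2 := (@Ordinal 4 2 isT).
Local Notation o3 := (@Ordinal 4 3 isT).

(* When M_0 is a complement of M_2 and of M_3, and M_2 one of M_1, the subspaces
   M_1 and M_3 are the graphs of maps M_0 -> M_2 and M_2 -> M_0, which are the
   two components of an odd endomorphism T of M_0 + M_2. *)
Definition odd_endo M (T : 'End(M)) : Prop :=
  [/\ forall v, v \in m4_sub M o0 -> T v \in m4_sub M o2 /\ v + T v \in m4_sub M o1,
      forall w, w \in m4_sub M o2 -> T w \in m4_sub M o0 /\ w + T w \in m4_sub M o3,
      forall y, y \in m4_sub M o1 -> exists2 v, v \in m4_sub M o0 & y = v + T v &
      forall y, y \in m4_sub M o3 -> exists2 w, w \in m4_sub M o2 & y = w + T w].

Lemma odd_endo_exists M :
  triv M o0 o2 -> triv M o1 o2 -> triv M o0 o3 ->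
  (m4_sub M o0 + m4_sub M o2 = fullv)%VS -> (m4_sub M o1 + m4_sub M o2 = fullv)%VS ->
  (m4_sub M o0 + m4_sub M o3 = fullv)%VS -> exists T : 'End(M), odd_endo T.
Proof.
move=> t02 t12 t03 f02 f12 f03.
have t20 := triv_sym t02; have t21 := triv_sym t12; have t30 := triv_sym t03.
(* On M_0, [T] is minus the M_2-component in M_1 + M_2, so v + T v is the M_1-component of v; on M_2
   it is minus the M_0-component in M_0 + M_3. *)
pose T : 'End(M) := - ((daddv_pi (m4_sub M o2) (m4_sub M o1) \o
    daddv_pi (m4_sub M o0) (m4_sub M o2))%VF +
  (daddv_pi (m4_sub M o0) (m4_sub M o3) \o daddv_pi (m4_sub M o2) (m4_sub M o0))%VF).
have T0 v : v \in m4_sub M o0 -> T v = - daddv_pi (m4_sub M o2) (m4_sub M o1) v.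
  move=> v0; rewrite opp_lfunE add_lfunE !comp_lfunE (daddv_pi_id t02 v0) (daddv_pi0 t20 v0).
  by rewrite linear0 addr0.
have T2 w : w \in m4_sub M o2 -> T w = - daddv_pi (m4_sub M o0) (m4_sub M o3) w.
  move=> w2; rewrite opp_lfunE add_lfunE !comp_lfunE (daddv_pi_id t20 w2) (daddv_pi0 t02 w2).
  by rewrite linear0 add0r.
have A v : v \in m4_sub M o0 -> T v \in m4_sub M o2 /\ v + T v \in m4_sub M o1.
  move=> v0; rewrite T0 // rpredN memv_pi; split=> //.
  have vE : v = daddv_pi (m4_sub M o1) (m4_sub M o2) v + daddv_pi (m4_sub M o2) (m4_sub M o1) v.
    by rewrite (daddv_pi_add t12) // f12 memvf.
  by rewrite {1}vE addrK memv_pi.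
have B w : w \in m4_sub M o2 -> T w \in m4_sub M o0 /\ w + T w \in m4_sub M o3.
  move=> w2; rewrite T2 // rpredN memv_pi; split=> //.
  have wE : w = daddv_pi (m4_sub M o3) (m4_sub M o0) w + daddv_pi (m4_sub M o0) (m4_sub M o3) w.
    by rewrite (daddv_pi_add t30) // addvC f03 memvf.
  by rewrite {1}wE addrK memv_pi.
(* For y = v + w in M_1, the difference y - (v + T v) = w - T v lies in M_1 and in M_2, so it is
   zero; likewise for M_3. *)
exists T; split=> // y yi.
  have /memv_addP[v v0 [w w2 yE]] : y \in (m4_sub M o0 + m4_sub M o2)%VS by rewrite f02 memvf.
  exists v => //; have [Tv vTv] := A v v0.
  have /trivP t := t12; apply/eqP; rewrite -subr_eq0; apply/eqP/t; first by rewrite rpredB.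
  by rewrite yE opprD addrACA subrr add0r rpredB.
have /memv_addP[v v0 [w w2 yE]] : y \in (m4_sub M o0 + m4_sub M o2)%VS by rewrite f02 memvf.
exists w => //; have [Tw wTw] := B w w2.
have /trivP t := t03; apply/eqP; rewrite -subr_eq0; apply/eqP/t; last by rewrite rpredB.
by rewrite yE [v + w]addrC opprD addrACA subrr add0r rpredB.
Qed.

Lemma odd_endo_hom M (T e : 'End(M)) : odd_endo T ->
  (forall v, v \in m4_sub M o0 -> e v \in m4_sub M o0) ->
  (forall v, v \in m4_sub M o2 -> e v \in m4_sub M o2) ->
  (forall v, e (T v) = T (e v)) -> m4_hom e.
Proof.
move=> [T0 T2 T1 T3] e0 e2 eT; apply: forall_I4 => y yi.
- exact: e0.
- have [v v0 ->] := T1 y yi; rewrite linearD /= eT.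
  by have [] := T0 (e v) (e0 v v0).
- exact: e2.
- have [v v2 ->] := T3 y yi; rewrite linearD /= eT.
  by have [] := T2 (e v) (e2 v v2).
Qed.

Lemma iter_lfunD M (T : 'End(M)) k x y : iter k T (x + y) = iter k T x + iter k T y.
Proof. by elim: k => //= k ->; rewrite linearD. Qed.

Lemma iter_lfun0 M (T : 'End(M)) k : iter k T 0 = 0.
Proof. by elim: k => //= k ->; rewrite linear0. Qed.

(* T^2 is not invertible, hence T is nilpotent.  For phi homogeneous and dual to the
   last vector of a longest homogeneous string v, T v, ..., the sum in the last
   conclusion is an idempotent endomorphism of M, hence the identity. *)
Lemma nilpotent_string M (T : 'End(M)) (x : M) :
  indec M -> odd_endo T -> triv M o0 o2 -> (m4_sub M o0 + m4_sub M o2 = fullv)%VS ->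
  x != 0 -> x \in m4_sub M o0 -> T x = 0 ->
  exists m (v : M) (phi : 'Hom(M, R^o)),
    [/\ (0 < m)%N, iter m T v = 0,
        v \in (if odd m then m4_sub M o0 else m4_sub M o2),
        forall l, (l < m)%N -> phi (iter l T v) = (l == m.-1)%:R &
        forall w, w = \sum_(i < m) phi (iter (m.-1 - i) T w) *: iter i T v].
Proof.
move=> iM oT t02 f02 x0 xM0 Tx; have [T0 T2 T1 T3] := oT.
pose H (b : bool) := if b then m4_sub M o2 else m4_sub M o0.
have TH b w : w \in H b -> T w \in H (~~ b).
  by case: b => /=; [move=> /T2[]|move=> /T0[]].
have THi k b w : w \in H b -> iter k T w \in H (b (+) odd k).
  elim: k => [|k IH] wb; first by rewrite addbF.
  by rewrite /= addbN; apply/TH/IH.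
have tH b w : w \in H b -> w \in H (~~ b) -> w = 0.
  have /trivP t := t02; case: b => /= w1 w2; exact: t.
have [m [m0 Tm [y Ty]]] : exists m, [/\ (0 < m)%N, forall w, iter m T w = 0 &
    exists y, iter m.-1 T y != 0].
  (* [T] exchanges M_0 and M_2; its square preserves them, and Fitting's lemma applies to that. *)
  have T2M : m4_hom (T \o T)%VF.
    apply: (odd_endo_hom oT) => [v v0|v v2|v]; rewrite !comp_lfunE //.
      by case: (T2 (T v) (T0 v v0).1).
    by case: (T0 (T v) (T2 v v2).1).
  have [[k nil]|[g [_ _ gK _]]] := fitting iM T2M; last first.
    by move: x0; rewrite -[x]gK comp_lfunE Tx !linear0 eqxx.
  have ex : exists m, `[< forall w, iter m T w = 0 >].
    exists (k * 2)%N; apply/asboolP => w; rewrite -(nil w).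
    elim: k {nil} => [|k IH] //; by rewrite mulSn iterD IH [RHS]iterS comp_lfunE.
  case: (ex_minnP ex) => m /asboolP Tm mmin; exists m.
  have m0 : (0 < m)%N by case: m Tm {mmin} => // /(_ x) /= xz; rewrite xz eqxx in x0.
  split=> //; apply: contrapT => ny.
  have : (m <= m.-1)%N; last by rewrite leqNgt prednK // leqnn.
  apply: mmin; apply/asboolP => w; apply/eqP/negPn/negP => nw.
  by apply: ny; exists w.
have [b [v [vb Tv]]] : exists b v, v \in H b /\ iter m.-1 T v != 0.
  have /memv_addP[v v0 [w w2 yE]] : y \in (m4_sub M o0 + m4_sub M o2)%VS by rewrite f02 memvf.
  have [Tv|Tv] := eqVneq (iter m.-1 T v) 0; last by exists false, v.
  exists true, w; split=> //; apply: contraNneq Ty => Tw.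
  by rewrite yE iter_lfunD Tv Tw addr0.
pose u := iter m.-1 T v; pose bu := b (+) odd m.-1.
have uH : u \in H bu by apply: THi.
have lin k : exists f : 'End(M), f =1 iter k T by exists (lpow T k) => w; rewrite lpowE.
pose S := (\sum_(i < m.-1) <[iter i T v]>)%VS.
have Tge l w : (m <= l)%N -> iter l T w = 0.
  by move=> ml; rewrite -(subnK ml) iterD Tm iter_lfun0.
(* In an expression of u by the earlier terms of the string, T^(m-1-i) kills u and all terms beyond
   the i-th, and turns the i-th into a multiple of u; so the coefficients vanish one after the
   other. *)
have uS : u \notin S.
  apply/negP => /memv_sumP[z zi uz].
  have z0 i : (i < m.-1)%N -> forall j : 'I_m.-1, j = i :> nat -> z j = 0.
    elim/ltn_ind: i => i IHi im j ji.
    have /vlineP[c zc] := zi j isT.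
    have [f fE] := lin (m.-1 - i)%N.
    have := congr1 f uz; rewrite linear_sum fE /u -iterD Tge /=; last by clear -im; lia.
    rewrite (bigD1 j) //= big1 => [|l lj].
      rewrite addr0 zc linearZ /= fE ji -iterD subnK ?(ltnW im) //.
      by move=> /esym/eqP; rewrite scaler_eq0 (negbTE Tv) orbF => /eqP->; rewrite scale0r.
    have lnj : (l : nat) <> i by rewrite -ji => lj'; case/eqP: lj; apply: ord_inj.
    have [li|li] := ltnP l i; first by rewrite (IHi l) ?linear0.
    have /vlineP[d ->] := zi l isT.
    rewrite linearZ /= fE -iterD Tge ?scaler0 //.
    by clear -li lnj; lia.
  by move: Tv; rewrite -/u uz big1 ?eqxx // => i _; apply: (z0 i).
have [phi0 [phi0u phi0S]] := functional_sep uS.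
pose pr := daddv_pi (H bu) (H (~~ bu)).
have tbu : (H bu :&: H (~~ bu) = 0)%VS.
  by case: (bu) => /=; [rewrite capvC|].
(* Projecting first to the component containing u makes [phi] vanish on the other one; this is why
   [e] preserves M_0 and M_2. *)
pose phi := (phi0 \o pr)%VF.
have phiH w : w \in H bu -> phi w = phi0 w by move=> wb; rewrite comp_lfunE /pr daddv_pi_id.
have phiH' w : w \in H (~~ bu) -> phi w = 0.
  by move=> wb; rewrite comp_lfunE /pr daddv_pi0 // linear0.
have phiT l : (l < m)%N -> phi (iter l T v) = (l == m.-1)%:R.
  move=> lm; have [->|lm'] := eqVneq l m.-1; first by rewrite phiH.
  have [bl|bl] := boolP (bu == b (+) odd l).
    rewrite phiH ?(eqP bl) ?THi // phi0S //.
    have lm1 : (l < m.-1)%N by rewrite ltn_neqAle lm' -ltnS prednK.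
    by rewrite memvE (sumv_sup (Ordinal lm1)).
  apply: phiH'; have -> : ~~ bu = b (+) odd l by move: bl; case: (bu); case: (b (+) odd l).
  exact: THi.
have [e eE] : exists e : 'End(M),
    e =1 (fun w => \sum_(i < m) phi (iter (m.-1 - i) T w) *: iter i T v).
  apply: lfun_of_linear => a w w'; rewrite scaler_sumr -big_split; apply: eq_bigr => i _.
  rewrite iter_lfunD; have -> : iter (m.-1 - i) T (a *: w) = a *: iter (m.-1 - i) T w.
    by elim: (m.-1 - i)%N => //= k ->; rewrite linearZ.
  by rewrite linearD linearZ /= scalerDl scalerA.
have eH b' w : w \in H b' -> e w \in H b'.
  move=> wb; rewrite eE; apply: rpred_sum => i _.
  have im : (i <= m.-1)%N by rewrite -ltnS prednK.
  have [bb|bb] := boolP (bu == b' (+) odd (m.-1 - i)).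
    have -> : b' = b (+) odd i.
      move: bb; rewrite /bu oddB //.
      by case: (b); case: (b'); case: (odd m.-1); case: (odd i).
    by rewrite rpredZ // THi.
  rewrite phiH' ?scale0r ?mem0v //.
  have -> : ~~ bu = b' (+) odd (m.-1 - i).
    by move: bb; case: (bu); case: (b' (+) _).
  exact: THi.
have eT w : e (T w) = T (e w).
  rewrite !eE linear_sum -(prednK m0) big_ord_recl [RHS]big_ord_recr /=.
  rewrite subn0 -iterSr prednK // Tm linear0 scale0r add0r.
  rewrite linearZ /= -iterS prednK // Tm scaler0 addr0.
  apply: eq_bigr => i _; rewrite linearZ /= /bump add1n -iterSr subnSK //.
have eM : m4_hom e by apply: (odd_endo_hom oT) => // w; [apply: (eH false)|apply: (eH true)].
have eTv j : (j < m)%N -> e (iter j T v) = iter j T v.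
  move=> jm; rewrite eE (bigD1 (Ordinal jm)) //= big1 => [|i ij].
    rewrite -iterD subnK; last by rewrite -ltnS prednK.
    by rewrite phiT ?prednK // eqxx scale1r addr0.
  rewrite -iterD; have im := ltn_ord i; have nij : (i : nat) <> j.
    by move=> ij'; case/eqP: ij; apply: ord_inj.
  have [lt|ge] := ltnP (m.-1 - i + j) m; last by rewrite Tge // linear0 scale0r.
  have ne : (m.-1 - i + j == m.-1)%N = false.
    by apply/eqP; clear -nij im jm; lia.
  by rewrite phiT // ne scale0r.
have ee w : e (e w) = e w.
  rewrite [e w]eE linear_sum /=; apply: eq_bigr => i _.
  by rewrite linearZ /= eTv.
have [_ iM'] := iM; have [e0|e1] := iM' e eM ee.
  by move: Tv; rewrite -[v](eTv 0%N m0) /= e0 iter_lfun0 eqxx.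
exists m, v, phi; split=> // [|w]; last by rewrite -eE e1.
suff -> : odd m = ~~ b by move: vb; case: (b).
(* The given x fixes the parity of m: being killed by [T] it is a multiple of the last term u, which
   therefore lies in M_0. *)
have xu : x = phi x *: u.
  rewrite -{1}[x]e1 eE -(prednK m0) big_ord_recr /= subnn big1 ?add0r // => i _.
  have : (0 < m.-1 - i)%N by rewrite subn_gt0.
  by case: (m.-1 - i)%N => // k _; rewrite iterSr Tx iter_lfun0 linear0 scale0r.
have u0 : u \in H false.
  have px : phi x != 0 by apply: contra x0 => /eqP px; rewrite xu px scale0r.
  by move: xM0; rewrite xu rpredZeq (negbTE px).
have : bu = false.
  apply: negbTE; apply/negP => bu1; move: uH; rewrite bu1 => u1.
  by move: Tv; rewrite -/u (tH false u u0 u1) eqxx.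
by rewrite /bu -{2}(prednK m0) /=; case: (b); case: (odd m.-1).
Qed.

Lemma perm4_exists (a b c d : 'I_4) : uniq [:: a; b; c; d] ->
  exists s : 'S_4, [/\ s o0 = a, s o1 = b, s o2 = c & s o3 = d].
Proof.
move=> u; pose f (i : 'I_4) := nth a [:: a; b; c; d] i.
have fI : injective f.
  move=> i j /eqP; rewrite /f nth_uniq //= => /eqP; exact: ord_inj.
by exists (perm fI); split; rewrite permE.
Qed.

(** The functionals w |-> phi (T^(m-1-j) w) are dual to the vectors T^j v. The exponents of the two
    blocks are left as parameters because types I and II number the string differently. *)
Lemma string_basis M (T : 'End(M)) m (v : M) (phi : 'Hom(M, R^o)) n1 n2
    (s : 'I_n1 -> nat) (t : 'I_n2 -> nat) :
  iter m T v = 0 ->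
  (forall l, (l < m)%N -> phi (iter l T v) = (l == m.-1)%:R) ->
  (forall w, w = \sum_(i < m) phi (iter (m.-1 - i) T w) *: iter i T v) ->
  injective s -> injective t -> (forall i j, s i != t j) ->
  (forall i, s i < m)%N -> (forall i, t i < m)%N -> (n1 + n2)%N = m ->
  exists Psi : 'Hom('cV[R]_(n1 + n2), M),
    [/\ forall x y, Psi (col_mx x y) = lincomb (fun i => iter (s i) T v) x +
          lincomb (fun i => iter (t i) T v) y,
        injective Psi & limg Psi = fullv].
Proof.
move=> Tm phiT span sI tI st sm tm nm.
have Tge l : (m <= l)%N -> iter l T v = 0.
  by move=> ml; rewrite -(subnK ml) iterD Tm iter_lfun0.
have [Psi PsiE] := block_lincomb (fun i => iter (s i) T v) (fun i => iter (t i) T v).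
have kap j l : (j < m)%N -> (l < m)%N -> phi (iter (m.-1 - j) T (iter l T v)) = (l == j)%:R.
  move=> jm lm; rewrite -iterD; have [lt|ge] := ltnP (m.-1 - j + l) m.
    by rewrite phiT //; congr (_%:R); congr nat_of_bool; apply/eqP/eqP; lia.
  by rewrite Tge // linear0 (_ : _ == _ = false) //; apply/eqP; lia.
have lin k : exists f : 'End(M), f =1 iter k T by exists (lpow T k) => w; rewrite lpowE.
have kapl j n (r : 'I_n -> nat) (x : 'cV[R]_n) : (j < m)%N -> (forall i, r i < m)%N ->
    phi (iter (m.-1 - j) T (lincomb (fun i => iter (r i) T v) x)) = \sum_i x i 0 * (r i == j)%:R.
  move=> jm rm; have [f fE] := lin (m.-1 - j)%N.
  rewrite -fE lfun_lincomb linear_sum; apply: eq_bigr => i _.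
  by rewrite linearZ /= fE kap.
have pick n (r : 'I_n -> nat) (x : 'cV[R]_n) j : injective r ->
    \sum_i x i 0 * (r i == r j)%:R = x j 0.
  move=> rI; rewrite (bigD1 j) //= eqxx mulr1 big1 ?addr0 // => i ij.
  by rewrite (inj_eq rI) (negbTE ij) mulr0.
have inj0 x y : Psi (col_mx x y) = 0 -> x = 0 /\ y = 0.
  rewrite PsiE => P0; split; apply/colP => j.
    have := congr1 (fun w => phi (iter (m.-1 - s j) T w)) P0.
    rewrite /= iter_lfunD linearD /= !kapl // pick // iter_lfun0 linear0 big1 ?addr0 ?mxE //.
    by move=> i _; rewrite eq_sym (negbTE (st _ _)) mulr0.
  have := congr1 (fun w => phi (iter (m.-1 - t j) T w)) P0.
  rewrite /= iter_lfunD linearD /= !kapl // pick // iter_lfun0 linear0 big1 ?add0r ?mxE //.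
  by move=> i _; rewrite (negbTE (st _ _)) mulr0.
have PI : injective Psi.
  apply/lker0P; rewrite -subv0; apply/subvP => w; rewrite memv_ker -[w]vsubmxK.
  by move=> /eqP/inj0[-> ->]; rewrite col_mx0 mem0v.
exists Psi; split=> //; apply: lfun_inj_dim => //.
have -> : \dim {:'cV[R]_(n1 + n2)} = m by rewrite dimvf -nm; apply: muln1.
have /dimvS : ({:M} <= \sum_(i < m) <[iter i T v]>)%VS.
  apply/subvP => w _; rewrite [w]span; apply: memv_sumr => i _.
  by rewrite rpredZ // memv_line.
move=> /leq_trans; apply; apply: leq_trans (dimv_leq_sum _ _ _) _.
rewrite -[X in (_ <= X)%N]card_ord -sum1_card; apply: leq_sum => i _.
by rewrite dim_vline leq_b1.
Qed.

Lemma nilpotent_listed M (T : 'End(M)) (x : M) :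
  indec M -> m4_total M = (2 * m4_dim M)%N ->
  odd_endo T -> triv M o0 o2 -> (m4_sub M o0 + m4_sub M o2 = fullv)%VS ->
  x != 0 -> x \in m4_sub M o0 -> T x = 0 -> iso_listed M.
Proof.
move=> iM tM oT t02 f02 x0 xM0 Tx; have [T0 T2 _ _] := oT.
have [m [v [phi [m0 Tm vm phiT span]]]] := nilpotent_string iM oT t02 f02 x0 xM0 Tx.
have Wmem i : iter i T v \in (if odd m (+) odd i then m4_sub M o0 else m4_sub M o2).
  elim: i => [|i IH]; first by rewrite addbF.
  rewrite iterS /= addbN; move: IH; case: (odd m (+) odd i) => /=.
    by move=> /T0[].
  by move=> /T2[].
have mE := odd_double_half m; set n := m./2 in mE.
have [om|em] := boolP (odd m).
  (* For m = 2n+1 the string starts and ends in M_0: its n+1 even terms lie in M_0 and its n odd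
     terms in M_2. *)
  have {}mE : m = (n.+1 + n)%N by rewrite -mE om -addnn.
  have mem0 i : iter (2 * i) T v \in m4_sub M o0.
    by have := Wmem (2 * i)%N; rewrite om oddM.
  have mem2 i : iter (2 * i).+1 T v \in m4_sub M o2.
    by have := Wmem (2 * i).+1; rewrite om /= oddM.
  have [|||||Psi [PsiE PI PS]] := @string_basis M T m v phi n.+1 n
    (fun i => 2 * i)%N (fun i => (2 * i).+1)%N Tm phiT span _ _ _ _ _ (esym mE).
  - by move=> i j ij; apply: ord_inj; lia.
  - by move=> i j [ij]; apply: ord_inj; lia.
  - by move=> i j; apply/eqP; lia.
  - by move=> i; have := ltn_ord i; lia.
  - by move=> i; have := ltn_ord i; lia.
  (* Type II lists M_0, the graph over M_0, the graph over M_2, and then M_2. *)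
  have [s [s0 s1 s2 s3]] : exists s : 'S_4, [/\ s o0 = o0, s o1 = o1, s o2 = o3 & s o3 = o2].
    exact: perm4_exists.
  apply: (@iso_listed_perm _ s); apply: iso_listed_table (Table_II R n) _.
  have [||g fg] := @m4_iso_of_total _ (m4_II R n) (m4_perm s M) Psi _ PI PS; last first.
    by apply/m4_isoP; exists g, Psi; apply: m4_inv_sym.
    rewrite m4_perm_total tM /m4_total; under eq_bigr do rewrite m4_II_subdim.
    rewrite !big_ord_recl big_ord0 /= !(tnth_nth 0%N) /=.
    have -> : m4_dim M = m by rewrite /m4_dim -PS limg_dim_eq ?dimvf;
      [rewrite mE; apply: muln1|have /lker0P/eqP -> := PI; rewrite capv0].
    by rewrite mE; lia.
  apply: m4_of_mx_hom => y /=; rewrite ?s0 ?s1 ?s2 ?s3 mul_col_mx PsiE ?mul1mx ?mul0mx ?lincomb0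
    ?addr0 ?add0r.
  - by apply: lincomb_mem => i; apply: mem0.
  - have /T0[_] : lincomb (fun i : 'I_n.+1 => iter (2 * i) T v) y \in m4_sub M o0.
      by apply: lincomb_mem => i; apply: mem0.
    suff <- : lincomb (fun i : 'I_n => iter (2 * i).+1 T v) (id_right R n *m y) =
        T (lincomb (fun i : 'I_n.+1 => iter (2 * i) T v) y) by [].
    rewrite lfun_lincomb lincomb_mulmx; apply: eq_lincomb => j.
    have [jn|nj] := ltnP j n.
      rewrite (bigD1 (Ordinal jn)) //= big1 => [|k kj]; rewrite mxE /=.
        by rewrite eqxx scale1r addr0.
      case: eqP => [E|]; last by rewrite scale0r.
      by case/eqP: kj; apply: ord_inj.
    (* For j = n the string has ended, T^m v = 0, which is the zero column of [id_right]. *)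
    rewrite -iterS big1 => [|k _].
      have -> : (2 * j).+1 = m by rewrite mE; have := ltn_ord j; lia.
      by [].
    rewrite mxE; case: eqP => [E|]; last by rewrite scale0r.
    by have := ltn_ord k; rewrite E ltnNge nj.
  - have /T2[_] : lincomb (fun i : 'I_n => iter (2 * i).+1 T v) y \in m4_sub M o2.
      by apply: lincomb_mem => i; apply: mem2.
    rewrite addrC.
    suff <- : lincomb (fun i : 'I_n.+1 => iter (2 * i) T v) (id_up R n *m y) =
        T (lincomb (fun i : 'I_n => iter (2 * i).+1 T v) y) by [].
    rewrite lfun_lincomb lincomb_mulmx; apply: eq_lincomb => j.
    rewrite -iterS (bigD1 (lift ord0 j)) // big1 => [|k kj]; rewrite mxE.
      rewrite eqxx scale1r; apply: etrans (addr0 _) _; congr (iter _ T v).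
      have -> : nat_of_ord (lift ord0 j) = j.+1 by [].
      by lia.
    case: eqP => [E|]; last by rewrite scale0r.
    by case/eqP: kj; apply: ord_inj.
  - by apply: lincomb_mem => i; apply: mem2.
(* For m = 2n the string starts in M_2 and ends in M_0, with n terms in each. *)
have {}mE : m = (n + n)%N by rewrite -mE (negbTE em) -addnn.
have n0 : (0 < n)%N by lia.
have mem0 i : iter (2 * i).+1 T v \in m4_sub M o0.
  by have := Wmem (2 * i).+1; rewrite (negbTE em) /= oddM.
have mem2 i : iter (2 * i) T v \in m4_sub M o2.
  by have := Wmem (2 * i)%N; rewrite (negbTE em) oddM.
(* The terms are numbered from the end of the string, so that [T] lowers the index from M_0 to M_2,
   as the ones above the diagonal of the Jordan block require. *)
have [|||||Psi [PsiE PI PS]] := @string_basis M T m v phi n n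
  (fun i => 2 * (n.-1 - i))%N (fun i => (2 * (n.-1 - i)).+1)%N Tm phiT span _ _ _ _ _ (esym mE).
- by move=> i j ij; apply: ord_inj; have := ltn_ord i; have := ltn_ord j; lia.
- by move=> i j [ij]; apply: ord_inj; have := ltn_ord i; have := ltn_ord j; lia.
- by move=> i j; apply/eqP; lia.
- by move=> i; have := ltn_ord i; lia.
- by move=> i; have := ltn_ord i; lia.
(* M_2 and M_0 become the coordinate subspaces; in the chosen bases the graph M_3 over M_2 is [I; I]
   and the graph M_1 over M_0 is [J; I]. *)
have [s [s0 s1 s2 s3]] : exists s : 'S_4, [/\ s o0 = o2, s o1 = o0, s o2 = o3 & s o3 = o1].
  exact: perm4_exists.
apply: (@iso_listed_perm _ s); apply: iso_listed_table (Table_I R n0) _.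
have [||g fg] := @m4_iso_of_total _ (m4_I R n) (m4_perm s M) Psi _ PI PS; last first.
  by apply/m4_isoP; exists g, Psi; apply: m4_inv_sym.
  rewrite m4_perm_total tM /m4_total; under eq_bigr do rewrite m4_0_subdim.
  rewrite !big_ord_recl big_ord0 /= !(tnth_nth 0%N) /=.
  have -> : m4_dim M = m by rewrite /m4_dim -PS limg_dim_eq ?dimvf;
    [rewrite mE; apply: muln1|have /lker0P/eqP -> := PI; rewrite capv0].
  by rewrite mE; lia.
apply: m4_of_mx_hom => y /=; rewrite ?s0 ?s1 ?s2 ?s3 mul_col_mx PsiE ?mul1mx ?mul0mx ?lincomb0
  ?addr0 ?add0r.
- by apply: lincomb_mem => i; apply: mem2.
- by apply: lincomb_mem => i; apply: mem0.
- have /T2[_] : lincomb (fun i : 'I_n => iter (2 * (n.-1 - i)) T v) y \in m4_sub M o2.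
    by apply: lincomb_mem => i; apply: mem2.
  by rewrite lfun_lincomb.
- have /T0[_] : lincomb (fun i : 'I_n => iter (2 * (n.-1 - i)).+1 T v) y \in m4_sub M o0.
    by apply: lincomb_mem => i; apply: mem0.
  rewrite addrC.
  suff <- : lincomb (fun i : 'I_n => iter (2 * (n.-1 - i)) T v) (jordan_block n 0 *m y) =
      T (lincomb (fun i : 'I_n => iter (2 * (n.-1 - i)).+1 T v) y) by [].
  rewrite lfun_lincomb lincomb_mulmx; apply: eq_lincomb => j.
  rewrite -iterS; case jE : (j : nat) => [|j'].
    rewrite big1 => [|k _]; last by rewrite mxE jE mul0rn add0r scale0r.
    by have -> : (2 * (n.-1 - 0)).+2 = m by rewrite mE; lia.
  have lj : (j' < n)%N by have := ltn_ord j; lia.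
  rewrite (bigD1 (Ordinal lj)) // big1 => [|k kj]; rewrite mxE mul0rn add0r jE eqSS.
    rewrite eqxx scale1r; apply: etrans (addr0 _) _; congr (iter _ T v).
    rewrite [nat_of_ord _]/=; have := ltn_ord j; lia.
  case: eqP => [E|]; last by rewrite scale0r.
  by case/eqP: kj; apply: ord_inj.
Qed.
End ZeroDefect.

(** * Defect zero with trivial intersections, and the full classification *)

Section Homogeneous.
Variable R : realType.
Implicit Types M : module4 R.

Local Notation o0 := (@Ordinal 4 0 isT).
Local Notation o1 := (@Ordinal 4 1 isT).
Local Notation o2 := (@Ordinal 4 2 isT).
Local Notation o3 := (@Ordinal 4 3 isT).

Lemma m4_0_similar n d (X : 'M[R]_n) (C : 'M[R]_d) A B :
  A *m B = 1%:M -> B *m A = 1%:M -> C *m A = A *m X -> m4_iso (m4_0 X) (m4_0 C).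
Proof.
move=> AB BA CA.
have [f [fM fE]] := m4_0_hom CA.
have XB : X *m B = B *m C by rewrite -[X]mul1mx -BA -!mulmxA (mulmxA A X) -CA -mulmxA AB mulmx1.
have [g [gM gE]] := m4_0_hom XB.
have BA' : block_mx B 0 0 B *m block_mx A 0 0 A = 1%:M.
  by rewrite mulmx_block !blockE BA -scalar_mx_block.
have AB' : block_mx A 0 0 A *m block_mx B 0 0 B = 1%:M.
  by rewrite mulmx_block !blockE AB -scalar_mx_block.
apply/m4_isoP; exists f, g; split=> // x; rewrite fE gE mulmxA ?BA' ?AB' mul1mx //.
Qed.

Lemma m4_0_table n (X : 'M[R]_n) : (0 < n)%N -> no_idempotent X ->
  (forall y : 'cV_n, X *m y = 0 -> y = 0) ->
  (forall y : 'cV_n, X *m y - y = 0 -> y = 0) ->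
  exists L, m4_table L /\ m4_iso (m4_0 X) L.
Proof.
case: n X => // n' X _ hX XI X1I.
have [P [r [r0 Pm irr minX]]] := no_idempotent_minpoly hX.
have [A [B [AB BA CA]]] := no_idempotent_companion hX r0 Pm irr minX.
(* P = t would give X^r = 0, and P = t - 1 would give (X - 1)^r = 0; neither is possible for an
   injective matrix of positive size. *)
have nil Y : (forall y : 'cV[R]_n'.+1, Y *m y = 0 -> y = 0) -> Y ^+ r <> 0.
  move=> YI Yr; have H : forall k (y : 'cV[R]_n'.+1), Y ^+ k *m y = 0 -> y = 0.
    elim=> [|k IH] y; first by rewrite expr0 mul1mx.
    by rewrite exprSr -[Y ^+ k * Y]/(Y ^+ k *m Y) -mulmxA => /IH/YI.
  have := H r (delta_mx 0 0); rewrite Yr mul0mx => /(_ erefl)/colP/(_ 0).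
  by rewrite !mxE eqxx => /eqP; rewrite oner_eq0.
have fX : horner_mx X (P ^+ r) = 0 by rewrite -minX mx_root_minpoly.
exists (m4_0 (companionmx (P ^+ r))); split; last exact: m4_0_similar AB BA CA.
apply: Table_0 r0 Pm irr _ _.
- apply/eqP => PX; apply: (nil X XI).
  by move: fX; rewrite PX rmorphXn /= horner_mx_X.
- apply/eqP => PX; apply: (nil (X - 1)).
    by move=> y; rewrite mulmxBl mul1mx; apply: X1I.
  by move: fX; rewrite PX rmorphXn rmorphB /= horner_mx_X rmorph1.
Qed.

Lemma homogeneous_listed M : indec M -> m4_total M = (2 * m4_dim M)%N ->
  (forall i j : 'I_4, i != j -> triv M i j) -> iso_listed M.
Proof.
move=> iM tM t.
have full (a b c d : 'I_4) : uniq [:: a; b; c; d] -> (m4_sub M c + m4_sub M d = fullv)%VS.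
  move=> u; apply: (triv_full u tM).
    by apply: t; move: u; rewrite /= !inE !negb_or => /andP[/andP[]].
  by apply: t; move: u; rewrite /= !inE => /and4P[].
have [t02 t12 t03] : [/\ triv M o0 o2, triv M o1 o2 & triv M o0 o3] by split; apply: t.
have f02 : (m4_sub M o0 + m4_sub M o2 = fullv)%VS by apply: (full o1 o3).
have f12 : (m4_sub M o1 + m4_sub M o2 = fullv)%VS by apply: (full o0 o3).
have f03 : (m4_sub M o0 + m4_sub M o3 = fullv)%VS by apply: (full o1 o2).
have f01 : (m4_sub M o0 + m4_sub M o1 = fullv)%VS by apply: (full o2 o3).
have [T oT] := odd_endo_exists t02 t12 t03 f02 f12 f03; have [T0 T2 T1 T3] := oT.
set n := \dim (m4_sub M o0).
have dimM : m4_dim M = (n + n)%N.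
  have := triv_dim t02; rewrite f02 => d02; have := triv_dim t12; rewrite f12 => d12.
  have t01 : triv M o0 o1 by apply: t.
  have := triv_dim t01; rewrite f01 => d01.
  by move: d01 d02 d12; rewrite /m4_dim /m4_subdim -/n; lia.
have TI v : v \in m4_sub M o0 -> T v = 0 -> v = 0.
  move=> v0 Tv; have /trivP t01 : triv M o0 o1 by apply: t.
  by apply: t01 => //; have [_] := T0 v v0; rewrite Tv addr0.
pose b (i : 'I_n) : M := (vbasis (m4_sub M o0))`_i.
have bM i : b i \in m4_sub M o0 by apply: vbasis_mem; rewrite mem_nth // size_tuple.
have bI y : lincomb b y = 0 -> y = 0.
  move=> y0; have /freeP fr := basis_free (vbasisP (m4_sub M o0)).
  by apply/colP => i; rewrite mxE; apply: (fr (fun i => y i 0)).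
(* [X] is the matrix of T^2 on M_0 in the basis b, and T b serves as the basis of M_2. *)
pose X : 'M[R]_n := \matrix_(i, j) coord (vbasis (m4_sub M o0)) i (T (T (b j))).
have XE y : lincomb b (X *m y) = T (T (lincomb b y)).
  rewrite lincomb_mulmx !lfun_lincomb; apply: eq_lincomb => j.
  rewrite [RHS](coord_vbasis (U := m4_sub M o0)); last by have [] := T2 _ (T0 _ (bM j)).1.
  by apply: eq_bigr => i _; rewrite mxE.
have lb y : lincomb b y \in m4_sub M o0 by apply: lincomb_mem.
have [Psi PsiE] := block_lincomb b (fun i => T (b i)).
have PE x y : Psi (col_mx x y) = lincomb b x + T (lincomb b y).
  by rewrite PsiE lfun_lincomb.
have PI : injective Psi.
  apply/lker0P; rewrite -subv0; apply/subvP => w; rewrite memv_ker -[w]vsubmxK PE.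
  rewrite addr_eq0 => /eqP xy.
  have x0 : lincomb b (usubmx w) = 0.
    have /trivP t02' := t02; apply: t02' => //.
    by rewrite xy rpredN; have [] := T0 _ (lb (dsubmx w)).
  have y0 : lincomb b (dsubmx w) = 0.
    by apply: TI => //; apply/eqP; rewrite -oppr_eq0 -xy x0.
  by rewrite (bI _ x0) (bI _ y0) col_mx0 mem0v.
have dcol : \dim {:'cV[R]_(n + n)} = (n + n)%N by rewrite dimvf; apply: muln1.
have PS : limg Psi = fullv.
  by apply: lfun_inj_dim => //; rewrite dcol -dimM.
(* M_0 and M_2 are the coordinate subspaces, M_1 consists of the v + T v, hence [I; I], and M_3 of
   the T v + T^2 v, hence [X; I]. *)
have [s [s0 s1 s2 s3]] : exists s : 'S_4, [/\ s o0 = o0, s o1 = o2, s o2 = o1 & s o3 = o3].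
  exact: perm4_exists.
have isoX : m4_iso (m4_perm s M) (m4_0 X).
  have [||g fg] := @m4_iso_of_total _ (m4_0 X) (m4_perm s M) Psi _ PI PS; last first.
    by apply/m4_isoP; exists g, Psi; apply: m4_inv_sym.
    rewrite m4_perm_total tM /m4_total; under eq_bigr do rewrite m4_0_subdim.
    rewrite !big_ord_recl big_ord0 /= !(tnth_nth 0%N) /= dimM; lia.
  apply: m4_of_mx_hom => y /=; rewrite ?s0 ?s1 ?s2 ?s3 mul_col_mx PE ?mul1mx ?mul0mx
    ?lincomb0 ?linear0 ?addr0 ?add0r //.
  - by have [] := T0 _ (lb y).
  - by have [] := T0 _ (lb y).
  - by rewrite XE addrC; have [] := T2 _ (T0 _ (lb y)).1.
have n0 : (0 < n)%N by have := indec_dim iM; rewrite dimM; lia.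
have hX := m4_0_no_idempotent (indec_iso isoX (m4_perm_indec s iM)).
(* A kernel vector of [X] would give a vector of M_2 and M_3, and an eigenvector for 1 a vector of
   M_1 and M_3. *)
have XI (y : 'cV_n) : X *m y = 0 -> y = 0.
  move=> Xy; have := XE y; rewrite Xy lincomb0 => /esym TT0; apply: bI; apply: TI => //.
  have Tl := (T0 _ (lb y)).1; have /trivP t23 : triv M o2 o3 by apply: t.
  by apply: t23 => //; have [_] := T2 _ Tl; rewrite TT0 addr0.
have X1I (y : 'cV_n) : X *m y - y = 0 -> y = 0.
  move=> /subr0_eq Xy; have := XE y; rewrite Xy => yE; apply: bI.
  have [Tl l1] := T0 _ (lb y); have [_ l3] := T2 _ Tl.
  have /trivP t13 : triv M o1 o3 by apply: t.
  have l0 : lincomb b y + T (lincomb b y) = 0.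
    by apply: t13 => //; rewrite {1}yE addrC.
  have /trivP t02' := t02; apply: t02' => //.
  by move/eqP: l0; rewrite addr_eq0 => /eqP ->; rewrite rpredN.
have [L [tL isoL]] := m4_0_table n0 hX XI X1I.
apply: (@iso_listed_perm _ s); apply: iso_listed_table tL _.
exact: m4_iso_trans isoX isoL.
Qed.

Lemma pair_perm (a b : 'I_4) : a != b -> exists s : 'S_4, s o0 = a /\ s o1 = b.
Proof.
move=> ab; pose t := tperm o0 a; exists (tperm o1 (t b) * t)%g.
have tb : t b != o0.
  by apply/eqP => tb; case/eqP: ab; rewrite -[b](tpermK o0 a) -/t tb tpermL.
by rewrite !permM tpermL tpermK [tperm o1 (t b) o0]tpermD // tpermL.
Qed.

Lemma defect_zero_listed M : indec M -> m4_total M = (2 * m4_dim M)%N -> iso_listed M.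
Proof.
move=> iM tM.
have [[a [b [x [ab x0 xa xb]]]]|none] := pselect (exists a b (x : M),
    [/\ a != b, x != 0, x \in m4_sub M a & x \in m4_sub M b]); last first.
  apply: homogeneous_listed => // i j ij; apply/trivP => x xi xj.
  by apply/eqP/negPn/negP => x0; apply: none; exists i, j, x.
have [s [sa sb]] := pair_perm ab.
apply: (@iso_listed_perm _ s); set N := m4_perm s M.
have iN : indec N := m4_perm_indec s iM.
have tN : m4_total N = (2 * m4_dim N)%N by rewrite m4_perm_total.
have x0N : (x : N) \in m4_sub N o0 by rewrite /= sa.
have x1N : (x : N) \in m4_sub N o1 by rewrite /= sb.
have [[/trivP t01 _]|[t02 t13 t03 t12]] := cross_triv_indec iN tN (isT : uniq [:: o0; o1; o2; o3]).
  by move: x0; rewrite (t01 x x0N x1N) eqxx.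
have f02 := triv_full (isT : uniq [:: o1; o3; o0; o2]) tN t13 t02.
have f12 := triv_full (isT : uniq [:: o0; o3; o1; o2]) tN t03 t12.
have f03 := triv_full (isT : uniq [:: o1; o2; o0; o3]) tN t12 t03.
have [T oT] := odd_endo_exists t02 t12 t03 f02 f12 f03.
apply: (nilpotent_listed iN tN oT t02 f02 x0 x0N).
have [T0 _ _ _] := oT; have [Tx xTx] := T0 x x0N.
(* As x also lies in M_1, so does T x = (x + T x) - x; but T x is in M_2, so it vanishes. *)
have /trivP t := t12; apply: t => //.
by rewrite -[T x](addKr x) rpredD // rpredN.
Qed.

Theorem indec_iso_listed M : indec M -> iso_listed M.
Proof.
move=> iM; case: (ltngtP (m4_total M) (2 * m4_dim M)%N) => tM.
- exact: defect_neg_listed.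
- exact: defect_pos_listed.
- exact: defect_zero_listed.
Qed.

Lemma listed_decomp M : exists k (L : 'I_k -> module4 R),
  (forall i, m4_listed (L i)) /\ m4_iso M (m4_sum L).
Proof.
have [k [Q [iQ MQ]]] := indec_decomp M.
pose L i := sval (cid (indec_iso_listed (iQ i))).
have LP i : m4_listed (L i) /\ m4_iso (Q i) (L i).
  exact: svalP (cid (indec_iso_listed (iQ i))).
exists k, L; split=> [i|]; first by have [] := LP i.
by apply: m4_iso_trans MQ _; apply: m4_sum_iso => i; have [] := LP i.
Qed.

End Homogeneous.

Theorem theorem1p14 (R : realType) :
  [/\ (forall H H' : bl_datum R,
         bl_equiv H H' <-> m4_iso (bl_module H) (bl_module H')),
      (forall M : module4 R, exists H : bl_datum R, m4_iso (bl_module H) M),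
      (forall H : bl_datum R,
         (exists (k : nat) (M : 'I_k -> module4 R),
            (forall i, m4_listed (M i)) /\ m4_iso (bl_module H) (m4_sum M)) /\
         (forall (k k' : nat) (M : 'I_k -> module4 R) (M' : 'I_k' -> module4 R),
            (forall i, m4_listed (M i)) -> m4_iso (bl_module H) (m4_sum M) ->
            (forall i, m4_listed (M' i)) -> m4_iso (bl_module H) (m4_sum M') ->
            exists s : 'I_k -> 'I_k',
              bijective s /\ forall i, m4_iso (M i) (M' (s i)))) &
      (forall (k : nat) (M : 'I_k -> module4 R),
         (forall i, m4_listed (M i)) ->
         exists H : bl_datum R,
           m4_iso (bl_module H) (m4_sum M) /\
           forall H' : bl_datum R,
             m4_iso (bl_module H') (m4_sum M) -> bl_equiv H H')].
Proof.
split.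
- exact: bl_equiv_module.
- exact: bl_module_surj.
- move=> H; split; first exact: listed_decomp.
  move=> k k' M M' lM HM lM' HM'.
  apply: krull_schmidt => [i|i|]; [exact: listed_indec|exact: listed_indec|].
  exact: m4_iso_trans (m4_iso_sym HM) HM'.
- move=> k M _; have [H HM] := bl_module_surj (m4_sum M); exists H; split=> // H' H'M.
  by apply/bl_equiv_module; apply: m4_iso_trans HM (m4_iso_sym H'M).
Qed.
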